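(* Let $C>0$ be a constant. For each $n$, let $m=m(n)$ be a positive integer and set $\phi=\sqrt{m/n}$, and assume $n^{1/C}\le \phi\le n^{C}$. Let $Z=Z^{(n)}$ be an $n\times m$ random matrix whose entries $Z_{ij}$ are i.i.d. and satisfy, for every integer $p\ge 1$, $$\mathbb{E}[Z_{ij}]=0,\qquad \mathbb{E}[Z_{ij}^2]=\frac1n,\qquad \mathbb{E}[Z_{ij}^{2p}]\le \frac{C_p}{n^p},$$ where the constants $C_p$ do not depend on $n$. Let $s_1$ denote the largest singular value of $Z$. Then for any fixed arbitrarily small $\delta>0$, with high probability $$|s_1-(\phi+1)|\le \frac{n^{\delta}}{n^{2/3}},$$ provided $n$ is large enough.
   Context: An event $\Omega=\Omega^{(n)}$ holds ''with high probability'' if for every constant $D>0$ one has $\mathbb{P}(\Omega)\ge 1-n^{-D}$ for all $n$ large enough. *)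

(* Defs.v *)
From HB Require Import structures.
From mathcomp Require Import all_boot all_order all_algebra.
From mathcomp Require Import all_classical all_reals all_analysis.
Set Implicit Arguments. Unset Strict Implicit. Unset Printing Implicit Defensive.
Import Order.TTheory GRing.Theory Num.Theory.
Local Open Scope classical_set_scope.
Local Open Scope ring_scope.

(* Mutual independence of a finite family of real random variables:
   the product rule for every choice of Borel sets (choosing B i = setT
   recovers the product rule for every subfamily). *)
Definition mutually_independent d (T : measurableType d) (R : realType)
  (P : probability T R) (I : finType) (X : I -> T -> R) : Prop :=
  forall B : I -> set R, (forall i, measurable (B i)) ->
    P (\bigcap_(i in [set: I]) (X i @^-1` B i)) =
    ((\prod_(i : I) fine (P (X i @^-1` B i)))%:E).

Definition identically_distributed d (T : measurableType d) (R : realType)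
  (P : probability T R) (I : Type) (X : I -> T -> R) : Prop :=
  forall i j (B : set R), measurable B -> P (X i @^-1` B) = P (X j @^-1` B).

Definition largest_singular_value (R : realType) (n m : nat)
  (A : 'M[R]_(n, m)) : R :=
  Num.sqrt (sup [set a : R | eigenvalue (A *m A^T) a]).

Definition phi_ratio (R : realType) (n m : nat) : R :=
  Num.sqrt (m%:R / n%:R).

(* Main.v *)
(* The columns z_1, ..., z_m of Z are added one at a time, and the spectrum of
   A_k = z_1 z_1^T + ... + z_k z_k^T is followed.  For a label th, let s_k be the
   normalized trace of (u_k - A_k)^-1 at a point u_k that starts at 1/th and moves
   by (1/n)/(1 - s_k).  By the rank-one update formula the increments of s_k are
   then centered quadratic forms in the new column, up to second-order terms, so
   high moments of martingales show that s_k stays near th and that u_k stays near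
   the line 1/th + (k/n)/(1 - th).  The envelope of these lines is the Marchenko-
   Pastur edge (1 + sqrt(k/n))^2; only labels whose line is still above a barrier
   slightly beyond the edge are tracked.  Frobenius norms of resolvents, which
   govern the fluctuations, are bounded by comparing s_k for two nearby labels.
   The same comparison shows that an eigenvalue above the barrier is impossible:
   it alone would separate s_k for the lines closest to the barrier by too much.
   Conversely, if all eigenvalues stayed well below the edge, the slope of the
   Stieltjes transform could not double between the lines at distances of order
   4, 16 and 64 from the edge, as the square root singularity of the edge requires.
   The barrier exceeds the edge by a factor 1 + O(n^(-2/3 + o(1))), and the union
   bound over times and labels costs only a power of n. *)
Require Import Defs.
From HB Require Import structures.
From mathcomp Require Import all_boot all_order all_algebra.
From mathcomp Require Import all_classical all_reals all_analysis.
From mathcomp Require Import measurable_realfun complex spectral ring lra.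
Import Order.TTheory GRing.Theory Num.Theory.
Local Open Scope classical_set_scope.
Local Open Scope ring_scope.

(** The shift of the point is dictated by a cancellation of drifts. Moving the point by del lowers
    the normalized trace by about del t2, with t2 the normalized trace of the squared resolvent; the
    new column raises it by about (1/n) t2 / (1 - s_k); del = (1/n)/(1 - s_k) balances the two. The
    lines u = 1/th + (k/n)/(1 - th) are the Marchenko-Pastur equation solved for u at the Stieltjes
    value th. The obstacle is a circle. The noise of a step is controlled by Frobenius norms of
    resolvents; these are controlled only while the spectrum is below the barrier and several labels
    have behaved well; and that rests on small noise in the past. Hence the probabilistic input
    [concentrated] takes the Frobenius bounds as premises, enforced by truncation in its proof, and
    a deterministic strong induction over time, for one fixed sample, discharges these premises.
    Conditional expectations are avoided: even moments of quadratic forms are expanded into finitely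
    many products, and the independence of the new column from the past is applied to each
    product. *)

(** * Independence of functions of disjoint groups of variables *)

Lemma indep_g_sigma (d : measure_display) (T : measurableType d) (R : realType)
  (P : probability T R) (G : set (set T)) (B : set T) :
  G `<=` measurable -> G setT -> setI_closed G -> measurable B ->
  (forall A, G A -> P (A `&` B) = (P A * P B)%E) ->
  forall A, <<s G >> A -> P (A `&` B) = (P A * P B)%E.
Proof.
move=> Gm GT GI mB GB A sA.
have fB : P B = (fine (P B))%:E by rewrite fineK // fin_num_measure.
have PB0 : 0 <= fine (P B) by rewrite fine_ge0.
pose m1 := mrestr P mB.
pose m2 := mscale (NngNum PB0) P.
have m12 : forall C, m2 C = (P C * P B)%E.
  by move=> C; rewrite /m2 /mscale /= -fB muleC.
rewrite -m12.
apply: (@g_sigma_algebra_measure_unique _ _ _ G Gm (fun=> setT) _ _ m1 m2) => //.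
- by rewrite bigcup_const.
- by move=> C GC; rewrite -[LHS]/(P (C `&` B)) GB // -m12.
- move=> k; rewrite /= /mrestr setTI.
  by rewrite fB ltry.
Qed.

Section indep_groups.
Context {d : measure_display} {T : measurableType d} {R : realType}.
Context (P : probability T R) {I : finType} (X : I -> T -> R).

(** A pi-system containing the whole space and generating the sigma-algebra of the variables [X i]
    with [S i]. Keeping [B] indexed by all of [I], with [setT] outside [S], lets the product rule of
    [mutually_independent] apply directly. *)
Definition cylinders (S : pred I) : set (set T) :=
  [set A | exists B : I -> set R, [/\ forall i, measurable (B i),
     forall i, ~~ S i -> B i = setT & A = \bigcap_(i in [set: I]) (X i @^-1` B i)]].

Lemma cylindersT S : cylinders S setT.
Proof.
exists (fun=> setT); split => //.
by apply/seteqP; split => // x _ i _.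
Qed.

Lemma cylindersI S : setI_closed (cylinders S).
Proof.
move=> A A' [B [mB BT ->]] [B' [mB' BT' ->]].
exists (fun i => B i `&` B' i); split.
- by move=> i; exact: measurableI.
- by move=> i Si; rewrite BT // BT' // setIT.
- apply/seteqP; split => x.
    by move=> [h h'] i _; split; [exact: h|exact: h'].
  by move=> h; split => i iI; have [] := h i iI.
Qed.

Hypothesis mX : forall i, measurable_fun setT (X i).

Lemma cylinders_measurable S : cylinders S `<=` measurable.
Proof.
move=> A [B [mB _ ->]].
apply: fin_bigcap_measurable => [|i _]; first exact: finite_finset.
by rewrite -[X in measurable X]setTI; exact: mX.
Qed.

Hypothesis indX : mutually_independent P X.

Lemma indep_cylinders (S S' : pred I) A A' : (forall i, ~~ (S i && S' i)) ->
  cylinders S A -> cylinders S' A' -> P (A `&` A') = (P A * P A')%E.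
Proof.
move=> dis [B [mB BT ->]] [B' [mB' BT' ->]].
pose B'' i := B i `&` B' i.
have mB'' i : measurable (B'' i) by exact: measurableI.
transitivity (P (\bigcap_(i in [set: I]) (X i @^-1` B'' i))).
  congr (P _); apply/seteqP; split => x.
    by move=> [h h'] i _; split; [exact: h|exact: h'].
  by move=> h; split => i iI; have [] := h i iI.
rewrite !indX // -EFinM -big_split /=; congr EFin.
apply: eq_bigr => i _; rewrite /B''.
have [Si|Si] := boolP (S i).
  have S'i : ~~ S' i by have := dis i; rewrite Si.
  by rewrite (BT' _ S'i) setIT preimage_setT probability_setT /= mulr1.
by rewrite (BT _ Si) setTI preimage_setT probability_setT /= mul1r.
Qed.

(** Uniqueness of measures on a pi-system is used twice, extending the product rule from cylinders
    to the generated sigma-algebra in one argument at a time. *)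
Lemma indep_sigma_cylinders (S S' : pred I) A A' : (forall i, ~~ (S i && S' i)) ->
  <<s cylinders S >> A -> <<s cylinders S' >> A' -> P (A `&` A') = (P A * P A')%E.
Proof.
move=> dis sA sA'.
have sub S0 : <<s cylinders S0 >> `<=` measurable.
  by apply: smallest_sub; [exact: sigma_algebra_measurable|exact: cylinders_measurable].
apply: (@indep_g_sigma _ _ _ P (cylinders S)) => //.
- exact: cylinders_measurable.
- exact: cylindersT.
- exact: cylindersI.
- exact: sub sA'.
move=> C SC.
rewrite setIC muleC.
apply: (@indep_g_sigma _ _ _ P (cylinders S')) => //.
- exact: cylinders_measurable.
- exact: cylindersT.
- exact: cylindersI.
- exact: (cylinders_measurable _ _ SC).
move=> C' SC'; rewrite setIC muleC.
exact: (indep_cylinders _ _ _ _ dis).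
Qed.

(** The same points with a coarser sigma-algebra: measurability of a map out of [gcyl S] expresses
    that it depends only on the [X i] with [S i]. Adaptedness to the past is stated in this way. *)
Definition gcyl (S : pred I) := g_sigma_algebraType (cylinders S).

Lemma measurable_cyl (S : pred I) i : S i ->
  measurable_fun setT (X i : gcyl S -> R).
Proof.
move=> Si _ B mB; rewrite setTI.
apply: sub_sigma_algebra; exists (fun j => if j == i then B else setT); split.
- by move=> j; case: ifP.
- by move=> j Sj; case: eqP => // ji; move: Sj; rewrite ji Si.
- apply/seteqP; split => x.
    by move=> h j _; case: eqP => [->|] //.
  by move=> /(_ i Logic.I); rewrite /= eqxx.
Qed.

Lemma measurable_gcyl_mono (S S' : pred I) (F : T -> R) : (forall i, S i -> S' i) ->
  measurable_fun setT (F : gcyl S -> R) -> measurable_fun setT (F : gcyl S' -> R).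
Proof.
move=> SS' mF _ B mB; have := mF measurableT B mB.
apply: sub_smallest2r; first exact: smallest_sigma_algebra.
move=> A [C [mC CT ->]]; exists C; split => // i S'i.
by apply: CT; apply: contra S'i; exact: SS'.
Qed.

Lemma measurable_gcyl (S : pred I) (F : T -> R) :
  measurable_fun setT (F : gcyl S -> R) -> measurable_fun setT F.
Proof.
move=> mF _ B mB; have := mF measurableT B mB.
apply: smallest_sub; first exact: sigma_algebra_measurable.
exact: cylinders_measurable.
Qed.

End indep_groups.

(** The joint law and the product of the marginal laws agree on rectangles, hence everywhere;
    integrating [z.1 * z.2] against the product law factorizes by Fubini. *)
Lemma indep_RintegralM (d : measure_display) (T : measurableType d) (R : realType)
  (P : probability T R) (X Y : T -> R) :
  (forall A B, measurable A -> measurable B ->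
     P (X @^-1` A `&` Y @^-1` B) = (P (X @^-1` A) * P (Y @^-1` B))%E) ->
  P.-integrable setT (EFin \o X) -> P.-integrable setT (EFin \o Y) ->
  P.-integrable setT (EFin \o (fun w => X w * Y w)) ->
  (\int[P]_w (X w * Y w) = (\int[P]_w X w) * (\int[P]_w Y w))%R.
Proof.
move=> ind iX iY iXY.
have mX : measurable_fun setT X by apply/measurable_EFinP; exact: measurable_int iX.
have mY : measurable_fun setT Y by apply/measurable_EFinP; exact: measurable_int iY.
have mXY : measurable_fun setT (fun w => (X w, Y w)) by exact: measurable_fun_pair.
pose X' : {mfun T >-> R} := mfun_Sub (mem_set mX).
pose Y' : {mfun T >-> R} := mfun_Sub (mem_set mY).
pose XY' : {mfun T >-> (R * R)%type} := mfun_Sub (mem_set mXY).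
pose m1 : probability R R := distribution P (X' : {RV P >-> R}).
pose m2 : probability R R := distribution P (Y' : {RV P >-> R}).
pose mu : probability (R * R)%type R := distribution P (XY' : {RV P >-> (R * R)%type}).
pose f (z : R * R) := (z.1 * z.2)%:E.
have mf : measurable_fun setT f.
  by apply/measurable_EFinP; apply: measurable_funM.
have E : forall A, measurable A -> (m1 \x m2)%E A = mu A.
  by move=> A mA; apply: product_measure_unique.
have i1 : m1.-integrable setT (EFin : R -> \bar R).
  by apply: integrable_pushforward => //; rewrite ?preimage_setT.
have i2 : m2.-integrable setT (EFin : R -> \bar R).
  by apply: integrable_pushforward => //; rewrite ?preimage_setT.
have imu : mu.-integrable setT f.
  by apply: integrable_pushforward => //; rewrite ?preimage_setT.
have e1 : (\int[m1]_x x%:E = \int[P]_w (X w)%:E)%E.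
  by rewrite /m1 /distribution integral_pushforward //.
have e2 : (\int[m2]_x x%:E = \int[P]_w (Y w)%:E)%E.
  by rewrite /m2 /distribution integral_pushforward //.
have e3 : (\int[mu]_x f x = \int[P]_w (X w * Y w)%:E)%E.
  by rewrite /mu /distribution integral_pushforward //.
have i12 : (m1 \x m2)%E.-integrable setT f.
  apply/integrableP; split => //.
  rewrite (eq_measure_integral mu) //; last by move=> A mA _; exact: E.
  by case/integrableP: imu.
have i1f : (\int[m1]_x x%:E)%E \is a fin_num by exact: integrable_fin_num.
have i2f : (\int[m2]_x x%:E)%E \is a fin_num by exact: integrable_fin_num.
have inner x : (\int[m2]_y f (x, y) = x%:E * \int[m2]_y y%:E)%E.
  by rewrite -integralZl.
have key : (\int[P]_w (X w * Y w)%:E = (\int[m1]_x x%:E) * (\int[m2]_x x%:E))%E.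
  rewrite -e3.
  rewrite -(@eq_measure_integral _ _ _ _ mu (m1 \x m2)%E) //; last first.
    by move=> A mA _; exact: E.
  rewrite -integral12_prod_meas1 //.
  transitivity (\int[m1]_x (x%:E * \int[m2]_y y%:E))%E.
    by apply: eq_integral => x _; exact: inner.
  by rewrite -(fineK i2f) integralZr.
rewrite /Rintegral key -e1 -e2 fineM //.
Qed.

(** * Even moments of sums of two variables *)

Lemma normrX_even (R : realType) (N : nat) (x : R) : ~~ odd N -> `|x| ^+ N = x ^+ N.
Proof. by move=> eN; rewrite -normrX ger0_norm // exprn_even_ge0. Qed.

(** The term linear in [y] is kept exactly, because its expectation vanishes for martingale
    increments. Each later binomial term is at most [x ^+ N * y ^+ 2 + y ^+ N.+2], as seen by
    comparing |x| with |y|, and the coefficients sum to at most 2^(N+2). *)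
Lemma exprD_even_le (R : realType) (N : nat) (x y : R) : ~~ odd N ->
  (x + y) ^+ N.+2 <= x ^+ N.+2 + (x ^+ N.+1 * y) *+ N.+2
     + 2 ^+ N.+2 * (x ^+ N * y ^+ 2 + y ^+ N.+2).
Proof.
move=> eN.
have eN2 : ~~ odd N.+2 by rewrite /= negbK.
have term i : (i <= N)%N -> x ^+ (N - i) * y ^+ i.+2 <= x ^+ N * y ^+ 2 + y ^+ N.+2.
  move=> iN; apply: le_trans (ler_norm _) _; rewrite normrM !normrX.
  rewrite -(normrX_even _ _ x eN) -(normrX_even _ _ y eN2) -(normrX_even _ 2 y) //.
  have [le|/ltW le] := leP `|y| `|x|.
    apply: le_trans (_ : `|x| ^+ (N - i) * (`|x| ^+ i * `|y| ^+ 2) <= _).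
      rewrite ler_wpM2l ?exprn_ge0 // -addn2 exprD ler_wpM2r ?exprn_ge0 //.
      by rewrite lerXn2r ?nnegrE.
    by rewrite mulrA -exprD subnK // lerDl exprn_ge0.
  apply: le_trans (_ : `|y| ^+ (N - i) * `|y| ^+ i.+2 <= _).
    by rewrite ler_wpM2r ?exprn_ge0 // lerXn2r ?nnegrE.
  by rewrite -exprD addnS addnS subnK // lerDr mulr_ge0 ?exprn_ge0.
rewrite exprDn big_ord_recl big_ord_recl /=.
rewrite /bump /= !subn0 bin0 bin1 expr0 mulr1 mulr1n expr1 subn1 /= addrA lerD2l.
set c := x ^+ N * y ^+ 2 + y ^+ N.+2.
have c0 : 0 <= c.
  by apply: addr_ge0; [apply: mulr_ge0; [exact: exprn_even_ge0|exact: sqr_ge0]|exact: exprn_even_ge0].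
apply: le_trans (_ : \sum_(i < N.+1) (c *+ 'C(N.+2, i.+2)) <= _).
  apply: ler_sum => i _; rewrite !add1n lerMn2r; apply/orP; right.
  by rewrite !subSS; apply: term; rewrite -ltnS.
have -> : \sum_(i < N.+1) (c *+ 'C(N.+2, i.+2)) = c *+ (\sum_(i < N.+1) 'C(N.+2, i.+2))%N.
  by rewrite sumrMnr.
rewrite -[2 ^+ _]natrX mulr_natl; apply: ler_wpMn2l => //.
have -> : (2 ^ N.+2)%N = (\sum_(i < N.+3) 'C(N.+2, i))%N.
  rewrite -[2%N]/(1 + 1)%N expnDn; apply: eq_bigr => i _.
  by rewrite !exp1n !muln1.
rewrite [X in (_ <= X)%N]big_ord_recl [X in (_ <= _ + X)%N]big_ord_recl addnA.
exact: leq_addl.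
Qed.

Section moments.
Context {d : measure_display} {T : measurableType d} {R : realType}.
Context (P : probability T R).
Implicit Types X Y : T -> R.

(** Asking for all powers at once makes the class closed under sums and products, so that
    integrability never has to be tracked degree by degree. *)
Definition all_moments X :=
  measurable_fun setT X /\ forall k, P.-integrable setT (EFin \o (fun w => X w ^+ k)).

Local Notation E X := (\int[P]_w X w)%R.

Lemma am_measurable X : all_moments X -> measurable_fun setT X.
Proof. by case. Qed.

Lemma am_integrable X : all_moments X -> P.-integrable setT (EFin \o X).
Proof.
by move=> [_ /(_ 1%N)]; congr (P.-integrable setT (EFin \o _)); apply/funext => w.
Qed.

Lemma am_integrable_norm X k : all_moments X ->
  P.-integrable setT (EFin \o (fun w => `|X w| ^+ k)).
Proof.
move=> [_ /(_ k)] /integrable_norm; congr (P.-integrable setT (EFin \o _)).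
by apply/funext => w /=; rewrite normrX.
Qed.

Lemma integrable_dominated X Y : measurable_fun setT X ->
  P.-integrable setT (EFin \o Y) -> (forall w, `|X w| <= Y w) ->
  P.-integrable setT (EFin \o X).
Proof.
move=> mX iY XY; apply: le_integrable iY => //; first exact/measurable_EFinP.
by move=> w _ /=; rewrite lee_fin; apply: le_trans (XY w) (ler_norm _).
Qed.

Lemma am_cst c : all_moments (fun=> c).
Proof.
split=> [|k]; first exact: measurable_cst.
exact: finite_measure_integrable_cst.
Qed.

Lemma am_M X Y : all_moments X -> all_moments Y -> all_moments (fun w => X w * Y w).
Proof.
move=> aX aY; have [mX iX] := aX; have [mY iY] := aY.
split=> [|k]; first exact: measurable_funM.
apply: (@integrable_dominated _ (fun w => X w ^+ (k + k) + Y w ^+ (k + k))).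
- by apply: measurable_funX; exact: measurable_funM.
- have := integrableD measurableT (iX (k + k)%N) (iY (k + k)%N).
  by congr (P.-integrable setT _).
- move=> w; rewrite exprMn normrM !exprD -!expr2.
  rewrite -[X w ^+ k ^+ 2]real_normK ?num_real // -[Y w ^+ k ^+ 2]real_normK ?num_real //.
  have := normr_ge0 (X w ^+ k); have := normr_ge0 (Y w ^+ k).
  by move: `|_| `|_| => a b a0 b0; nra.
Qed.

Lemma am_D X Y : all_moments X -> all_moments Y -> all_moments (fun w => X w + Y w).
Proof.
move=> aX aY; have [mX iX] := aX; have [mY iY] := aY.
split=> [|k]; first exact: measurable_funD.
apply: (@integrable_dominated _ (fun w => 2 ^+ k * (`|X w| ^+ k + `|Y w| ^+ k))).
- by apply: measurable_funX; exact: measurable_funD.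
- have := integrableZl measurableT (2 ^+ k) (integrableD measurableT
    (am_integrable_norm _ k aX) (am_integrable_norm _ k aY)).
  by congr (P.-integrable setT _).
- move=> w; rewrite normrX.
  have h : `|X w + Y w| <= 2 * Num.max `|X w| `|Y w|.
    apply: le_trans (ler_normD _ _) _.
    by rewrite mulr2n mulrDl mul1r lerD // le_max lexx ?orbT.
  apply: le_trans (_ : (2 * Num.max `|X w| `|Y w|) ^+ k <= _).
    by rewrite lerXn2r ?nnegrE // mulr_ge0 // le_max normr_ge0.
  rewrite exprMn ler_wpM2l ?exprn_ge0 //.
  by case: (leP `|X w|) => _; rewrite ?lerDl ?lerDr exprn_ge0.
Qed.

Lemma am_Z c X : all_moments X -> all_moments (fun w => c * X w).
Proof. by apply: am_M; exact: am_cst. Qed.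

Lemma am_X X k : all_moments X -> all_moments (fun w => X w ^+ k).
Proof.
move=> aX; elim: k => [|k IH]; first exact: am_cst.
by have := am_M _ _ aX IH; congr all_moments; apply/funext => w; rewrite exprS.
Qed.

Lemma am_sum (J : Type) (s : seq J) (Q : pred J) (F : J -> T -> R) :
  (forall j, Q j -> all_moments (F j)) -> all_moments (fun w => \sum_(j <- s | Q j) F j w).
Proof.
move=> aF; elim: s => [|j s IH].
  by have := am_cst 0; congr all_moments; apply/funext => w; rewrite big_nil.
have [Qj|Qj] := boolP (Q j).
  by have := am_D _ _ (aF _ Qj) IH; congr all_moments; apply/funext => w; rewrite big_cons Qj.
by move: IH; congr all_moments; apply/funext => w; rewrite big_cons (negbTE Qj).
Qed.

Lemma am_prod (J : Type) (s : seq J) (Q : pred J) (F : J -> T -> R) :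
  (forall j, Q j -> all_moments (F j)) -> all_moments (fun w => \prod_(j <- s | Q j) F j w).
Proof.
move=> aF; elim: s => [|j s IH].
  by have := am_cst 1; congr all_moments; apply/funext => w; rewrite big_nil.
have [Qj|Qj] := boolP (Q j).
  by have := am_M _ _ (aF _ Qj) IH; congr all_moments; apply/funext => w; rewrite big_cons Qj.
by move: IH; congr all_moments; apply/funext => w; rewrite big_cons (negbTE Qj).
Qed.

Lemma am_bounded X b : measurable_fun setT X -> (forall w, `|X w| <= b) -> all_moments X.
Proof.
move=> mX Xb; split=> // k.
apply: (@integrable_dominated _ (fun=> b ^+ k)).
- exact: measurable_funX.
- exact: finite_measure_integrable_cst.
- by move=> w; rewrite normrX lerXn2r ?nnegrE //; apply: le_trans (Xb w).
Qed.

Lemma E_D X Y : all_moments X -> all_moments Y -> E (fun w => X w + Y w) = E X + E Y.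
Proof. by move=> aX aY; rewrite -RintegralD //; exact: am_integrable. Qed.

Lemma E_Z c X : all_moments X -> E (fun w => c * X w) = c * E X.
Proof. by move=> aX; rewrite -RintegralZl //; exact: am_integrable. Qed.

Lemma E_cst c : E (fun=> c) = c.
Proof.
transitivity (c * fine (P setT)); first exact: Rintegral_cst.
by rewrite probability_setT mulr1.
Qed.

Lemma E_le X Y : all_moments X -> all_moments Y -> (forall w, X w <= Y w) -> E X <= E Y.
Proof. by move=> aX aY XY; apply: le_Rintegral => //; exact: am_integrable. Qed.

Lemma E_ge0 X : (forall w, 0 <= X w) -> 0 <= E X.
Proof. by move=> X0; apply: Rintegral_ge0. Qed.

Lemma E_sum (J : Type) (s : seq J) (Q : pred J) (F : J -> T -> R) :
  (forall j, Q j -> all_moments (F j)) ->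
  E (fun w => \sum_(j <- s | Q j) F j w) = \sum_(j <- s | Q j) E (F j).
Proof.
move=> aF; elim: s => [|j s IH].
  by rewrite big_nil -[RHS](E_cst 0); congr Rintegral; apply/funext => w; rewrite big_nil.
rewrite big_cons; have [Qj|Qj] := boolP (Q j).
  rewrite -IH -E_D //; last exact: am_sum.
    by congr Rintegral; apply/funext => w; rewrite big_cons Qj.
  exact: aF.
by rewrite -IH; congr Rintegral; apply/funext => w; rewrite big_cons (negbTE Qj).
Qed.

(* A discrete Burkholder inequality: in L^(2p), p = q+1, the squared norm of a
   sum of orthogonal-type increments grows at most additively. *)
Lemma moment_increment (q : nat) (M xi : T -> R) (A B : R) :
  all_moments M -> all_moments xi -> 0 < A -> 0 < B ->
  E (fun w => M w ^+ (2 * q.+1)) <= A ^+ q.+1 ->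
  E (fun w => xi w ^+ (2 * q.+1)) <= B ^+ q.+1 ->
  E (fun w => M w ^+ (2 * q).+1 * xi w) = 0 ->
  E (fun w => (M w + xi w) ^+ (2 * q.+1)) <= (A + 2 ^+ (2 * q + 5) * B) ^+ q.+1.
Proof.
move=> aM axi A0 B0 hM hxi h0.
have e2 : (2 * q.+1 = (2 * q).+2)%N by rewrite mulnS.
rewrite !e2 in hM hxi *.
have ev : ~~ odd (2 * q) by rewrite mul2n odd_double.
set c : R := 2 ^+ (2 * q).+2.
have c0 : 0 < c by rewrite exprn_gt0.
have step1 : E (fun w => (M w + xi w) ^+ (2 * q).+2) <=
    E (fun w => M w ^+ (2 * q).+2) +
    c * (E (fun w => M w ^+ (2 * q) * xi w ^+ 2) + E (fun w => xi w ^+ (2 * q).+2)).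
  have a1 : all_moments (fun w => M w ^+ (2 * q).+2) by exact: am_X.
  have a2 : all_moments (fun w => M w ^+ (2 * q).+1 * xi w).
    by apply: am_M => //; exact: am_X.
  have a3 : all_moments (fun w => M w ^+ (2 * q) * xi w ^+ 2).
    by apply: am_M => //; exact: am_X.
  have a4 : all_moments (fun w => xi w ^+ (2 * q).+2) by exact: am_X.
  have a34 := am_D _ _ a3 a4.
  have a12 := am_D _ _ a1 (am_Z ((2 * q).+2%:R) _ a2).
  rewrite -E_D // -E_Z //.
  rewrite -[X in _ <= X + _]addr0 -[X in _ <= _ + X + _](mulr0 ((2 * q).+2%:R)) -h0 -E_Z //.
  rewrite -E_D //; last exact: am_Z.
  rewrite -E_D //; last exact: am_Z.
  apply: E_le.
  - by apply: am_X; exact: am_D.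
  - by apply: am_D => //; exact: am_Z.
  by move=> w; rewrite mulr_natl; exact: exprD_even_le.
(* Young's inequality by cases: the mixed term is absorbed by the power of M^2 or of xi^2 according
   to which of M^2/A and xi^2/B is larger. *)
have young : E (fun w => M w ^+ (2 * q) * xi w ^+ 2) <= 2 * (A ^+ q * B).
  have pw w : M w ^+ (2 * q) * xi w ^+ 2 <=
      (B / A) * M w ^+ (2 * q).+2 + (A ^+ q / B ^+ q) * xi w ^+ (2 * q).+2.
    have x0 : 0 <= M w ^+ 2 by exact: sqr_ge0.
    have y0 : 0 <= xi w ^+ 2 by exact: sqr_ge0.
    rewrite -e2 !exprM; move: (M w ^+ 2) (xi w ^+ 2) x0 y0 => x y x0 y0.
    have [le|/ltW le] := leP (y * A) (x * B).
      apply: le_trans (_ : B / A * x ^+ q.+1 <= _); last first.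
        by rewrite lerDl mulr_ge0 ?exprn_ge0 // divr_ge0 // exprn_ge0 // ltW.
      rewrite exprSr mulrCA ler_wpM2l ?exprn_ge0 //.
      by rewrite mulrAC ler_pdivlMr // [B * x]mulrC.
    apply: le_trans (_ : A ^+ q / B ^+ q * y ^+ q.+1 <= _); last first.
      by rewrite lerDr mulr_ge0 ?exprn_ge0 // divr_ge0 // ltW.
    rewrite exprSr mulrA ler_wpM2r //.
    rewrite mulrAC ler_pdivlMr ?exprn_gt0 // -!exprMn.
    by rewrite lerXn2r ?nnegrE ?mulr_ge0 // ?(ltW A0) ?(ltW B0) // [A * y]mulrC.
  apply: le_trans (_ : E (fun w => (B / A) * M w ^+ (2 * q).+2 + (A ^+ q / B ^+ q) * xi w ^+ (2 * q).+2) <= _).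
    apply: E_le => //.
      by apply: am_M; exact: am_X.
    by apply: am_D; apply: am_Z; exact: am_X.
  rewrite E_D; [|by apply: am_Z; exact: am_X|by apply: am_Z; exact: am_X].
  rewrite E_Z; last exact: am_X.
  rewrite E_Z; last exact: am_X.
  rewrite [2 * _]mulr_natl mulr2n lerD //.
    apply: le_trans (ler_wpM2l _ hM) _; first by rewrite divr_ge0 ?ltW.
    by rewrite exprSr mulrA mulrAC divfK ?gt_eqF // mulrC.
  apply: le_trans (ler_wpM2l _ hxi) _; first by rewrite divr_ge0 ?exprn_ge0 ?ltW.
  by rewrite exprSr mulrA divfK ?gt_eqF // ?exprn_gt0.
apply: le_trans step1 _.
apply: le_trans (_ : A ^+ q.+1 + c * (2 * (A ^+ q * B) + B ^+ q.+1) <= _).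
  by rewrite lerD // ler_wpM2l ?(ltW c0) // lerD.
set K : R := 2 ^+ (2 * q + 5).
have KE : K = 8 * c.
  have e5 : (2 * q + 5 = 3 + (2 * q).+2)%N by rewrite -[(2 * q).+2]addn2 addnCA.
  by rewrite /K e5 exprD; congr (_ * _); rewrite -natrX.
have K1 : 1 <= K by rewrite /K exprn_ege1 // ler1n.
have AB : 0 <= K * B by rewrite mulr_ge0 ?(ltW B0) // (le_trans ler01).
rewrite [X in _ <= X]exprSr [X in _ <= X]mulrDr.
have h1 : A ^+ q.+1 <= (A + K * B) ^+ q * A.
  by rewrite exprSr ler_wpM2r ?(ltW A0) // lerXn2r ?nnegrE ?addr_ge0 ?(ltW A0) // lerDl.
rewrite lerD //.
have h2 : A ^+ q <= (A + K * B) ^+ q.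
  by rewrite lerXn2r ?nnegrE ?addr_ge0 ?(ltW A0) // lerDl.
have h3 : B ^+ q <= (A + K * B) ^+ q.
  rewrite lerXn2r ?nnegrE ?addr_ge0 ?(ltW A0) ?(ltW B0) //.
  apply: le_trans (_ : K * B <= _); last by rewrite lerDr (ltW A0).
  by rewrite ler_peMl // (ltW B0).
rewrite exprSr mulrA -mulrDl mulrA [X in _ <= X]mulrA ler_wpM2r ?(ltW B0) //.
set S := (A + K * B) ^+ q in h2 h3 *; rewrite KE.
have : c * A ^+ q <= c * S by rewrite ler_wpM2l ?(ltW c0).
have : c * B ^+ q <= c * S by rewrite ler_wpM2l ?(ltW c0).
have : 0 <= c * S by rewrite mulr_ge0 ?(ltW c0) // (le_trans _ h2) // exprn_ge0 // ltW.
by nra.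
Qed.

End moments.

Lemma ler_sumR (R : realType) (J : Type) (r : seq J) (Q : pred J) (F G : J -> R) :
  (forall i, Q i -> F i <= G i) -> \sum_(i <- r | Q i) F i <= \sum_(i <- r | Q i) G i.
Proof. by move=> FG; apply: ler_sum. Qed.

Lemma measurable_sum_cond (d : measure_display) (T : measurableType d) (R : realType)
  (D : set T) (J : Type) (s : seq J) (Q : pred J) (F : J -> T -> R) :
  (forall j, Q j -> measurable_fun D (F j)) ->
  measurable_fun D (fun w => \sum_(j <- s | Q j) F j w).
Proof.
move=> mF; rewrite (_ : (fun w => _) = fun w => \sum_(j <- s) (if Q j then F j w else 0)).
  apply: measurable_sum => j; case: (Q j) (mF j) => h; first exact: h.
  exact: measurable_cst.
by apply/funext => w; rewrite big_mkcond.
Qed.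

Lemma measurable_prod_cond (d : measure_display) (T : measurableType d) (R : realType)
  (D : set T) (J : eqType) (s : seq J) (Q : pred J) (F : J -> T -> R) :
  (forall j, Q j -> measurable_fun D (F j)) ->
  measurable_fun D (fun w => \prod_(j <- s | Q j) F j w).
Proof.
move=> mF; rewrite (_ : (fun w => _) = fun w => \prod_(j <- s) (if Q j then F j w else 1)).
  apply: measurable_prod => j _; case: (Q j) (mF j) => h; first exact: h.
  exact: measurable_cst.
by apply/funext => w; rewrite big_mkcond.
Qed.

Lemma normrD_even_le (R : realType) (p : nat) (x y : R) :
  (x + y) ^+ (2 * p) <= 4 ^+ p * (x ^+ (2 * p) + y ^+ (2 * p)).
Proof.
rewrite !exprM.
apply: le_trans (_ : (4 * Num.max (x ^+ 2) (y ^+ 2)) ^+ p <= _).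
  have h : (x + y) ^+ 2 <= 4 * Num.max (x ^+ 2) (y ^+ 2).
    by have [] := leP (x ^+ 2) (y ^+ 2) => h; nra.
  by rewrite lerXn2r ?nnegrE ?sqr_ge0 // (le_trans _ h) // sqr_ge0.
rewrite exprMn ler_wpM2l ?exprn_ge0 //.
by case: (leP (x ^+ 2) (y ^+ 2)) => _; rewrite ?lerDl ?lerDr exprn_ge0 // sqr_ge0.
Qed.

Lemma sum_triangle (V : nmodType) (n : nat) (f : 'I_n -> 'I_n -> V) :
  \sum_i \sum_l f i l = \sum_i (f i i + \sum_(l < n | (l < i)%N) (f i l + f l i)).
Proof.
rewrite (eq_bigr (fun i => f i i + (\sum_(l < n | (l < i)%N) f i l + \sum_(l < n | (i < l)%N) f i l))).
  rewrite big_split /= big_split /= [in RHS]big_split /=; congr (_ + _).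
  under [in RHS]eq_bigr do rewrite big_split /=.
  rewrite big_split /=; congr (_ + _).
  by rewrite (exchange_big_dep predT).
move=> i _; rewrite (bigD1 i) //=; congr (_ + _).
rewrite (bigID (fun l : 'I_n => (l < i)%N)) /=; congr (_ + _); apply: eq_bigl => l.
  by rewrite -val_eqE /=; case: ltngtP.
by rewrite -val_eqE /=; case: ltngtP.
Qed.

Lemma big_ord_lt_recr (V : nmodType) (N : nat) (F : 'I_N -> V) (k : 'I_N) :
  \sum_(j < N | (j < k.+1)%N) F j = \sum_(j < N | (j < k)%N) F j + F k.
Proof.
rewrite (bigD1 k) //= addrC; congr (_ + _); apply: eq_bigl => j.
by rewrite ltnS [RHS]ltn_neqAle andbC.
Qed.

Lemma exprDn_le (R : realType) (p : nat) (x y : R) : 0 <= x -> 0 <= y ->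
  x ^+ p.+1 + y ^+ p.+1 <= (x + y) ^+ p.+1.
Proof.
move=> x0 y0; rewrite [X in _ <= X]exprS mulrDl lerD // exprS ler_wpM2l // lerXn2r ?nnegrE ?addr_ge0 //.
  by rewrite lerDl.
by rewrite lerDr.
Qed.

Lemma exprn_even_ge0_mul2 (R : realType) (k : nat) (x : R) : 0 <= x ^+ (2 * k).
Proof. by rewrite exprn_even_ge0 // mul2n odd_double. Qed.

(** * Even moments of martingales *)

Section martingale.
Context {d : measure_display} {T : measurableType d} {R : realType}.
Context (P : probability T R).
Local Notation E X := (\int[P]_w X w)%R.

Definition Kmart (q : nat) : R := 1 + 2 * 2 ^+ (2 * q + 5).

Lemma Kmart_ge1 q : 1 <= Kmart q.
Proof. by rewrite /Kmart lerDl mulr_ge0 // exprn_ge0. Qed.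

(** Iteration of [moment_increment]. That lemma wants strictly positive bounds, so each [b j] is
    raised by [c = a / k.+1]; the raised bounds still sum to at most [2 * a], which is the factor 2
    in [Kmart]. *)
Lemma martingale_moment (q N : nat) (xi : 'I_N -> T -> R) (b : 'I_N -> R) (a : R) (k : nat) :
  (k <= N)%N -> 0 < a ->
  (forall j : 'I_N, (j < k)%N -> all_moments P (xi j)) ->
  (forall j : 'I_N, (j < k)%N -> 0 <= b j) ->
  (forall j : 'I_N, (j < k)%N -> E (fun w => xi j w ^+ (2 * q.+1)) <= b j ^+ q.+1) ->
  (forall j : 'I_N, (j < k)%N ->
     E (fun w => (\sum_(i < N | (i < j)%N) xi i w) ^+ (2 * q).+1 * xi j w) = 0) ->
  \sum_(j < N | (j < k)%N) b j <= a ->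
  E (fun w => (\sum_(j < N | (j < k)%N) xi j w) ^+ (2 * q.+1)) <= (Kmart q * a) ^+ q.+1.
Proof.
move=> kN a0 axi b0 bxi ortho ba.
set K2 : R := 2 ^+ (2 * q + 5).
have K20 : 0 < K2 by rewrite exprn_gt0.
pose c : R := a / k.+1%:R.
have c0 : 0 < c by rewrite divr_gt0.
pose A l := a + K2 * \sum_(j < N | (j < l)%N) (b j + c).
have A0 l : (l <= k)%N -> 0 < A l.
  move=> lk; rewrite /A ltr_pwDl // mulr_ge0 ?(ltW K20) // sumr_ge0 // => j jl.
  by rewrite addr_ge0 ?(ltW c0) // b0 // (leq_trans jl).
have main l : (l <= k)%N ->
    E (fun w => (\sum_(j < N | (j < l)%N) xi j w) ^+ (2 * q.+1)) <= A l ^+ q.+1.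
  elim: l => [_|l IH lk].
    rewrite (_ : (fun w => _) = fun=> 0) ?E_cst.
      by rewrite exprn_ge0 // ltW // A0.
    by apply/funext => w; rewrite big_pred0 // expr0n muln_eq0.
  have lN : (l < N)%N by exact: leq_trans kN.
  pose j0 := Ordinal lN.
  rewrite (_ : (fun w => _) = fun w => (\sum_(j < N | (j < l)%N) xi j w + xi j0 w) ^+ (2 * q.+1)); last first.
    by apply/funext => w; rewrite (big_ord_lt_recr _ _ (fun j => xi j w) j0).
  have -> : A l.+1 = A l + K2 * (b j0 + c).
    by rewrite /A (big_ord_lt_recr _ _ _ j0) mulrDr addrA.
  apply: moment_increment => //.
  - by apply: am_sum => j jl; apply: axi; exact: ltn_trans lk.
  - exact: axi.
  - by apply: A0; exact: ltnW.
  - by rewrite ltr_wpDl // b0.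
  - by apply: IH; exact: ltnW.
  - apply: le_trans (bxi j0 lk) _; rewrite lerXn2r ?nnegrE ?addr_ge0 ?(ltW c0) ?b0 //.
    by rewrite lerDl (ltW c0).
  - exact: (ortho j0).
apply: le_trans (main k (leqnn k)) _.
have Kq0 : 0 <= Kmart q * a by rewrite mulr_ge0 ?(ltW a0) // (le_trans ler01) // Kmart_ge1.
rewrite lerXn2r ?nnegrE ?(ltW (A0 k (leqnn k))) //.
rewrite /A /Kmart -/K2 mulrDl mul1r lerD2l [2 * K2]mulrC -mulrA ler_wpM2l ?(ltW K20) //.
rewrite big_split /= mulr2n mulrDl mul1r lerD //.
rewrite sumr_const -[X in X <= _]mulr_natl /c mulrCA ler_piMr ?(ltW a0) //.
rewrite ler_pdivrMr // mul1r ler_nat.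
rewrite cardE /= -(size_map val).
apply: leq_trans (_ : size (iota 0 k) <= _)%N; last by rewrite size_iota.
apply: uniq_leq_size.
  by rewrite map_inj_uniq ?enum_uniq //; exact: val_inj.
by move=> x /mapP[j]; rewrite mem_enum mem_iota => jk ->.
Qed.

End martingale.

(** * Moments and tails of quadratic forms in the columns of the array *)

Section array.
Context {d : measure_display} {T : measurableType d} {R : realType}.
Context (P : probability T R) (n m : nat) (Z : 'I_n -> 'I_m -> T -> R).
Local Notation E X := (\int[P]_w X w)%R.
Local Notation ent := (fun ij : 'I_n * 'I_m => Z ij.1 ij.2).

Hypothesis mZ : forall i j, measurable_fun setT (Z i j).
Hypothesis indZ : mutually_independent P ent.
Hypothesis aZ : forall i j, all_moments P (Z i j).

Let ment ij : measurable_fun setT (ent ij). Proof. exact: mZ. Qed.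

Lemma indep_EM (S S' : pred ('I_n * 'I_m)) (F G : T -> R) :
  (forall x, ~~ (S x && S' x)) ->
  measurable_fun setT (F : gcyl ent S -> R) -> all_moments P F ->
  measurable_fun setT (G : gcyl ent S' -> R) -> all_moments P G ->
  E (fun w => F w * G w) = E F * E G.
Proof.
move=> dis mF aF mG aG; apply: indep_RintegralM.
- move=> A B mA mB; apply: (indep_sigma_cylinders P ent ment indZ S S') => //.
    by have := mF measurableT A mA; rewrite setTI.
  by have := mG measurableT B mB; rewrite setTI.
- exact: am_integrable.
- exact: am_integrable.
- by apply: am_integrable; exact: am_M.
Qed.

Variables (v mu : R).
Hypothesis v0 : 0 < v.
Hypothesis EZ : forall i j, E (Z i j) = 0.
Hypothesis EZ2 : forall i j, E (fun w => Z i j w ^+ 2) = v.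

Definition past (j : 'I_m) : pred ('I_n * 'I_m) := fun x => (x.2 < j)%N.

Definition quad (j : 'I_m) (B : 'I_n -> 'I_n -> T -> R) (w : T) : R :=
  \sum_i \sum_l B i l w * (Z i j w * Z l j w - (i == l)%:R * v).

Lemma measurable_ent_cyl (S : pred ('I_n * 'I_m)) i j : S (i, j) ->
  measurable_fun setT (Z i j : gcyl ent S -> R).
Proof. by move=> Sij; exact: (measurable_cyl ent S (i, j)). Qed.

Lemma am_pair i l j : all_moments P (fun w => Z i j w * Z l j w - (i == l)%:R * v).
Proof. by apply: am_D; [exact: am_M|exact: am_cst]. Qed.

Lemma E_pair i l j : E (fun w => Z i j w * Z l j w - (i == l)%:R * v) = 0.
Proof.
rewrite E_D; [|exact: am_M|exact: am_cst]; rewrite E_cst.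
have [<-|il] := eqVneq i l.
  rewrite mul1r -[X in X - _](_ : E (fun w => Z i j w ^+ 2) = _) ?EZ2 ?subrr //.
rewrite mul0r subr0 (indep_EM (pred1 (i, j)) (pred1 (l, j))) ?EZ ?mul0r //.
- move=> x /=; apply/negP => /andP[/eqP -> /eqP[]] e.
  by move: il; rewrite e eqxx.
- by apply: measurable_ent_cyl => /=.
- by apply: measurable_ent_cyl => /=.
Qed.

Variable q : nat.
Hypothesis mu1 : 1 <= mu.
Hypothesis momZ : forall i j, E (fun w => Z i j w ^+ (2 * q.+1)) <= (mu * v) ^+ q.+1.
Hypothesis momZ2 : forall i j,
  E (fun w => (Z i j w ^+ 2 - v) ^+ (2 * q.+1)) <= ((mu * v) ^+ 2) ^+ q.+1.

Lemma linear_moment (j : 'I_m) (c : 'I_n -> R) (k : nat) (a : R) : (k <= n)%N -> 0 < a ->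
  \sum_(l < n | (l < k)%N) c l ^+ 2 <= a ->
  E (fun w => (\sum_(l < n | (l < k)%N) c l * Z l j w) ^+ (2 * q.+1)) <=
    (Kmart q * (mu * v * a)) ^+ q.+1.
Proof.
move=> kn a0 ca.
have mv0 : 0 < mu * v by rewrite mulr_gt0 // (lt_le_trans ltr01).
apply: (martingale_moment P q n (fun l w => c l * Z l j w) (fun l => mu * v * c l ^+ 2)) => //.
- by rewrite mulr_gt0.
- by move=> l _; exact: am_Z.
- by move=> l _; rewrite mulr_ge0 ?sqr_ge0 ?(ltW mv0).
- move=> l _; rewrite (_ : (fun w => _) = fun w => c l ^+ (2 * q.+1) * Z l j w ^+ (2 * q.+1)).
    rewrite E_Z; last exact: am_X.
    rewrite exprMn mulrC -exprM ler_wpM2r //.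
    by rewrite exprn_even_ge0 // mul2n odd_double.
  by apply/funext => w; rewrite exprMn.
- move=> l lk.
  rewrite (indep_EM (fun x => (x.1 < l)%N && (x.2 == j)) (pred1 (l, j))).
  + by rewrite E_Z // EZ mulr0 mulr0.
  + by move=> [x y] /=; apply/negP => /andP[/andP[xl _] /eqP[e _]]; move: xl; rewrite e ltnn.
  + apply: measurable_funX; apply: measurable_sum_cond => i il.
    apply: measurable_funM => //; apply: measurable_ent_cyl.
    by rewrite /= il eqxx.
  + by apply: am_X; apply: am_sum => i _; exact: am_Z.
  + apply: measurable_funM => //; apply: measurable_ent_cyl.
    by rewrite /= eqxx.
  + exact: am_Z.
- by rewrite -mulr_sumr ler_wpM2l // ltW.
Qed.

(** Ordering the rows turns the form into a martingale: the increment of row i is [Z i j] times a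
    linear form in the earlier entries of the column, plus the centered diagonal term. The linear
    forms are themselves martingales, handled by [linear_moment], which accounts for the second
    factor [Kmart q]. *)
Lemma quad_const_moment (j : 'I_m) (B : 'I_n -> 'I_n -> R) (b : R) : 0 < b ->
  \sum_i \sum_l B i l ^+ 2 <= b ->
  E (fun w => quad j (fun i l _ => B i l) w ^+ (2 * q.+1)) <=
    (24 * Kmart q ^+ 2 * (mu * v) ^+ 2 * b) ^+ q.+1.
Proof.
move=> b0 Bb; have K1 : 1 <= Kmart q :> R := Kmart_ge1 q.
have K0 : 0 < Kmart q :> R by exact: lt_le_trans K1.
have mv0 : 0 < mu * v by rewrite mulr_gt0 // (lt_le_trans ltr01).
pose c i l := B i l + B l i.
pose al (i : 'I_n) w := \sum_(l < n | (l < i)%N) c i l * Z l j w.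
pose xi i w := Z i j w * al i w + B i i * (Z i j w ^+ 2 - v).
(* A positive filler: [S i] may vanish while [linear_moment] asks for a positive variance bound. The
   n copies of [e] add up to at most [b]. *)
pose e := b / n.+1%:R.
have e0 : 0 < e by rewrite divr_gt0.
pose S (i : 'I_n) := \sum_(l < n | (l < i)%N) c i l ^+ 2.
have S0 i : 0 <= S i by rewrite sumr_ge0 // => l _; exact: sqr_ge0.
pose bb i := 4 * (Kmart q * (mu * v) ^+ 2 * (S i + e) + B i i ^+ 2 * (mu * v) ^+ 2).
have aal i : all_moments P (al i) by apply: am_sum => l _; exact: am_Z.
have aZ2 i : all_moments P (fun w => Z i j w ^+ 2 - v).
  by apply: am_D; [exact: am_X|exact: am_cst].
have axi i : all_moments P (xi i).
  by apply: am_D; [exact: am_M|exact: am_Z].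
have Sb : \sum_i S i <= 2 * b.
  apply: le_trans (_ : 2 * \sum_i \sum_l B i l ^+ 2 <= _); last by rewrite ler_wpM2l.
  have -> : \sum_i \sum_l B i l ^+ 2 =
      \sum_i (B i i ^+ 2 + \sum_(l < n | (l < i)%N) (B i l ^+ 2 + B l i ^+ 2)).
    exact: (sum_triangle _ _ (fun i l => B i l ^+ 2)).
  rewrite mulr_sumr; refine (ler_sumR _ _ _ _ _ _ _) => i _.
  rewrite mulrDr mulr_sumr -[X in X <= _]add0r; apply: lerD.
    by apply: mulr_ge0 => //; exact: sqr_ge0.
  refine (ler_sumR _ _ _ _ _ _ _) => l _.
  by rewrite /c; have := sqr_ge0 (B i l - B l i); nra.
have Bd : \sum_i B i i ^+ 2 <= b.
  apply: le_trans Bb; refine (ler_sumR _ _ _ _ _ _ _) => i _.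
  by rewrite (bigD1 i) //= lerDl sumr_ge0 // => l _; exact: sqr_ge0.
have quadE w : quad j (fun i l _ => B i l) w = \sum_(i < n | (i < n)%N) xi i w.
  rewrite /quad sum_triangle [RHS](eq_bigl predT); last by move=> i; exact: ltn_ord.
  apply: eq_bigr => i _; rewrite /xi eqxx mul1r -expr2 addrC; congr (_ + _).
  rewrite /al mulr_sumr; apply: eq_bigr => l li.
  have il : i != l by rewrite -val_eqE /= gtn_eqF.
  have li0 : (l == i) = false by rewrite eq_sym (negbTE il).
  by rewrite (negbTE il) li0 /c !mul0r !subr0; ring.
under eq_Rintegral => w _ do rewrite quadE.
have bbsum : \sum_(i < n | (i < n)%N) bb i <= 24 * Kmart q * (mu * v) ^+ 2 * b.
  rewrite (eq_bigl predT); last by move=> i; exact: ltn_ord.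
  rewrite /bb -mulr_sumr big_split /= -mulr_sumr -mulr_suml big_split /=.
  have eb : \sum_(i < n) e <= b.
    rewrite sumr_const card_ord -mulr_natl /e mulrCA ler_piMr ?(ltW b0) //.
    by rewrite ler_pdivrMr // mul1r ler_nat.
  set s1 := \sum_i S i in Sb *; set s2 := \sum_(i < n) e in eb *.
  set s3 := \sum_i B i i ^+ 2 in Bd *; set t := (mu * v) ^+ 2.
  have t0 : 0 < t by rewrite exprn_gt0.
  have h1 : Kmart q * t * (s1 + s2) <= Kmart q * t * (3 * b).
    apply: ler_wpM2l; last by lra.
    by apply: mulr_ge0; exact: ltW.
  have h2 : s3 * t <= Kmart q * (t * b).
    apply: le_trans (_ : t * b <= _); first by rewrite mulrC ler_wpM2l // (ltW t0).
    by rewrite ler_peMl // mulr_ge0 ?(ltW t0) ?(ltW b0).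
  have h3 : 0 <= Kmart q * (t * b).
    by apply: mulr_ge0; [exact: ltW|apply: mulr_ge0; exact: ltW].
  by move: h1 h2 h3; nra.
have -> : 24 * Kmart q ^+ 2 * (mu * v) ^+ 2 * b = Kmart q * (24 * Kmart q * (mu * v) ^+ 2 * b).
  by ring.
apply: (martingale_moment P q n xi bb) => //.
- apply: mulr_gt0 => //; apply: mulr_gt0; last exact: exprn_gt0.
  exact: mulr_gt0.
- move=> i _; apply: mulr_ge0 => //; apply: addr_ge0; apply: mulr_ge0; try exact: sqr_ge0.
    by apply: mulr_ge0; [exact: ltW|exact: sqr_ge0].
  by apply: addr_ge0 => //; exact: ltW.
- move=> i _; rewrite /bb /xi.
  have a1 : all_moments P (fun w => Z i j w * al i w) by exact: am_M.
  have a2 : all_moments P (fun w => B i i * (Z i j w ^+ 2 - v)) by exact: am_Z.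
  apply: le_trans (_ : E (fun w => 4 ^+ q.+1 * ((Z i j w * al i w) ^+ (2 * q.+1) +
      (B i i * (Z i j w ^+ 2 - v)) ^+ (2 * q.+1))) <= _).
    apply: E_le; [by apply: am_X; exact: am_D| |by move=> w; exact: normrD_even_le].
    by apply: am_Z; apply: am_D; exact: am_X.
  rewrite E_Z; last by apply: am_D; exact: am_X.
  rewrite E_D; [|exact: am_X|exact: am_X].
  rewrite [X in _ <= X]exprMn ler_wpM2l ?exprn_ge0 //.
  apply: le_trans (exprDn_le _ _ _ _ _ _); last first.
  + by apply: mulr_ge0; exact: sqr_ge0.
  + apply: mulr_ge0; first by apply: mulr_ge0; [exact: ltW|exact: sqr_ge0].
    by apply: addr_ge0 => //; exact: ltW.
  apply: lerD.
    rewrite (_ : (fun w => _) = fun w => Z i j w ^+ (2 * q.+1) * al i w ^+ (2 * q.+1)); last first.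
      by apply/funext => w; rewrite exprMn.
    rewrite (indep_EM (pred1 (i, j)) (fun x => (x.1 < i)%N && (x.2 == j))).
    + have := linear_moment j (c i) i (S i + e) (ltnW (ltn_ord i)).
      rewrite ltr_wpDl // lerDl (ltW e0) => /(_ isT isT) h.
      rewrite (_ : _ * (S i + e) = (mu * v) * (Kmart q * (mu * v * (S i + e)))); last by ring.
      rewrite [X in _ <= X]exprMn.
      apply: ler_pM => //; apply: E_ge0 => w; exact: exprn_even_ge0_mul2.
    + by move=> [x y] /=; apply/negP => /andP[/eqP[-> _]]; rewrite ltnn.
    + by apply: measurable_funX; apply: measurable_ent_cyl => /=.
    + exact: am_X.
    + apply: measurable_funX; apply: measurable_sum_cond => l li.
      apply: measurable_funM => //; apply: measurable_ent_cyl.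
      by rewrite /= li eqxx.
    + exact: am_X.
  rewrite (_ : (fun w => _) = fun w => B i i ^+ (2 * q.+1) * (Z i j w ^+ 2 - v) ^+ (2 * q.+1)); last first.
    by apply/funext => w; rewrite exprMn.
  rewrite E_Z; last exact: am_X.
  rewrite [X in _ <= X]exprMn -exprM ler_wpM2l //.
  exact: exprn_even_ge0_mul2.
- move=> i _.
  pose Sm w := (\sum_(l < n | (l < i)%N) xi l w) ^+ (2 * q).+1.
  have aSm : all_moments P Sm by apply: am_X; apply: am_sum => l _; exact: axi.
  pose C0 : pred ('I_n * 'I_m) := fun x => (x.1 < i)%N && (x.2 == j).
  have mZc (l : 'I_n) : (l < i)%N -> measurable_fun setT (Z l j : gcyl ent C0 -> R).
    by move=> li; apply: measurable_ent_cyl; rewrite /C0 /= li eqxx.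
  have malc (l : 'I_n) : (l <= i)%N -> measurable_fun setT (al l : gcyl ent C0 -> R).
    move=> li; apply: measurable_sum_cond => k kl.
    by apply: measurable_funM => //; apply: mZc; exact: leq_trans li.
  have mSm : measurable_fun setT (Sm : gcyl ent C0 -> R).
    apply: measurable_funX; apply: measurable_sum_cond => l li.
    apply: measurable_funD.
      by apply: measurable_funM; [exact: mZc|apply: malc; exact: ltnW].
    apply: measurable_funM => //; apply: measurable_funB => //.
    by apply: measurable_funX; exact: mZc.
  rewrite (_ : (fun w => _) = fun w => (Sm w * al i w) * Z i j w + B i i * (Sm w * (Z i j w ^+ 2 - v))); last first.
    by apply/funext => w; rewrite -/(Sm w) /xi; ring.
  have dis x : ~~ (C0 x && pred1 (i, j) x).
    by apply/negP => /andP[/andP[xi' _] /eqP e']; move: xi'; rewrite e' /= ltnn.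
  have mZi : measurable_fun setT (Z i j : gcyl ent (pred1 (i, j)) -> R).
    by apply: measurable_ent_cyl => /=.
  rewrite E_D; [|by apply: am_M => //; exact: am_M|by apply: am_Z; exact: am_M].
  rewrite E_Z; last exact: am_M.
  rewrite (indep_EM C0 (pred1 (i, j)) (fun w => Sm w * al i w)) //.
  + rewrite EZ mulr0 add0r (indep_EM C0 (pred1 (i, j)) Sm) //.
      rewrite E_D; [|exact: am_X|exact: am_cst].
      by rewrite EZ2 E_cst subrr !mulr0.
    by apply: measurable_funB => //; exact: measurable_funX.
  + by apply: measurable_funM => //; exact: malc.
  + exact: am_M.
Qed.

Lemma quad_expand (j : 'I_m) (B : 'I_n -> 'I_n -> T -> R) (w : T) (N : nat) :
  quad j B w ^+ N = \sum_(g : {ffun 'I_N -> 'I_n * 'I_n})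
    (\prod_a B (g a).1 (g a).2 w) *
    (\prod_a (Z (g a).1 j w * Z (g a).2 j w - ((g a).1 == (g a).2)%:R * v)).
Proof.
rewrite /quad pair_big /= -{1}[N]card_ord -prodr_const bigA_distr_bigA /=.
by apply: eq_bigr => g _; rewrite big_split.
Qed.

Lemma am_prod_pair (j : 'I_m) (N : nat) (g : 'I_N -> 'I_n * 'I_n) :
  all_moments P (fun w => \prod_a (Z (g a).1 j w * Z (g a).2 j w - ((g a).1 == (g a).2)%:R * v)).
Proof. by apply: am_prod => a _; exact: am_pair. Qed.

Lemma measurable_pair_cyl (j : 'I_m) (S : pred ('I_n * 'I_m)) i l :
  S (i, j) -> S (l, j) ->
  measurable_fun setT ((fun w => Z i j w * Z l j w - (i == l)%:R * v) : gcyl ent S -> R).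
Proof.
move=> Si Sl; apply: measurable_funB => //.
by apply: measurable_funM; exact: measurable_ent_cyl.
Qed.

Lemma am_bounded_entry (S : pred ('I_n * 'I_m)) (B : 'I_n -> 'I_n -> T -> R) (b : R) :
  (forall i l, measurable_fun setT (B i l : gcyl ent S -> R)) ->
  (forall w, \sum_i \sum_l B i l w ^+ 2 <= b) ->
  forall i l, all_moments P (B i l).
Proof.
move=> mB Bb i l; apply: (am_bounded _ _ (1 + b)).
  exact: (measurable_gcyl ent ment S).
move=> w; have : B i l w ^+ 2 <= b.
  apply: le_trans (Bb w); rewrite (bigD1 i) //= (bigD1 l) //= -addrA lerDl.
  apply: addr_ge0; first by apply: sumr_ge0 => k _; exact: sqr_ge0.
  by apply: sumr_ge0 => k _; apply: sumr_ge0 => k' _; exact: sqr_ge0.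
rewrite -(real_normK (num_real _)); have := normr_ge0 (B i l w).
by move: `|_| => x; nra.
Qed.

(** Freezing the past without conditional expectations. In the expanded power every product splits
    into coefficients depending on the past and entries of column j, so its expectation factorizes.
    Replacing only the column factors by their expectations gives, for each [w], exactly the moment
    of the form with the constant coefficients [B i l w], which [quad_const_moment] bounds
    uniformly; it remains to integrate over [w]. *)
Lemma quad_moment (j : 'I_m) (B : 'I_n -> 'I_n -> T -> R) (b : R) :
  (forall i l, measurable_fun setT (B i l : gcyl ent (past j) -> R)) -> 0 <= b ->
  (forall w, \sum_i \sum_l B i l w ^+ 2 <= b) ->
  E (fun w => quad j B w ^+ (2 * q.+1)) <= (24 * Kmart q ^+ 2 * (mu * v) ^+ 2 * b) ^+ q.+1.
Proof.
move=> mB; rewrite le_eqVlt => /orP[/eqP <- Bb|b0 Bb].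
  have B0 i l w : B i l w = 0.
    apply/eqP; rewrite -sqrf_eq0 eq_le sqr_ge0 andbT; apply: le_trans (Bb w).
    rewrite (bigD1 i) //= (bigD1 l) //= -addrA lerDl.
    apply: addr_ge0; first by apply: sumr_ge0 => k _; exact: sqr_ge0.
    by apply: sumr_ge0 => k _; apply: sumr_ge0 => k' _; exact: sqr_ge0.
  rewrite mulr0 expr0n /= (_ : (fun w => _) = fun=> 0) ?E_cst //.
  apply/funext => w; rewrite /quad big1 ?expr0n // => i _.
  by rewrite big1 // => l _; rewrite B0 mul0r.
set rhs := (_ ^+ q.+1).
pose N := (2 * q.+1)%N.
pose y (g : {ffun 'I_N -> 'I_n * 'I_n}) w :=
  \prod_a (Z (g a).1 j w * Z (g a).2 j w - ((g a).1 == (g a).2)%:R * v).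
have ay g : all_moments P (y g) by exact: am_prod_pair.
have aB := am_bounded_entry _ _ _ mB Bb.
pose Bp (g : {ffun 'I_N -> 'I_n * 'I_n}) w := \prod_a B (g a).1 (g a).2 w.
have aBp g : all_moments P (Bp g) by apply: am_prod => a _; exact: aB.
have pol w : \sum_g Bp g w * E (y g) <= rhs.
  apply: le_trans (quad_const_moment j (fun i l => B i l w) b b0 (Bb w)).
  rewrite le_eqVlt; apply/orP; left; apply/eqP.
  under [RHS]eq_Rintegral => w' _ do rewrite quad_expand.
  rewrite E_sum => [|g _]; last by apply: am_Z; exact: am_prod_pair.
  by apply: eq_bigr => g _; rewrite E_Z //; exact: am_prod_pair.
under eq_Rintegral => w _ do rewrite quad_expand.
rewrite E_sum => [|g _]; last by apply: am_M; [exact: aBp|exact: am_prod_pair].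
rewrite (eq_bigr (fun g => E (fun w => Bp g w * E (y g)))) => [|g _].
  rewrite -E_sum => [|g _]; last by apply: am_M; [exact: aBp|exact: am_cst].
  rewrite -[leRHS](E_cst P); apply: E_le => //; last exact: am_cst.
  by apply: am_sum => g _; apply: am_M; [exact: aBp|exact: am_cst].
rewrite (indep_EM (past j) (fun x => x.2 == j)) //.
- rewrite (_ : (fun w => Bp g w * E (y g)) = fun w => E (y g) * Bp g w); last first.
    by apply/funext => w; rewrite mulrC.
  by rewrite E_Z // mulrC.
- by move=> x; apply/negP => /andP[xj /eqP e]; move: xj; rewrite /past e ltnn.
- refine (measurable_prod_cond _ (gcyl ent (past j)) _ _ 'I_N _ _ (fun a w => B (g a).1 (g a).2 w) _) => a _; exact: mB.
- exact: aBp.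
- refine (measurable_prod_cond _ (gcyl ent (fun x => x.2 == j)) _ _ 'I_N _ _ (fun a w => Z (g a).1 j w * Z (g a).2 j w - ((g a).1 == (g a).2)%:R * v) _) => a _.
  by apply: measurable_pair_cyl => /=.
- exact: am_prod_pair.
Qed.

Definition Kquad : R := 24 * Kmart q ^+ 3.

(** The forms of successive columns are martingale increments: the partial sum and the coefficients
    depend on earlier columns only, and every centered product within column j has mean zero by
    [E_pair]. *)
Lemma quad_sum_moment (B : 'I_m -> 'I_n -> 'I_n -> T -> R) (b : 'I_m -> R) (k : nat) (a : R) :
  (k <= m)%N -> 0 < a ->
  (forall j : 'I_m, (j < k)%N ->
    forall i l, measurable_fun setT (B j i l : gcyl ent (past j) -> R)) ->
  (forall j : 'I_m, (j < k)%N -> 0 <= b j) ->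
  (forall j : 'I_m, (j < k)%N -> forall w, \sum_i \sum_l B j i l w ^+ 2 <= b j) ->
  \sum_(j < m | (j < k)%N) b j <= a ->
  E (fun w => (\sum_(j < m | (j < k)%N) quad j (B j) w) ^+ (2 * q.+1)) <=
    (Kquad * (mu * v) ^+ 2 * a) ^+ q.+1.
Proof.
move=> km a0 mB b0 Bb ba.
have K0 : 0 < Kmart q :> R by exact: lt_le_trans (Kmart_ge1 q).
have mv0 : 0 < mu * v by rewrite mulr_gt0 // (lt_le_trans ltr01).
have c0 : 0 < 24 * Kmart q ^+ 2 * (mu * v) ^+ 2.
  by apply: mulr_gt0; [apply: mulr_gt0 => //|]; exact: exprn_gt0.
have aB (j : 'I_m) : (j < k)%N -> forall i l, all_moments P (B j i l).
  by move=> jk; exact: (am_bounded_entry _ _ _ (mB j jk) (Bb j jk)).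
have -> : Kquad * (mu * v) ^+ 2 * a = Kmart q * (24 * Kmart q ^+ 2 * (mu * v) ^+ 2 * a).
  by rewrite /Kquad; ring.
apply: (martingale_moment P q m (fun j w => quad j (B j) w)
  (fun j => 24 * Kmart q ^+ 2 * (mu * v) ^+ 2 * b j)) => //.
- exact: mulr_gt0.
- move=> j jk; apply: am_sum => i _; apply: am_sum => l _.
  by apply: am_M; [exact: aB|exact: am_pair].
- by move=> j jk; apply: mulr_ge0; [exact: ltW|exact: b0].
- by move=> j jk; apply: quad_moment; [exact: mB|exact: b0|exact: Bb].
- move=> j jk.
  pose Sm w := (\sum_(i < m | (i < j)%N) quad i (B i) w) ^+ (2 * q).+1.
  have aSm : all_moments P Sm.
    apply: am_X; apply: am_sum => i ij; apply: am_sum => x _; apply: am_sum => l _.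
    by apply: am_M; [apply: aB; exact: ltn_trans jk|exact: am_pair].
  have mSm : measurable_fun setT (Sm : gcyl ent (past j) -> R).
    apply: measurable_funX; apply: measurable_sum_cond => i ij.
    apply: measurable_sum_cond => x _; apply: measurable_sum_cond => l _.
    apply: measurable_funM; last exact: measurable_pair_cyl.
    have := mB i (ltn_trans ij jk) x l.
    apply: measurable_gcyl_mono => z; rewrite /past => zi; exact: ltn_trans ij.
  rewrite (_ : (fun w => _) = fun w => \sum_x \sum_l (Sm w * B j x l w) *
      (Z x j w * Z l j w - (x == l)%:R * v)); last first.
    apply/funext => w; rewrite -/(Sm w) /quad mulr_sumr; apply: eq_bigr => x _.
    by rewrite mulr_sumr; apply: eq_bigr => l _; rewrite mulrA.
  have aSB x l : all_moments P (fun w => Sm w * B j x l w) by apply: am_M => //; exact: aB.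
  rewrite E_sum => [|x _]; last by apply: am_sum => l _; apply: am_M => //; exact: am_pair.
  rewrite big1 // => x _.
  rewrite E_sum => [|l _]; last by apply: am_M => //; exact: am_pair.
  rewrite big1 // => l _.
  rewrite (indep_EM (past j) (fun x => x.2 == j) (fun w => Sm w * B j x l w)) //.
  + by rewrite E_pair mulr0.
  + by move=> z; apply/negP => /andP[zj /eqP e]; move: zj; rewrite /past e ltnn.
  + by apply: measurable_funM => //; exact: mB.
  + by apply: measurable_pair_cyl => /=.
  + exact: am_pair.
- by rewrite -mulr_sumr ler_wpM2l // ltW.
Qed.

(** Markov's inequality for the power [2 * q.+1]. The threshold is [x] times the natural size v
    sqrt(a) of the sum, so that the resulting bound depends neither on [v] nor on [a]. *)
Lemma quad_sum_tail (B : 'I_m -> 'I_n -> 'I_n -> T -> R) (b : 'I_m -> R) (k : nat) (a x : R) :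
  (k <= m)%N -> 0 < a -> 0 < x ->
  (forall j : 'I_m, (j < k)%N ->
    forall i l, measurable_fun setT (B j i l : gcyl ent (past j) -> R)) ->
  (forall j : 'I_m, (j < k)%N -> 0 <= b j) ->
  (forall j : 'I_m, (j < k)%N -> forall w, \sum_i \sum_l B j i l w ^+ 2 <= b j) ->
  \sum_(j < m | (j < k)%N) b j <= a ->
  let Q w := \sum_(j < m | (j < k)%N) quad j (B j) w in
  measurable [set w | x ^+ 2 * (v ^+ 2 * a) < Q w ^+ 2] /\
  (P [set w | (x ^+ 2 * (v ^+ 2 * a) < Q w ^+ 2)%R] <=
    ((Kquad * mu ^+ 2 / x ^+ 2) ^+ q.+1)%:E)%E.
Proof.
move=> km a0 x0 mB b0 Bb ba Q.
have aQ : all_moments P Q.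
  apply: am_sum => j jk; apply: am_sum => i _; apply: am_sum => l _; apply: am_M; last exact: am_pair.
  exact: (am_bounded_entry _ _ _ (mB j jk) (Bb j jk)).
have t0 : 0 < x ^+ 2 * (v ^+ 2 * a).
  by apply: mulr_gt0; [exact: exprn_gt0|apply: mulr_gt0 => //; exact: exprn_gt0].
set t := x ^+ 2 * _ in t0 *.
have mA : measurable [set w | t < Q w ^+ 2].
  rewrite -[X in measurable X]setTI; apply: measurable_fun_ltr => //.
  by apply: measurable_funX; exact: am_measurable aQ.
split=> //.
pose A := [set w | t < Q w ^+ 2].
have aA : all_moments P (\1_A : T -> R).
  apply: (am_bounded _ _ 1) => [|w]; first exact: measurable_indic.
  by rewrite indicE; case: (_ \in _); rewrite ?normr1 ?normr0.
have PA : fine (P A) = E (\1_A).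
  by rewrite /Rintegral integral_indic // setIT.
have hE := quad_sum_moment B b k a km a0 mB b0 Bb ba.
rewrite -[P A]fineK ?fin_num_measure // lee_fin PA.
have ineq : t ^+ q.+1 * E (\1_A) <= (Kquad * (mu * v) ^+ 2 * a) ^+ q.+1.
  rewrite -E_Z //; apply: le_trans hE; apply: E_le; [exact: am_Z|exact: am_X|].
  move=> w; rewrite indicE; case: (boolP (w \in A)) => [|_].
    rewrite inE /A /= mulr1 exprM => h; rewrite lerXn2r ?nnegrE ?sqr_ge0 ?(ltW t0) //.
    exact: ltW.
  by rewrite mulr0 exprn_even_ge0_mul2.
have -> : Kquad * mu ^+ 2 / x ^+ 2 = Kquad * (mu * v) ^+ 2 * a / t.
  by rewrite /t; field; rewrite !gt_eqF.
by rewrite expr_div_n ler_pdivlMr ?exprn_gt0 // mulrC.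
Qed.

End array.

(** * Spectral theory of symmetric matrices and rank-one updates *)

Section spectrum.
Context {R : realType}.

Definition resolvent {n : nat} (A : 'M[R]_n) (u : R) : 'M[R]_n := invmx (u%:M - A).

Definition res_prod {n : nat} (A : 'M[R]_n) (us : seq R) : 'M[R]_n :=
  foldr (fun u M => resolvent A u *m M) 1%:M us.

Definition qform {n : nat} (M : 'M[R]_n) (z : 'cV[R]_n) : R := (z^T *m M *m z) 0 0.

(** An interface in terms of real numbers alone: eigenvectors and the complex field of the
    diagonalization stay hidden behind it. In the last clause the weights, squared moduli of the
    coordinates of [z] in an eigenbasis, do not depend on [u]. *)
Definition spectral_data {n : nat} (A : 'M[R]_n) (lam : 'I_n -> R) : Prop :=
  [/\ forall x, eigenvalue A x <-> exists i, x = lam i,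
      forall k, \tr (iter k (mulmx A) 1%:M) = \sum_i lam i ^+ k,
      forall u, (forall i, lam i != u) -> u%:M - A \in unitmx,
      forall us, (forall u, u \in us -> forall i, lam i != u) ->
        \tr (res_prod A us) = \sum_i \prod_(u <- us) (u - lam i)^-1
    & forall z, exists c : 'I_n -> R, (forall i, 0 <= c i) /\
        forall u, (forall i, lam i != u) ->
          qform (resolvent A u) z = \sum_i c i * (u - lam i)^-1].

Section diagonalized.
Context {C : numClosedFieldType} (rc : {rmorphism R -> C}).
Hypothesis rc_conj : forall x, (rc x)^* = rc x.
Hypothesis rc_norm : forall y : C, exists2 c, 0 <= c & rc c = y * y^*.

(** [F g], the conjugate of the diagonal matrix of [g], is a functional calculus: it respects
    products and differences and has trace the sum of [g]. Resolvents, their products and powers are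
    all of this form, and each clause descends to [R] because [rc] is injective. *)
Lemma diagonalized_spectral_data (n : nat) (A : 'M[R]_n) (Q : 'M[C]_n) (lam : 'I_n -> R) :
  Q \is unitarymx ->
  map_mx rc A = invmx Q *m diag_mx (\row_i rc (lam i)) *m Q -> spectral_data A lam.
Proof.
move=> Qu; set AC := map_mx _ A => FA0.
have Qun : Q \in unitmx by exact: unitarymx_unit.
have rcI : injective rc by exact: fmorph_inj.
pose F (g : 'I_n -> R) := invmx Q *m diag_mx (\row_i rc (g i)) *m Q.
have FA : AC = F lam by exact: FA0.
have FM g h : F g *m F h = F (fun i => g i * h i).
  rewrite /F !mulmxA mulmxK // -[X in X *m Q]mulmxA mulmx_diag.
  by congr (_ *m diag_mx _ *m _); apply/rowP => i; rewrite !mxE rmorphM.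
have Fu u : F (fun=> u) = map_mx rc (u%:M).
  rewrite /F (_ : diag_mx _ = (rc u)%:M); last first.
    by rewrite -diag_const_mx; congr diag_mx; apply/rowP => i; rewrite !mxE.
  by rewrite scalar_mxC -mulmxA mulVmx // mulmx1 map_scalar_mx.
have FD g h : F g - F h = F (fun i => g i - h i).
  rewrite /F -mulmxBl -mulmxBr -raddfB; congr (_ *m diag_mx _ *m _).
  by apply/rowP => i; rewrite !mxE rmorphB.
have Ftr g : \tr (F g) = rc (\sum_i g i).
  rewrite /F mxtrace_mulC mulmxA mulmxV // mul1mx mxtrace_diag rmorph_sum /=.
  by apply: eq_bigr => i _; rewrite mxE.
have un u : (forall i, lam i != u) -> u%:M - A \in unitmx /\
    map_mx rc (resolvent A u) = F (fun i => (u - lam i)^-1).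
  move=> hu; have e : map_mx rc (u%:M - A) *m F (fun i => (u - lam i)^-1) = 1%:M.
    rewrite map_mxB -Fu -/AC FA FD FM.
    rewrite -[RHS](map_mx1 rc) -Fu; congr F; apply/funext => i.
    by rewrite divff // subr_eq0 eq_sym.
  have [h _] := mulmx1_unit e.
  split; first by rewrite map_unitmx in h.
  rewrite /resolvent map_invmx.
  by rewrite -[LHS]mulmx1 -e mulKmx.
have Fprod us : (forall u, u \in us -> forall i, lam i != u) ->
    map_mx rc (res_prod A us) = F (fun i => \prod_(u <- us) (u - lam i)^-1).
  elim: us => [_|u us IH h].
    rewrite /res_prod /= -Fu; congr F; apply/funext => i; by rewrite big_nil.
  rewrite /res_prod /= map_mxM IH => [|v vus]; last by apply: h; rewrite inE vus orbT.
  rewrite (un u (h u _)).2 ?inE ?eqxx // FM; congr F; apply/funext => i.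
  by rewrite big_cons.
have Fpow k : map_mx rc (iter k (mulmx A) 1%:M) = F (fun i => lam i ^+ k).
  elim: k => [|k IH]; first by rewrite /= -Fu; congr F; apply/funext => i; rewrite expr0.
  by rewrite /= map_mxM IH -/AC FA FM; congr F; apply/funext => i; rewrite exprS.
split.
- move=> x; split.
    have [//|nex] := pselect (exists i, x = lam i).
    move=> /eigenvalueP[w wA w0]; exfalso.
    have hu i : lam i != x by apply/eqP => e; apply: nex; exists i.
    have [ux _] := un x hu.
    have : w *m (x%:M - A) = 0 by rewrite mulmxBr wA mul_mx_scalar subrr.
    by move=> /(congr1 (mulmx^~ (invmx (x%:M - A)))); rewrite mulmxK // mul0mx => /eqP; rewrite (negbTE w0).
  move=> [i ->]; have : ~~ (A - (lam i)%:M \in unitmx).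
    rewrite -(map_unitmx rc) map_mxB -/AC FA -Fu FD /F.
    rewrite unitmx_mul Qun andbT unitmx_mul unitmx_inv Qun /=.
    rewrite unitmxE det_diag unitfE negbK (bigD1 i) //= mxE subrr rmorph0 mul0r //.
  rewrite /eigenvalue /eigenspace kermx_eq0 row_free_unit //.
- move=> k; apply: rcI; rewrite -trace_map_mx Fpow Ftr //.
- by move=> u /un[].
- move=> us hus; apply: rcI; rewrite -trace_map_mx Fprod // Ftr //.
- move=> z; pose y := Q *m map_mx rc z.
  have cP i : exists c, 0 <= c /\ rc c = y i 0 * (y i 0)^*.
    by have [c c0 cE] := rc_norm (y i 0); exists c.
  pose c i := projT1 (cid (cP i)).
  have c0 i : 0 <= c i by have [] := projT2 (cid (cP i)).
  have cE i : rc (c i) = y i 0 * (y i 0)^* by have [] := projT2 (cid (cP i)).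
  exists c; split=> // u hu; apply: rcI; rewrite /qform.
  transitivity ((map_mx rc (z^T *m resolvent A u *m z)) 0 0); first by rewrite [RHS]mxE.
  rewrite !map_mxM (un u hu).2 /F invmx_unitary //.
  have yE : (map_mx rc z^T *m Q^t* = y^t*)%sesqui.
    rewrite /y trmx_mul map_mxM; congr (_ *m _).
    by apply/matrixP => a b; rewrite !mxE; symmetry; exact: rc_conj.
  rewrite !mulmxA yE -mulmxA -/y mxE rmorph_sum; apply: eq_bigr => i _.
  rewrite rmorphM cE mul_mx_diag !mxE.
  by rewrite mulrC mulrA.
Qed.

End diagonalized.

Lemma symmetric_diagonalization (n : nat) (A : 'M[R]_n) : A^T = A ->
  exists (Q : 'M[R[i]]_n) (lam : 'I_n -> R), Q \is unitarymx /\
    map_mx (real_complex R) A = invmx Q *m diag_mx (\row_i real_complex R (lam i)) *m Q.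
Proof.
move=> As; pose AC := map_mx (real_complex R) A.
have ACh : AC \is hermsymmx.
  apply: realsym_hermsym.
    by apply/is_hermitianmxP; rewrite expr0 scale1r map_mx_id // /AC map_trmx As.
  by apply/mxOverP => i j; rewrite mxE /= complex_real.
pose sp := spectral_diag AC.
exists (spectralmx AC), (fun i => complex.Re (sp 0 i)); split.
  exact: spectral_unitarymx.
rewrite (_ : \row_i _ = sp).
  by apply/orthomx_spectralP; exact: hermitian_normalmx.
apply/rowP => i; rewrite mxE.
by have /mxOverP/(_ 0 i)/complex_realP[k] := hermitian_spectral_diag_real ACh; rewrite -/sp => ->.
Qed.

Lemma symmetric_spectral_data (n : nat) (A : 'M[R]_n) : A^T = A ->
  exists lam : 'I_n -> R, spectral_data A lam.
Proof.
move=> As; have [Q [lam [Qu QA]]] := symmetric_diagonalization n A As.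
exists lam; apply: (diagonalized_spectral_data (real_complex R)) QA => //.
- by move=> x; apply: conj_Creal; apply/complex_realP; exists x.
- move=> y; have /ger0_real/complex_realP[c cE] := mul_conjC_ge0 y; exists c => //.
  by rewrite -(@ler0c R) -cE mul_conjC_ge0.
Qed.

Lemma resolvent_sym (n : nat) (A : 'M[R]_n) u : A^T = A -> (resolvent A u)^T = resolvent A u.
Proof. by move=> As; rewrite /resolvent trmx_inv linearB /= tr_scalar_mx As. Qed.

Lemma mx11_mulC (n m : nat) (x : 'M[R]_1) (M : 'M[R]_(n, 1)) (N : 'M[R]_(1, m)) :
  M *m x *m N = x 0 0 *: (M *m N).
Proof. by rewrite [x]mx11_scalar mul_mx_scalar -scalemxAl mxE eqxx mulr1n. Qed.

(** An eigenvalue [x >= u] of the updated matrix would force [qform (resolvent A x) z = 1]; but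
    beyond the spectrum this form decreases in the spectral parameter, and it is already below 1 at
    [u]. *)
Lemma rank1_eigenvalue_lt (n : nat) (A : 'M[R]_n) (lam : 'I_n -> R) (z : 'cV[R]_n) (u : R) :
  spectral_data A lam -> (forall i, lam i < u) -> qform (resolvent A u) z < 1 ->
  forall x, eigenvalue (A + z *m z^T) x -> x < u.
Proof.
move=> [_ _ un _ qf] lu q1 x /eigenvalueP[w wA w0].
rewrite ltNge; apply/negP => ux.
have lx i : lam i != x by rewrite lt_eqF // (lt_le_trans (lu i)).
have [c [c0 qc]] := qf z.
have qx : qform (resolvent A x) z < 1.
  apply: le_lt_trans q1; rewrite !qc //; last by move=> i; rewrite lt_eqF.
  apply: ler_sum => i _; rewrite ler_wpM2l // lef_pV2 ?posrE ?subr_gt0 ?lerB //.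
  exact: lt_le_trans ux.
have wE : w *m (x%:M - A) = (w *m z) *m z^T.
  move: wA; rewrite mulmxDr mulmxBr mul_mx_scalar => <-.
  by rewrite addrAC subrr add0r mulmxA.
have wE2 : w = (w *m z) *m z^T *m resolvent A x.
  by rewrite -wE mulmxK // un.
have h : (w *m z) 0 0 = (w *m z) 0 0 * qform (resolvent A x) z.
  rewrite {1}wE2 -!mulmxA [w *m (z *m _)]mulmxA mxE big_ord1 /qform !mulmxA //.
have : (w *m z) 0 0 = 0.
  have : (w *m z) 0 0 * (1 - qform (resolvent A x) z) = 0 by rewrite mulrBr mulr1 -h subrr.
  by move=> /eqP; rewrite mulf_eq0 subr_eq0 [1 == _]gt_eqF // orbF => /eqP.
move=> wz0; move: w0; rewrite wE2 [w *m z]mx11_scalar wz0 -scalemx1 scale0r !mul0mx.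
by rewrite eqxx.
Qed.

(** Sherman-Morrison: [K'] is the explicit inverse after the update, and cyclicity of the trace
    turns its rank-one correction into the form of the squared resolvent. *)
Lemma rank1_resolvent_trace (n : nat) (A : 'M[R]_n) (z : 'cV[R]_n) (u : R) :
  u%:M - A \in unitmx -> qform (resolvent A u) z != 1 ->
  \tr (resolvent (A + z *m z^T) u) =
    \tr (resolvent A u) + qform (res_prod A [:: u; u]) z / (1 - qform (resolvent A u) z).
Proof.
move=> uA; set K := resolvent A u; set a := qform K z => a1.
have a10 : 1 - a != 0 by rewrite subr_eq0 eq_sym.
pose K' := K + (1 - a)^-1 *: (K *m z *m (z^T *m K)).
have e : (u%:M - (A + z *m z^T)) *m K' = 1%:M.
  have uK : (u%:M - A) *m K = 1%:M by exact: mulmxV.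
  have zKz : z *m z^T *m (K *m z *m (z^T *m K)) = a *: (z *m (z^T *m K)).
    rewrite (_ : _ *m _ = z *m (z^T *m K *m z) *m (z^T *m K)); last by rewrite !mulmxA.
    by rewrite mx11_mulC.
  have uKz : (u%:M - A) *m (K *m z *m (z^T *m K)) = z *m (z^T *m K).
    by rewrite !mulmxA uK mul1mx.
  rewrite opprD addrA mulmxBl /K' !mulmxDr uK -!scalemxAr uKz zKz -mulmxA.
  set N := z *m _; rewrite scalerA -addrA -{2}[N]scale1r -scalerDl -scalerBl.
  by rewrite (_ : _ - _ = 0) ?scale0r ?addr0 //; field.
have [u' _] := mulmx1_unit e.
have -> : resolvent (A + z *m z^T) u = K'.
  by rewrite /resolvent -[LHS]mulmx1 -e mulKmx.
rewrite /K' mxtraceD mxtraceZ; congr (_ + _).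
rewrite mulrC; congr (_ * _).
by rewrite mxtrace_mulC trace_mx11 /qform /res_prod /= mulmx1 !mulmxA.
Qed.

Lemma frobenius_trace (n : nat) (M : 'M[R]_n) : M^T = M ->
  \sum_i \sum_l M i l ^+ 2 = \tr (M *m M).
Proof.
move=> Ms; apply: eq_bigr => i _; rewrite mxE; apply: eq_bigr => l _.
by rewrite -{3}Ms mxE expr2.
Qed.

Lemma frobenius_resolvent (n : nat) (A : 'M[R]_n) (lam : 'I_n -> R) u :
  A^T = A -> spectral_data A lam -> (forall i, lam i != u) ->
  \sum_i \sum_l resolvent A u i l ^+ 2 = \sum_i (u - lam i)^-1 ^+ 2.
Proof.
move=> As [_ _ _ tr _] hu; rewrite frobenius_trace ?resolvent_sym //.
have := tr [:: u; u]; rewrite /res_prod /= mulmx1 => ->.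
  by apply: eq_bigr => i _; rewrite !big_cons big_nil mulr1.
by move=> v; rewrite !inE orbb => /eqP ->.
Qed.

Lemma frobenius_resolvent2 (n : nat) (A : 'M[R]_n) (lam : 'I_n -> R) u :
  A^T = A -> spectral_data A lam -> (forall i, lam i != u) ->
  \sum_i \sum_l res_prod A [:: u; u] i l ^+ 2 = \sum_i (u - lam i)^-1 ^+ 4.
Proof.
move=> As [_ _ _ tr _] hu; rewrite frobenius_trace; last first.
  by rewrite /res_prod /= mulmx1 trmx_mul !resolvent_sym.
have := tr [:: u; u; u; u]; rewrite /res_prod /= !mulmx1 !mulmxA => ->.
  by apply: eq_bigr => i _; rewrite !big_cons big_nil mulr1 !exprS expr0 mulr1.
by move=> v; rewrite !inE !orbb => /eqP ->.
Qed.

Lemma qform_center (n : nat) (M : 'M[R]_n) (z : 'cV[R]_n) (v : R) :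
  \sum_i \sum_l M i l * (z i 0 * z l 0 - (i == l)%:R * v) = qform M z - v * \tr M.
Proof.
rewrite /qform mxE.
under [in RHS]eq_bigr => l _ do rewrite mxE mulr_suml.
rewrite exchange_big /mxtrace mulr_sumr -sumrB; apply: eq_bigr => i _.
rewrite (bigD1 i) //= [in RHS](bigD1 i) //= eqxx !mxE addrAC; congr (_ + _).
  by rewrite mul1r; ring.
by apply: eq_bigr => l li; rewrite (negbTE li) mul0r subr0 !mxE; ring.
Qed.

End spectrum.

(** * Geometry of the lines, the edge and the barrier *)

Section geometry.
Context {R : realType} (n m : nat) (kap eta : R).
Hypotheses (n0 : (0 < n)%N) (m0 : (0 < m)%N).

Definition ratio (j : nat) : R := Num.sqrt (j%:R / n%:R).
Local Notation phi := (ratio m).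
(** Zero when [th] is 1/(1 + ratio j), the Stieltjes value at the Marchenko-Pastur edge. Since
    [line th j - (1 + ratio j) ^+ 2] equals margin^2 / (th (1 - th)), the margin plays the role of a
    square root of the distance to the edge. *)
Definition margin (th : R) (j : nat) : R := 1 - th * (1 + ratio j).
(** The last summand is 1 at time 0 and vanishes at time m. It raises the barrier early, where
    otherwise labels close to 1 would have to be tracked and 1/(1 - th) would blow up; with it,
    labels up to 1/2 suffice ([half_inactive]), and nothing is lost at the final time. *)
Definition barrier (j : nat) : R :=
  (1 + ratio j) ^+ 2 + kap * phi + (1 - ratio j / phi) ^+ 2.
Definition line (th : R) (j : nat) : R := th^-1 + (j%:R / n%:R) / (1 - th).
Definition gap (th : R) (j : nat) : R := th * (line th j - barrier j).
Lemma gap_line th j : gap th j = th * (line th j - barrier j).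
Proof. by []. Qed.
Definition active (th : R) (j : nat) : bool := (0 < margin th j) && (eta <= gap th j).

Hypotheses (eta0 : 0 < eta) (kap0 : 0 < kap) (kap1 : kap <= 1) (phi20 : 20 <= phi).

Let n0R : 0 < n%:R :> R. Proof. by rewrite ltr0n. Qed.
Let phi0 : 0 < phi. Proof. by apply: lt_le_trans phi20. Qed.

Lemma ratio_ge0 j : 0 <= ratio j.
Proof. exact: sqrtr_ge0. Qed.

Lemma ratio_sqr j : ratio j ^+ 2 = j%:R / n%:R.
Proof. by rewrite sqr_sqrtr // divr_ge0. Qed.

Lemma ratio_mono j k : (j <= k)%N -> ratio j <= ratio k.
Proof. by move=> jk; rewrite ler_wsqrtr // ler_pM2r ?invr_gt0 // ler_nat. Qed.

Lemma ratio_step j : ratio j.+1 ^+ 2 - ratio j ^+ 2 = n%:R^-1.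
Proof. by rewrite !ratio_sqr -mulrBl -natrB // subSnn mul1r. Qed.

Lemma ratio_gt0 j : 0 < ratio j.+1.
Proof. by rewrite sqrtr_gt0 divr_gt0. Qed.

Lemma relative_ratio j : (j <= m)%N -> 0 <= 1 - ratio j / phi <= 1.
Proof.
move=> jm; rewrite subr_ge0 ler_pdivrMr // mul1r ratio_mono //=.
by rewrite gerBl divr_ge0 ?ratio_ge0 // ltW.
Qed.

Section one_label.
Variable th : R.
Hypotheses (th0 : 0 < th) (th12 : th <= 1 / 2).

Let th1 : 0 < 1 - th. Proof. by move: th12; lra. Qed.

Lemma sqr_div_le (x : R) : x ^+ 2 / (1 - th) <= 2 * x ^+ 2.
Proof.
rewrite ler_pdivrMr //; have t12 := th12.
have h : 0 <= 1 - 2 * th by lra.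
by have := mulr_ge0 (sqr_ge0 x) h; lra.
Qed.

Lemma gapE j : gap th j =
  margin th j ^+ 2 / (1 - th) - th * (kap * phi) - th * (1 - ratio j / phi) ^+ 2.
Proof.
rewrite /gap /line /barrier -ratio_sqr /margin.
by field; rewrite !gt_eqF.
Qed.

Lemma gap_le_margin_sqr j : (j <= m)%N -> gap th j <= 2 * margin th j ^+ 2.
Proof.
have t0 := th0; have t12 := th12; have t1 := th1; have k0 := kap0; have k1 := kap1; have p20 := phi20.
move=> jm; rewrite gapE.
have h1 : 0 <= th * (kap * phi) by rewrite !mulr_ge0 // ltW.
have h2 : 0 <= th * (1 - ratio j / phi) ^+ 2 by rewrite mulr_ge0 ?sqr_ge0 // ltW.
have := sqr_div_le (margin th j).
by lra.
Qed.

Lemma margin_le j : margin th j <= 1 - th.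
Proof. by rewrite /margin mulrDr mulr1 opprD addrA gerBl mulr_ge0 ?ratio_ge0 // ltW. Qed.

Lemma gap_le_margin j : (j <= m)%N -> 0 <= margin th j -> gap th j <= margin th j.
Proof.
have t0 := th0; have t12 := th12; have t1 := th1; have k0 := kap0; have k1 := kap1; have p20 := phi20.
move=> jm r0; rewrite gapE.
have h1 : 0 <= th * (kap * phi) by rewrite !mulr_ge0 // ltW.
have h2 : 0 <= th * (1 - ratio j / phi) ^+ 2 by rewrite mulr_ge0 ?sqr_ge0 // ltW.
have : margin th j ^+ 2 / (1 - th) <= margin th j.
  by rewrite ler_pdivrMr //; have := margin_le j; nra.
by lra.
Qed.

(** If the margin is below 1/2 then [th * phi >= 1 / 4], and the summand [kap * phi] of the barrier
    alone keeps an active label this far from the edge. *)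
Lemma margin_lower j : (j <= m)%N -> active th j -> kap <= 16 * margin th j ^+ 2.
Proof.
have t0 := th0; have t12 := th12; have t1 := th1; have k0 := kap0; have k1 := kap1; have p20 := phi20.
move=> jm /andP[r0 ge].
have [r12|r12] := leP (1 / 2) (margin th j).
  by move: r12 r0 kap1; move: (margin th j) => r; nra.
have thphi : 1 <= 4 * (th * phi).
  have : th * ratio j <= th * phi by rewrite ler_wpM2l ?ratio_mono // ltW.
  have : th * 20 <= th * phi by rewrite ler_wpM2l // ltW.
  by move: r12; rewrite /margin; lra.
have : 0 <= gap th j by apply: le_trans ge; exact: ltW.
rewrite gapE => hg.
have h2 : 0 <= th * (1 - ratio j / phi) ^+ 2 by rewrite mulr_ge0 ?sqr_ge0 // ltW.
have h3 := sqr_div_le (margin th j).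
have : kap * 1 <= kap * (4 * (th * phi)) by rewrite ler_wpM2l // ltW.
have := sqr_ge0 (margin th j).
by move: hg h2 h3; move: (margin th j ^+ 2) (_ / (1 - th)) => x y; nra.
Qed.

(** The line loses height over the edge at a rate proportional to the margin, whereas the falling
    last summand of the barrier gives some height back. The point is that at most half of the loss
    is given back. *)
Lemma gap_step j : (j.+1 <= m)%N -> active th j.+1 ->
  th ^+ 2 * margin th j / (4 * n%:R) <= gap th j - gap th j.+1 /\
  margin th j.+1 <= margin th j.
Proof.
have t0 := th0; have t12 := th12; have t1 := th1; have k0 := kap0; have k1 := kap1; have p20 := phi20.
move=> jm /andP[rb ge].
set a := ratio j; set b := ratio j.+1.
have a0 : 0 <= a by exact: ratio_ge0.
have b0 : 0 < b by exact: ratio_gt0.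
have ab : a <= b by exact: ratio_mono.
have bphi : b <= phi by exact: ratio_mono.
have ab2 : (b - a) * (a + b) = n%:R^-1.
  by rewrite -(ratio_step j) -/a -/b; ring.
set ra := margin th j; set rB := margin th j.+1 in rb *.
have raE : ra = rB + th * (b - a) by rewrite /ra /rB /margin -/a -/b; ring.
have rab : rB <= ra by rewrite raE lerDl mulr_ge0 ?subr_ge0 // ltW.
split=> //.
pose yb := 1 - b / phi.
have yb0 : 0 <= yb by have /andP[] := relative_ratio j.+1 jm.
have thb : th * b <= 1 by move: rb; rewrite /rB /margin -/b; nra.
(* Two regimes. If th phi^2 < 8 the label is so small that its margin is at least 1/2, and
   [phi >= 20] is enough. Otherwise a nonnegative gap forces th yb^2 <= 2 rB^2, hence 2 yb <= phi
   rB. *)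
have key : 2 * yb + (b - a) / phi <= phi * (ra + rB) / 2.
  have [lt|ge8] := ltP (th * phi ^+ 2) 8.
    have h1 : th * phi <= 2 / 5.
      have : (th * phi) * 20 <= (th * phi) * phi by rewrite ler_wpM2l ?mulr_ge0 // ltW.
      by nra.
    have h2 : th * 20 <= th * phi by rewrite ler_wpM2l // ltW.
    have h3 : th * b <= th * phi by rewrite ler_wpM2l // ltW.
    have rB12 : 1 / 2 <= rB by rewrite /rB /margin -/b; lra.
    have h4 : (b - a) / phi <= 1 by rewrite ler_pdivrMr // mul1r; lra.
    have h5 : yb <= 1 by have /andP[] := relative_ratio j.+1 jm.
    have : 20 * (1 / 2) <= phi * rB by rewrite ler_pM.
    have : phi * rB <= phi * ra by rewrite ler_wpM2l // ltW.
    by lra.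
  have hr : 2 * yb <= phi * rB.
    have : 0 <= gap th j.+1 by apply: le_trans ge; exact: ltW.
    rewrite gapE -/rB -/b -/yb => hg.
    have h1 : 0 <= th * (kap * phi) by rewrite !mulr_ge0 // ltW.
    have h3 := sqr_div_le rB.
    have h4 : th * yb ^+ 2 <= 2 * rB ^+ 2 by lra.
    have h5 : th * phi ^+ 2 * yb ^+ 2 <= 2 * (phi * rB) ^+ 2.
      have : phi ^+ 2 * (th * yb ^+ 2) <= phi ^+ 2 * (2 * rB ^+ 2) by rewrite ler_wpM2l ?sqr_ge0.
      by rewrite exprMn; nra.
    have h6 : 8 * yb ^+ 2 <= th * phi ^+ 2 * yb ^+ 2 by rewrite ler_wpM2r ?sqr_ge0.
    rewrite -(@ler_pXn2r _ 2) ?nnegrE ?mulr_ge0 // ?(ltW phi0) ?(ltW rb) //.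
    by rewrite exprMn; nra.
  have hd : (b - a) / phi <= phi * (th * (b - a)) / 2.
    rewrite ler_pdivrMr //.
    rewrite (_ : _ * phi = (th * phi ^+ 2) / 2 * (b - a)); last by field.
    by rewrite ler_peMl ?subr_ge0 //; lra.
  by rewrite raE; lra.
have diffE : gap th j - gap th j.+1 =
    th * (b - a) * ((ra + rB) / (1 - th) - (2 * yb + (b - a) / phi) / phi).
  rewrite !gapE -/ra -/rB -/a -/b raE /yb /rB /margin -/b.
  by field; rewrite !gt_eqF.
have br : (ra + rB) / 2 <= (ra + rB) / (1 - th) - (2 * yb + (b - a) / phi) / phi.
  have h1 : (2 * yb + (b - a) / phi) / phi <= (ra + rB) / 2.
    by rewrite ler_pdivrMr //; lra.
  have h2 : ra + rB <= (ra + rB) / (1 - th).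
    by rewrite ler_pdivlMr //; nra.
  by lra.
rewrite diffE.
have ba0 : 0 <= b - a by rewrite subr_ge0.
apply: le_trans (_ : th * (b - a) * (ra / 2) <= _); last first.
  rewrite ler_wpM2l ?mulr_ge0 // ?(ltW th0) //.
  by move: rb br; lra.
rewrite ler_pdivrMr ?mulr_gt0 //.
rewrite (_ : _ * _ * (4 * n%:R) = (2 * (b - a) * n%:R) * (th * ra)); last by field.
rewrite expr2 -mulrA ler_wpM2r ?mulr_ge0 ?(ltW th0) //; first by move: rb rab; lra.
have -> : b - a = n%:R^-1 / (a + b).
  by rewrite -ab2 mulfK // gt_eqF // ltr_wpDl.
have abp : 0 < a + b by rewrite ltr_wpDl.
rewrite (_ : 2 * _ * _ = 2 / (a + b)); last by field; rewrite !gt_eqF.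
rewrite ler_pdivlMr // mulrDr.
have : th * a <= th * b by rewrite ler_wpM2l // ltW.
by lra.
Qed.

Lemma active_pred j : (j.+1 <= m)%N -> active th j.+1 -> active th j.
Proof.
move=> jm act; have [st mr] := gap_step j jm act.
have /andP[rb ge] := act; have ra := lt_le_trans rb mr.
rewrite /active ra /=; apply: le_trans ge _; rewrite -subr_ge0; apply: le_trans st.
by rewrite divr_ge0 // mulr_ge0 ?sqr_ge0 // ltW.
Qed.

(** A label active at time k has been active since time 0, with larger gap and margin, so bounds at
    time k control its whole past. *)
Lemma active_mono j k : (j <= k)%N -> (k <= m)%N -> active th k ->
  [/\ active th j, gap th k <= gap th j & margin th k <= margin th j].
Proof.
move=> jk km act; elim: k jk km act => [|k IH] jk km act.
  by move: jk; rewrite leqn0 => /eqP ->.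
move: jk; rewrite leq_eqVlt => /predU1P[->//|]; rewrite ltnS => jk.
have actk := active_pred k km act.
have [aj gj rj] := IH jk (ltnW km) actk.
have [st mr] := gap_step k km act.
split=> //; last exact: le_trans rj.
apply: le_trans gj; rewrite -subr_ge0; apply: le_trans st.
have /andP[rk _] := actk.
by rewrite divr_ge0 // mulr_ge0 ?sqr_ge0 // ltW.
Qed.

Lemma active_gap_gt0 j : active th j -> 0 < gap th j.
Proof. by case/andP => _; exact: lt_le_trans. Qed.

Let active_lt k j : (j < k)%N -> (k <= m)%N -> active th k ->
  [/\ 0 < gap th k <= gap th j.+1, gap th j.+1 <= gap th j,
      0 < margin th k <= margin th j, gap th j <= 2 * margin th j ^+ 2
    & th ^+ 2 / n%:R <= 4 * (gap th j - gap th j.+1) / margin th j].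
Proof.
move=> jk km act.
have [aj gj rj] := active_mono j k (ltnW jk) km act.
have [aj1 gj1 rj1] := active_mono j.+1 k jk km act.
have [st mr] := gap_step j (leq_trans jk km) aj1.
have /andP[rj0 _] := aj; have /andP[rk0 _] := act.
have j1m : (j.+1 <= m)%N by exact: leq_trans km.
split=> //.
- by rewrite active_gap_gt0.
- by have [] := active_mono j j.+1 (leqnSn j) j1m aj1.
- by rewrite rk0.
- exact: gap_le_margin_sqr (ltnW j1m).
rewrite ler_pdivlMr //; move: st; rewrite ler_pdivrMr ?mulr_gt0 // => st.
by rewrite mulrAC ler_pdivrMr //; lra.
Qed.

(* The sums over time telescope through gap_step: along a label, th^2 / (n margin)
   is at most four times the decrement of gap divided by margin^2. *)
Lemma gap_sum2 k : (k <= m)%N -> active th k ->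
  \sum_(j < k) (th ^+ 2 / n%:R) / (margin th j * gap th j ^+ 2) <=
    4 / (margin th k ^+ 2 * gap th k).
Proof.
move=> km act.
have H j (jk : (j < k)%N) := active_lt k j jk km act.
suff main l : (l <= k)%N -> \sum_(j < l) (th ^+ 2 / n%:R) / (margin th j * gap th j ^+ 2) <=
    4 / margin th k ^+ 2 * ((gap th l)^-1 - (gap th 0)^-1).
  apply: le_trans (main k (leqnn k)) _.
  have /andP[rk0 _] := act.
  have g0 := active_gap_gt0 _ act.
  have -> : 4 / (margin th k ^+ 2 * gap th k) = 4 / margin th k ^+ 2 * (gap th k)^-1.
    by rewrite -mulrA -invfM.
  rewrite ler_wpM2l ?divr_ge0 ?sqr_ge0 // gerBl invr_ge0.
  by have [a0 _ _] := active_mono 0 k (leq0n k) km act; rewrite ltW // active_gap_gt0.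
elim: l => [|l IH] lk; first by rewrite big_ord0 subrr mulr0.
rewrite big_ord_recr /=; apply: le_trans (lerD (IH (ltnW lk)) (lexx _)) _.
rewrite -lerBrDl -mulrBr opprB addrA subrK.
have [/andP[gk0 gkl] gl /andP[rk0 rkl] _ h] := H l lk.
have gl1 : 0 < gap th l.+1 by exact: lt_le_trans gkl.
have gl0 : 0 < gap th l by exact: lt_le_trans gl.
have rl0 : 0 < margin th l by exact: lt_le_trans rkl.
rewrite (_ : _^-1 - _^-1 = (gap th l - gap th l.+1) / (gap th l * gap th l.+1)); last first.
  by field; rewrite !gt_eqF.
have d0 : 0 < margin th l * gap th l ^+ 2.
  by apply: mulr_gt0 => //; exact: exprn_gt0.
rewrite ler_pdivrMr //; apply: le_trans h _.
rewrite ler_pdivrMr //.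
rewrite (_ : _ * _ * _ = 4 * (gap th l - gap th l.+1) *
   ((margin th l ^+ 2 / margin th k ^+ 2) * (gap th l / gap th l.+1))); last first.
  by field; rewrite !gt_eqF.
rewrite ler_peMr ?mulr_ge0 ?subr_ge0 //.
rewrite mulr_ege1 // ler_pdivlMr ?exprn_gt0 // mul1r // lerXn2r ?nnegrE ?(ltW rk0) ?(ltW rl0) //.
Qed.

(** With y, z the square roots of consecutive gaps, the summand is compared with 16 (1/z - 1/y). The
    two factors of the margin are traded for gaps through [gap_le_margin_sqr]. *)
Lemma gap_sum32 k : (k <= m)%N -> active th k ->
  \sum_(j < k) (th ^+ 2 / n%:R) / (margin th j * Num.sqrt (gap th j)) <=
    16 / Num.sqrt (gap th k).
Proof.
move=> km act.
have H j (jk : (j < k)%N) := active_lt k j jk km act.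
suff main l : (l <= k)%N -> \sum_(j < l) (th ^+ 2 / n%:R) / (margin th j * Num.sqrt (gap th j)) <=
    16 * ((Num.sqrt (gap th l))^-1 - (Num.sqrt (gap th 0))^-1).
  apply: le_trans (main k (leqnn k)) _.
  by rewrite ler_wpM2l // gerBl invr_ge0 sqrtr_ge0.
elim: l => [|l IH] lk; first by rewrite big_ord0 subrr mulr0.
rewrite big_ord_recr /=; apply: le_trans (lerD (IH (ltnW lk)) (lexx _)) _.
rewrite -lerBrDl -mulrBr opprB addrA subrK.
have [/andP[gk0 gkl] gl /andP[rk0 rkl] g2 h] := H l lk.
have gl1 : 0 < gap th l.+1 by exact: lt_le_trans gkl.
have gl0 : 0 < gap th l by exact: lt_le_trans gl.
have rl0 : 0 < margin th l by exact: lt_le_trans rkl.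
have y0 : 0 < Num.sqrt (gap th l) by rewrite sqrtr_gt0.
have z0 : 0 < Num.sqrt (gap th l.+1) by rewrite sqrtr_gt0.
have zy : Num.sqrt (gap th l.+1) <= Num.sqrt (gap th l) by rewrite ler_wsqrtr.
move: h g2; rewrite -[X in _ * (X - _)](sqr_sqrtr (ltW gl0)).
rewrite -[X in _ * (_ - X)](sqr_sqrtr (ltW gl1)) -{2}(sqr_sqrtr (ltW gl0)).
move: (Num.sqrt (gap th l)) (Num.sqrt (gap th l.+1)) (margin th l) y0 z0 zy rl0.
move=> y z r y0 z0 zy r0 h g2.
rewrite (_ : _^-1 - _^-1 = (y - z) / (y * z)); last by field; rewrite !gt_eqF.
rewrite ler_pdivrMr ?mulr_gt0 //; apply: le_trans h _.
rewrite ler_pdivrMr //.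
rewrite (_ : _ * _ * _ = 16 * (y - z) * (r ^+ 2 / z)); last by field; rewrite !gt_eqF.
rewrite mulrA ler_pdivlMr //.
have yz0 : 0 <= y - z by rewrite subr_ge0.
have h1 : (y + z) * z <= 2 * y ^+ 2.
  by nra.
have h2 : 4 * (y - z) * ((y + z) * z) <= 4 * (y - z) * (4 * r ^+ 2).
  by rewrite ler_wpM2l ?mulr_ge0 //; lra.
by nra.
Qed.

(** The same telescoping, except that one factor of the margin is replaced by its smallest value,
    the one at time k. *)
Lemma gap_sum1 k : (k <= m)%N -> active th k ->
  \sum_(j < k) (th ^+ 2 / n%:R) / (margin th j * gap th j) <=
    16 / (margin th k * Num.sqrt (gap th k)).
Proof.
move=> km act.
have H j (jk : (j < k)%N) := active_lt k j jk km act.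
suff main l : (l <= k)%N -> \sum_(j < l) (th ^+ 2 / n%:R) / (margin th j * gap th j) <=
    16 / margin th k * ((Num.sqrt (gap th l))^-1 - (Num.sqrt (gap th 0))^-1).
  apply: le_trans (main k (leqnn k)) _.
  have /andP[rk0 _] := act.
  have -> : 16 / (margin th k * Num.sqrt (gap th k)) = 16 / margin th k * (Num.sqrt (gap th k))^-1.
    by rewrite -mulrA -invfM.
  rewrite ler_wpM2l ?divr_ge0 ?(ltW rk0) //.
  by rewrite gerBl invr_ge0 sqrtr_ge0.
elim: l => [|l IH] lk; first by rewrite big_ord0 subrr mulr0.
rewrite big_ord_recr /=; apply: le_trans (lerD (IH (ltnW lk)) (lexx _)) _.
rewrite -lerBrDl -mulrBr opprB addrA subrK.
have [/andP[gk0 gkl] gl /andP[rk0 rkl] g2 h] := H l lk.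
have gl1 : 0 < gap th l.+1 by exact: lt_le_trans gkl.
have gl0 : 0 < gap th l by exact: lt_le_trans gl.
have rl0 : 0 < margin th l by exact: lt_le_trans rkl.
have y0 : 0 < Num.sqrt (gap th l) by rewrite sqrtr_gt0.
have z0 : 0 < Num.sqrt (gap th l.+1) by rewrite sqrtr_gt0.
have zy : Num.sqrt (gap th l.+1) <= Num.sqrt (gap th l) by rewrite ler_wsqrtr.
move: h g2; rewrite -{1 2 3}(sqr_sqrtr (ltW gl0)) -(sqr_sqrtr (ltW gl1)).
rewrite !(sqrtr_sqr, gtr0_norm y0, gtr0_norm z0).
move: (Num.sqrt (gap th l)) (Num.sqrt (gap th l.+1)) (margin th l) (margin th k) y0 z0 zy rl0 rk0 rkl.
move=> y z r s y0 z0 zy r0 s0 sr h g2.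
rewrite (_ : _^-1 - _^-1 = (y - z) / (y * z)); last by field; rewrite !gt_eqF.
have d0 : 0 < r * y ^+ 2 by apply: mulr_gt0 => //; exact: exprn_gt0.
rewrite ler_pdivrMr //; apply: le_trans h _.
rewrite ler_pdivrMr //.
rewrite (_ : _ * _ * _ = 16 * (y - z) * (r ^+ 2 * y / (z * s))); last by field; rewrite !gt_eqF.
rewrite mulrA ler_pdivlMr ?mulr_gt0 //.
have yz0 : 0 <= y - z by rewrite subr_ge0.
have y2r : y <= 2 * r.
  by rewrite -(@ler_pXn2r _ 2) ?nnegrE ?mulr_ge0 // ?(ltW y0) ?(ltW r0) // exprMn; have := sqr_ge0 r; lra.
have h1 : z * s <= 2 * r ^+ 2.
  have : z * s <= (2 * r) * r by rewrite ler_pM ?(ltW z0) ?(ltW s0) // (le_trans zy).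
  by lra.
have h2 : (y + z) * (z * s) <= (2 * y) * (2 * r ^+ 2).
  by rewrite ler_pM ?addr_ge0 ?mulr_ge0 ?(ltW z0) ?(ltW s0) ?(ltW y0) //; lra.
have h3 : 4 * (y - z) * ((y + z) * (z * s)) <= 4 * (y - z) * ((2 * y) * (2 * r ^+ 2)).
  by rewrite ler_wpM2l ?mulr_ge0.
by lra.
Qed.

End one_label.

Lemma ratio_over_le th j : 0 < th -> th <= 1 / 2 -> 0 <= margin th j ->
  ratio j / (1 - th) <= 1 + ratio j.
Proof.
move=> t0 t12 r0; have f0 := ratio_ge0 j.
by rewrite ler_pdivrMr; move: r0; rewrite /margin; nra.
Qed.

Lemma gap_diff th th' j : 0 < th' -> th' <= th -> th <= 1 / 2 ->
  gap th' j - gap th j =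
    (th - th') * (barrier j - ratio j / (1 - th) * (ratio j / (1 - th'))).
Proof.
move=> t0 tt t12; rewrite /gap /line -ratio_sqr.
have h1 : 1 - th != 0 by rewrite gt_eqF //; lra.
have h2 : 1 - th' != 0 by rewrite gt_eqF //; lra.
have h3 : th != 0 by rewrite gt_eqF //; lra.
have h4 : th' != 0 by rewrite gt_eqF.
by field; rewrite h1 h2 h3 h4.
Qed.

Lemma barrier_ge j : (1 + ratio j) ^+ 2 <= barrier j.
Proof.
rewrite /barrier -addrA lerDl addr_ge0 ?sqr_ge0 // mulr_ge0 //; exact: ltW.
Qed.

Lemma barrier_le j : (j <= m)%N -> barrier j <= 2 * (1 + phi) ^+ 2.
Proof.
move=> jm; have k0 := kap0; have k1 := kap1; have p20 := phi20.
have fphi := ratio_mono j m jm; have f0 := ratio_ge0 j.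
have /andP[x0 x1] := relative_ratio j jm.
have h1 : (1 - ratio j / phi) ^+ 2 <= 1 by rewrite expr_le1.
have h2 : (1 + ratio j) ^+ 2 <= (1 + phi) ^+ 2 by rewrite lerXn2r ?nnegrE; lra.
have h3 : kap * phi <= phi by rewrite ler_piMl; lra.
have h4 : 1 + phi <= (1 + phi) ^+ 2 by rewrite expr2 ler_peMr; lra.
rewrite /barrier -addrA [leRHS]mulr_natl mulr2n lerD // (le_trans _ h4) // [leRHS]addrC.
exact: lerD.
Qed.

(** In [gap_diff] each factor ratio/(1 - label) is at most 1 + ratio as long as the margin is
    nonnegative, while the barrier is at least (1 + ratio)^2. *)
Lemma gap_mono_label th th' j : 0 < th' -> th' <= th -> th <= 1 / 2 -> 0 <= margin th j ->
  gap th j <= gap th' j /\ margin th j <= margin th' j.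
Proof.
move=> t0 tt t12 r0; have f0 := ratio_ge0 j.
have rr : margin th j <= margin th' j.
  by rewrite /margin lerB // ler_wpM2r // addr_ge0.
split=> //; rewrite -subr_ge0 gap_diff // mulr_ge0 ?subr_ge0 //.
apply: le_trans (barrier_ge j); rewrite expr2 ler_pM ?divr_ge0 //; try lra.
  by apply: ratio_over_le => //; lra.
by apply: ratio_over_le => //; lra.
Qed.

Lemma gap_lipschitz th th' j : 0 < th' -> th' <= th -> th <= 1 / 2 ->
  gap th' j - gap th j <= (th - th') * barrier j.
Proof.
move=> t0 tt t12; rewrite gap_diff // ler_wpM2l ?subr_ge0 // gerBl.
by rewrite mulr_ge0 // divr_ge0 ?ratio_ge0 //; lra.
Qed.

(** Labels that stay well away from the barrier at all times. Crude bounds are enough for them, so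
    the grid need not resolve their neighbourhood. *)
Lemma small_label th j : 0 < th -> 4 * (1 + phi) * th <= 1 -> (j <= m)%N ->
  3 / 4 <= margin th j /\ 5 / 16 <= gap th j.
Proof.
have k0 := kap0; have k1 := kap1; have p20 := phi20; have e0 := eta0.
move=> t0 t4 jm.
have := ratio_mono j m jm; have f0 := ratio_ge0 j => fphi.
have h1 : th * (1 + ratio j) <= th * (1 + phi) by rewrite ler_wpM2l; lra.
have r34 : 3 / 4 <= margin th j by rewrite /margin; lra.
split=> //.
have h2 : th * 80 <= th * (4 * (1 + phi)) by rewrite ler_wpM2l; lra.
have t12 : th <= 1 / 2 by lra.
rewrite gapE //.
have h3 : (3 / 4) ^+ 2 <= margin th j ^+ 2 by rewrite lerXn2r ?nnegrE; lra.
have h4 : margin th j ^+ 2 <= margin th j ^+ 2 / (1 - th).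
  rewrite ler_pdivlMr; last by lra.
  by rewrite ler_piMr ?sqr_ge0 //; lra.
have /andP[x0 x1] := relative_ratio j jm.
have h5 : th * (1 - ratio j / phi) ^+ 2 <= th * 1 by rewrite ler_wpM2l ?expr_le1 //; lra.
have h6 : th * (kap * phi) <= th * phi.
  by rewrite ler_wpM2l ?(ltW t0) // ler_piMl; lra.
by move: h3; rewrite (_ : (3 / 4) ^+ 2 = 9 / 16); [lra|field].
Qed.

(** At label 1/2 the margin is (1 - ratio)/2, so the main term (1 - ratio)^2 / 2 of the gap is eaten
    up by the last summand of the barrier. *)
Lemma half_inactive j : (j <= m)%N -> ~~ active (1 / 2) j.
Proof.
have k0 := kap0; have k1 := kap1; have p20 := phi20; have e0 := eta0.
move=> jm; apply/negP => /andP[r0 ge].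
have [h1 h2] : gap (1 / 2) j = 2 * margin (1 / 2) j ^+ 2 - 1 / 2 * (kap * phi) -
    1 / 2 * (1 - ratio j / phi) ^+ 2 /\ ratio j / phi <= ratio j.
  split.
    have e : 1 - 1 / 2 = 2^-1 :> R by field.
    by rewrite gapE; [rewrite e invrK [_ * 2]mulrC|lra|lra].
  rewrite ler_pdivrMr; last by lra.
  by rewrite ler_peMr ?ratio_ge0 //; lra.
have h3 : 2 * margin (1 / 2) j <= 1 - ratio j / phi.
  by move: r0 h2; rewrite /margin; lra.
have h4 : (2 * margin (1 / 2) j) ^+ 2 <= (1 - ratio j / phi) ^+ 2.
  by rewrite lerXn2r ?nnegrE; lra.
have h5 : 0 < kap * phi by rewrite mulr_gt0 //; lra.
by move: ge h4; rewrite h1 exprMn; lra.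
Qed.

(** Lowering the label by [s] raises the line by [s / (th * (th - s))] times a quantity between one
    and 40/9 margins. Hence [s] of order gap th / margin moves the line by a fixed fraction of its
    height gap / th over the barrier. The admissible [s] span a factor of two, which leaves room for
    a label of the grid. *)
Lemma partner th s j : 0 < th -> th <= 1 / 2 -> (j <= m)%N -> active th j ->
  gap th j * th / (18 * margin th j) <= s -> s <= gap th j * th / (9 * margin th j) ->
  [/\ 8 / 9 * th <= th - s, active (th - s) j,
      gap th j / th / 18 <= line (th - s) j - line th j,
      line (th - s) j - line th j <= gap th j / th &
      0 < s].
Proof.
have e0 := eta0.
move=> t0 t12 jm act s1 s2.
have /andP[r0 ge] := act; have g0 : 0 < gap th j by lra.
have gr := gap_le_margin th t0 t12 j jm (ltW r0).
have g2r := gap_le_margin_sqr th t0 t12 j jm.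
have f0 := ratio_ge0 j.
have [g gE] : exists g, gap th j = g by exists (gap th j).
have [r rE] : exists r, margin th j = r by exists (margin th j).
rewrite gE in g0 gr g2r ge s1 s2 *; rewrite rE in r0 gr g2r s1 s2 *.
have s0 : 0 < s by apply: lt_le_trans s1; rewrite divr_gt0 ?mulr_gt0.
have s9 : s <= th / 9.
  apply: le_trans s2 _; rewrite ler_pdivrMr ?mulr_gt0 //.
  have : g * th <= r * th by rewrite ler_wpM2r //; lra.
  by lra.
have thf : th * (1 + ratio j) = 1 - r by rewrite -rE /margin; ring.
have rs : margin (th - s) j = r + s * (1 + ratio j) by rewrite -rE /margin; ring.
have sf : s * (1 + ratio j) <= 2 / 9 * r.
  have h : s * (9 * r) <= g * th.
    by move: s2; rewrite ler_pdivlMr ?mulr_gt0.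
  have h1 : s * (9 * r) * (1 + ratio j) <= g * th * (1 + ratio j) by rewrite ler_wpM2r //; lra.
  have h2 : g * th * (1 + ratio j) <= g.
    by rewrite -mulrA thf ler_piMr //; lra.
  have h3 : (s * (1 + ratio j)) * (9 * r) <= 2 / 9 * r * (9 * r) by lra.
  by rewrite -(@ler_pM2r _ (9 * r)) // mulr_gt0.
clear g2r.
have sf0 : 0 <= s * (1 + ratio j) by rewrite mulr_ge0; lra.
have [r' r'E] : exists r', margin (th - s) j = r' by exists (margin (th - s) j).
rewrite r'E in rs.
have r'0 : 0 < r' by lra.
have t'0 : 0 < th - s by lra.
have d0 : 0 < 1 - th by lra.
have d'0 : 0 < 1 - (th - s) by lra.
have d2 : 0 <= 1 - 2 * th by lra.
have d'2 : 0 <= 1 - 2 * (th - s) by lra.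
have diffE : line (th - s) j - line th j =
    s / (th * (th - s)) * (r / (1 - th) + r' * (ratio j * th / (1 - th)) / (1 - (th - s))).
  rewrite /line -ratio_sqr rs -rE /margin.
  by field; rewrite !gt_eqF.
have q1 : r + ratio j * th = 1 - th by move: thf; lra.
have fth0 : 0 <= ratio j * th by exact: mulr_ge0 f0 (ltW t0).
have q2 : ratio j * th / (1 - th) <= 1 by rewrite ler_pdivrMr //; lra.
have q20 : 0 <= ratio j * th / (1 - th) by exact: divr_ge0 fth0 (ltW d0).
have r't' : r' <= 1 - (th - s) by rewrite -r'E; exact: margin_le.
have lowb : r <= r / (1 - th) + r' * (ratio j * th / (1 - th)) / (1 - (th - s)).
  set x := r' / (1 - (th - s)).
  have x1 : x <= 1 by rewrite ler_pdivrMr // mul1r.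
  have xr : r <= x.
    rewrite ler_pdivlMr //; have := mulr_gt0 r0 t'0; lra.
  have x0 : 0 <= x by exact: le_trans (ltW r0) xr.
  have e1 : r / (1 - th) + ratio j * th / (1 - th) = 1.
    by rewrite -mulrDl q1 divff // gt_eqF.
  have rt0 : 0 <= r / (1 - th) by exact: divr_ge0 (ltW r0) (ltW d0).
  have h1 : x * (r / (1 - th)) <= 1 * (r / (1 - th)) by rewrite ler_wpM2r.
  rewrite mulrAC -/x.
  have h2 : x * (r / (1 - th)) + x * (ratio j * th / (1 - th)) = x by rewrite -mulrDr e1 mulr1.
  by lra.
have upb : r / (1 - th) + r' * (ratio j * th / (1 - th)) / (1 - (th - s)) <= 40 / 9 * r.
  have h1 : r / (1 - th) <= 2 * r.
    rewrite ler_pdivrMr //; have := mulr_ge0 (ltW r0) d2.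
    by lra.
  have h2 : r' * (ratio j * th / (1 - th)) / (1 - (th - s)) <= 2 * r'.
    rewrite ler_pdivrMr //.
    have : r' * (ratio j * th / (1 - th)) <= r' * 1 by exact: ler_wpM2l (ltW r'0) _ _ q2.
    have := mulr_ge0 (ltW r'0) d'2.
    by lra.
  by lra.
set E := r / (1 - th) + _ in diffE lowb upb.
have st0 : 0 < s / (th * (th - s)) by rewrite divr_gt0 // mulr_gt0.
have th' : 8 / 9 * th <= th - s by lra.
have gt0 : 0 < g * th by rewrite mulr_gt0.
have lo : g / th / 18 <= s / (th * (th - s)) * E.
  apply: le_trans (_ : s / (th * (th - s)) * r <= _); last by rewrite ler_wpM2l // ltW.
  rewrite [leRHS]mulrAC ler_pdivlMr ?mulr_gt0 //.
  move: s1; rewrite ler_pdivrMr ?mulr_gt0 // => s1.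
  apply: le_trans (_ : g / th / 18 * (th * th) <= _).
    rewrite ler_wpM2l ?divr_ge0 ?(ltW g0) ?(ltW t0) //.
    by rewrite ler_wpM2l ?(ltW t0) //; lra.
  by rewrite (_ : g / th / 18 * (th * th) = g * th / 18); [lra|field; rewrite gt_eqF].
have hi : s / (th * (th - s)) * E <= g / th.
  apply: le_trans (_ : s / (th * (th - s)) * (40 / 9 * r) <= _); first by rewrite ler_wpM2l // ltW.
  rewrite [leLHS]mulrAC ler_pdivrMr ?mulr_gt0 //.
  move: s2; rewrite ler_pdivlMr ?mulr_gt0 // => s2.
  apply: le_trans (_ : g / th * (th * (8 / 9 * th)) <= _).
    by rewrite (_ : g / th * (th * (8 / 9 * th)) = 8 / 9 * (g * th)); [lra|field; rewrite gt_eqF].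
  by rewrite ler_wpM2l ?divr_ge0 ?(ltW g0) ?(ltW t0) // ler_wpM2l // ltW.
have tt : th - s <= th by rewrite gerBl ltW.
have r00 : 0 <= margin th j by rewrite rE ltW.
have [gg _] := gap_mono_label th (th - s) j t'0 tt t12 r00.
split=> //; try by rewrite diffE.
by rewrite /active r'E r'0 /=; apply: le_trans ge _; rewrite -gE.
Qed.

Lemma grid_between (N : nat) (x y : R) : (0 < N)%N -> 0 <= y -> N%:R^-1 <= y - x ->
  exists i : nat, x <= i%:R / N%:R <= y.
Proof.
move=> N0 y0 xy; have N0R : 0 < N%:R :> R by rewrite ltr0n.
exists (Num.truncn (y * N%:R)).
have /andP[h1 h2] := truncn_itv (mulr_ge0 y0 (ltW N0R)).
apply/andP; split; last by rewrite ler_pdivrMr.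
rewrite ler_pdivlMr //; move: h2; rewrite -natr1 => h2.
have : 1 <= (y - x) * N%:R by rewrite -ler_pdivrMr // div1r.
by lra.
Qed.

(** The largest active grid label; it is not 1/2, by [half_inactive]. Its successor cannot fail
    through the margin, which is at least sqrt(kap)/4 before the step and changes by at most (1 +
    phi)/(2N). So it fails through the gap, and one mesh step changes the gap by at most [eta]. *)
Lemma bottom_label (N j : nat) : (0 < N)%N -> (j <= m)%N -> eta <= 5 / 16 -> eta <= kap ->
  (1 + phi) ^+ 2 <= N%:R * eta ->
  exists i : nat, [/\ (0 < i)%N, (i <= N)%N, active (i%:R / (2 * N)%:R) j &
     gap (i%:R / (2 * N)%:R) j <= 2 * eta].
Proof.
have k0 := kap0; have k1 := kap1; have p20 := phi20; have e0 := eta0.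
move=> N0 jm e516 ek hN; have N0R : 0 < N%:R :> R by rewrite ltr0n.
have NN : (2 * N)%:R = 2 * N%:R :> R by rewrite natrM.
have NN0 : 0 < (2 * N)%:R :> R by rewrite NN mulr_gt0.
have big1 : (1 + phi) ^+ 2 <= N%:R by apply: le_trans hN _; rewrite ler_piMr ?(ltW N0R) //; lra.
have big2 : 21 * (1 + phi) <= (1 + phi) ^+ 2 by rewrite expr2 ler_wpM2r; lra.
have th_pos i : (0 < i)%N -> 0 < i%:R / (2 * N)%:R :> R by move=> i0; rewrite divr_gt0 // ltr0n.
have th_le i : (i <= N)%N -> i%:R / (2 * N)%:R <= 1 / 2 :> R.
  move=> iN; rewrite ler_pdivrMr // NN.
  have : i%:R <= N%:R :> R by rewrite ler_nat.
  by lra.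
pose Pr i := (0 < i <= N)%N && active (i%:R / (2 * N)%:R) j.
have ex : exists i, Pr i.
  exists 1%N; rewrite /Pr N0 /=.
  have [|//|r34 g5] := small_label (1%:R / (2 * N)%:R) j (th_pos 1%N isT).
    by rewrite mulrA ler_pdivrMr // NN; lra.
  by rewrite /active; apply/andP; split; lra.
have bd i : Pr i -> (i <= N)%N by case/andP => /andP[].
case: (ex_maxnP ex bd) => i /andP[/andP[i0 iN] act] imax.
exists i; split=> //.
have iltN : (i < N)%N.
  rewrite ltn_neqAle iN andbT; apply/eqP => e; move: act.
  rewrite e NN (_ : N%:R / (2 * N%:R) = 1 / 2); last by field; rewrite gt_eqF.
  by apply/negP; exact: half_inactive.
have nact : ~~ active (i.+1%:R / (2 * N)%:R) j.
  apply/negP => act'; have := imax i.+1; rewrite /Pr act' ltnS leq0n iltN => /(_ isT).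
  by rewrite ltnn.
set th := i%:R / _ in act *; set th2 := i.+1%:R / _ in nact.
have d : th2 - th = (2 * N%:R)^-1.
  by rewrite /th2 /th -mulrBl -natrB // subSnn NN mul1r.
have th0 : 0 < th by exact: th_pos.
have th2le : th2 <= 1 / 2 by exact: th_le.
have tt : th <= th2 by rewrite -subr_ge0 d invr_ge0 mulr_ge0 // ltW.
have hk := margin_lower th th0 (le_trans tt th2le) j jm act.
have fphi := ratio_mono j m jm; have f0 := ratio_ge0 j.
have r2 : 0 < margin th2 j.
  rewrite ltNge; apply/negP => r2le.
  have hr : margin th j <= (1 + phi) / (2 * N%:R).
    have : margin th j - margin th2 j = (th2 - th) * (1 + ratio j) by rewrite /margin; ring.
    rewrite d => h.
    apply: le_trans (_ : (2 * N%:R)^-1 * (1 + ratio j) <= _); first by lra.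
    by rewrite mulrC ler_wpM2r ?invr_ge0 ?mulr_ge0 ?(ltW N0R) //; lra.
  have /andP[r0 _] := act.
  move: hr; rewrite ler_pdivlMr ?mulr_gt0 // => hr.
  have h1 : (margin th j * (2 * N%:R)) ^+ 2 <= (1 + phi) ^+ 2.
    by rewrite lerXn2r ?nnegrE ?mulr_ge0 ?(ltW r0) ?(ltW N0R) //; lra.
  have h2 : kap * N%:R ^+ 2 <= 16 * margin th j ^+ 2 * N%:R ^+ 2 by rewrite ler_wpM2r ?sqr_ge0.
  have h3 : N%:R * eta * N%:R <= N%:R * kap * N%:R by rewrite ler_wpM2r ?(ltW N0R) // ler_wpM2l // ltW.
  have h4 : (1 + phi) ^+ 2 * N%:R <= N%:R * eta * N%:R by rewrite ler_wpM2r ?(ltW N0R).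
  have h5 : (1 + phi) ^+ 2 * 441 <= (1 + phi) ^+ 2 * N%:R.
    by rewrite ler_wpM2l ?sqr_ge0 //; apply: le_trans big1; lra.
  have h6 : 0 < (1 + phi) ^+ 2 by rewrite exprn_gt0; lra.
  by lra.
move: nact; rewrite /active r2 /= -ltNge => g2.
have := gap_lipschitz th2 th j th0 tt th2le.
rewrite d => h.
have h2 : (2 * N%:R)^-1 * barrier j <= eta.
  by rewrite mulrC ler_pdivrMr ?mulr_gt0 //; apply: le_trans (barrier_le j jm) _; lra.
by lra.
Qed.

End geometry.

(** * Means over the spectrum, compared at two points above it *)

Section spectral_means.
Context {R : realType} (n : nat) (lam : 'I_n -> R).
Hypothesis n0 : (0 < n)%N.

(** Up to sign, the divided difference of [mean1]. It links a drop of the Stieltjes transform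
    between two points to [mean2], that is, to the Frobenius norm of the resolvent. *)
Definition mean11 (u v : R) : R := n%:R^-1 * \sum_i (u - lam i)^-1 * (v - lam i)^-1.
Definition mean1 (u : R) : R := n%:R^-1 * \sum_i (u - lam i)^-1.
Definition mean2 (u : R) : R := n%:R^-1 * \sum_i (u - lam i)^-1 ^+ 2.
Definition mean4 (u : R) : R := n%:R^-1 * \sum_i (u - lam i)^-1 ^+ 4.

Let nV : 0 < n%:R^-1 :> R. Proof. by rewrite invr_gt0 ltr0n. Qed.

Variables (u v g : R).
Hypotheses (g0 : 0 < g) (lg : forall i, lam i <= u - g) (uv : u <= v).

Let u_lam i : g <= u - lam i. Proof. by have := lg i; rewrite lerBrDr addrC -lerBrDr. Qed.
Let u0 i : 0 < u - lam i. Proof. exact: lt_le_trans (u_lam i). Qed.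
Let uvl i : u - lam i <= v - lam i. Proof. by rewrite lerB. Qed.
Let v0 i : 0 < v - lam i. Proof. exact: lt_le_trans (uvl i). Qed.
Let vu i : (v - lam i)^-1 <= (u - lam i)^-1. Proof. by rewrite lef_pV2 ?posrE. Qed.
Let ug i : (u - lam i)^-1 <= g^-1. Proof. by rewrite lef_pV2 ?posrE. Qed.
Let vV i : 0 <= (v - lam i)^-1. Proof. by rewrite invr_ge0 ltW. Qed.
Let uV i : 0 <= (u - lam i)^-1. Proof. by rewrite invr_ge0 ltW. Qed.

Lemma mean1_diff : mean1 u - mean1 v = (v - u) * mean11 u v.
Proof.
rewrite /mean1 /mean11 mulrCA -mulrBr; congr (_ * _).
rewrite -sumrB mulr_sumr; apply: eq_bigr => i _.
by field; rewrite !gt_eqF.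
Qed.

Lemma mean2_ge0 : 0 <= mean2 v.
Proof. by rewrite mulr_ge0 ?(ltW nV) // sumr_ge0 // => i _; exact: sqr_ge0. Qed.

Lemma mean2_le_mean11 : mean2 v <= mean11 u v.
Proof.
rewrite ler_wpM2l ?(ltW nV) //; refine (ler_sumR _ _ _ _ _ _ _) => i _.
by rewrite expr2 ler_wpM2r.
Qed.

Lemma mean11_le_mean2 : mean11 u v <= mean2 u.
Proof.
rewrite ler_wpM2l ?(ltW nV) //; refine (ler_sumR _ _ _ _ _ _ _) => i _.
by rewrite expr2 ler_wpM2l.
Qed.

Lemma mean2_le_mean1 : mean2 u <= mean1 u / g.
Proof.
rewrite /mean2 /mean1 -mulrA ler_wpM2l ?(ltW nV) // mulr_suml.
by refine (ler_sumR _ _ _ _ _ _ _) => i _; rewrite expr2 ler_wpM2l.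
Qed.

Lemma mean1_gt0 : 0 < mean1 u.
Proof.
rewrite mulr_gt0 //; have i0 : 'I_n := Ordinal n0.
rewrite (bigD1 i0) //= ltr_pwDl ?invr_gt0 // sumr_ge0 // => i _; exact: uV.
Qed.

Lemma mean11_sub_mean2 : mean11 u v - mean2 v <= (v - u) * (mean2 u / g).
Proof.
rewrite /mean11 /mean2 -mulrBr -mulrA mulrCA ler_wpM2l ?(ltW nV) // -sumrB.
rewrite mulr_suml mulr_sumr; refine (ler_sumR _ _ _ _ _ _ _) => i _.
rewrite (_ : _ - _ = (v - u) * ((u - lam i)^-1 * (v - lam i)^-1 ^+ 2)); last first.
  by field; rewrite !gt_eqF.
rewrite ler_wpM2l ?subr_ge0 // [leLHS]mulrC ler_pM ?exprn_ge0 //.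
by rewrite lerXn2r ?nnegrE.
Qed.

Lemma mean4_le : mean4 v <= mean2 v / g ^+ 2.
Proof.
rewrite /mean4 /mean2 -mulrA ler_wpM2l ?(ltW nV) // mulr_suml.
refine (ler_sumR _ _ _ _ _ _ _) => i _.
rewrite -[4%N]/(2 + 2)%N exprD ler_wpM2l ?sqr_ge0 // -exprVn.
have h := le_trans (vu i) (ug i).
by rewrite lerXn2r // nnegrE ?vV // (le_trans _ h) ?vV.
Qed.

(** Termwise, v - lam is at most 1 + (v - u)/g times u - lam. This converts a small drop of [mean1]
    over a distance comparable to [g] into a bound on the Frobenius norm at the nearer point. *)
Lemma mean2_le_mean11_mul : mean2 u <= (1 + (v - u) / g) * mean11 u v.
Proof.
rewrite /mean11 /mean2 mulrCA ler_wpM2l ?(ltW nV) // mulr_sumr.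
refine (ler_sumR _ _ _ _ _ _ _) => i _.
rewrite expr2 mulrCA ler_wpM2l // ler_pdivlMr //.
rewrite mulrC ler_pdivrMr // mulrDl mul1r.
have -> : v - lam i = (u - lam i) + (v - u) by ring.
rewrite lerD2l -mulrA ler_peMr ?subr_ge0 // mulrC ler_pdivlMr // mul1r //.
Qed.

Lemma mean11_ge_term i : n%:R^-1 * ((u - lam i)^-1 * (v - lam i)^-1) <= mean11 u v.
Proof.
rewrite ler_wpM2l ?(ltW nV) // (bigD1 i) //= lerDl sumr_ge0 // => j _.
by rewrite mulr_ge0.
Qed.

End spectral_means.

(* Here G and K are the resolvents at the old and the new point; t1, t2, tau are the
   normalized traces of K, K^2, G K, and a, b the quadratic forms of K, K^2. *)
Lemma step_expansion (R : realType) (N s t1 t2 tau del a b : R) :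
  N != 0 -> 1 - s != 0 -> 1 - a != 0 -> s - t1 = del * tau -> del = N^-1 / (1 - s) ->
  t1 + N^-1 * (b / (1 - a)) - s - N^-1 * ((b - t2) / (1 - s) + t2 * (a - t1) / (1 - s) ^+ 2) =
  N^-1 * ((t2 - tau) / (1 - s) + (b - t2) * (a - s) / ((1 - a) * (1 - s))
    + t2 * (a - s) ^+ 2 / ((1 - a) * (1 - s) ^+ 2) - t2 * (del * tau) / (1 - s) ^+ 2).
Proof.
move=> N0 s0 a0 st dE.
have t1E : t1 = s - N^-1 / (1 - s) * tau by rewrite -dE -st; ring.
rewrite dE t1E; field; by rewrite N0 s0 a0.
Qed.

(** In [step_expansion] the main drifts have cancelled down to (t2 - tau)/(1 - s); what else remains
    is quadratic in the fluctuations or carries an additional factor 1/N. The premise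
    [3 * q <= N * ea] makes the deterministic shift del tau no larger than the fluctuation [ea], so
    that a - s is at most twice [ea] in size. *)
Lemma step_remainder (R : realType) (N s t1 t2 tau del a b q g ea eb : R) :
  0 < N -> 0 < g -> s <= 3 / 5 -> 0 <= ea -> 0 <= eb ->
  s - t1 = del * tau -> del = N^-1 / (1 - s) ->
  0 <= t2 -> t2 <= tau -> tau <= q -> tau - t2 <= del * (q / g) ->
  `|a - t1| <= ea -> `|b - t2| <= eb ->
  3 * q <= N * ea -> ea <= 1 / 20 ->
  `|t1 + N^-1 * (b / (1 - a)) - s -
     N^-1 * ((b - t2) / (1 - s) + t2 * (a - t1) / (1 - s) ^+ 2)| <=
    N^-1 * (8 * q / (N * g) + 20 * eb * ea + 100 * q * ea ^+ 2 + 20 * q ^+ 2 / N).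
Proof.
move=> N0 g0 s35 ea0 eb0 st dE t20 t2tau tauq tt ha hb qea ea20.
have s1 : 2 / 5 <= 1 - s by lra.
have del0 : 0 <= del by rewrite dE divr_ge0 ?invr_ge0 //; lra.
have delN : del <= 5 / 2 / N.
  rewrite dE ler_pdivrMr; last by lra.
  rewrite mulrAC -[leLHS]mul1r ler_wpM2r ?invr_ge0 ?(ltW N0) //; lra.
have tau0 : 0 <= tau by lra.
have q0 : 0 <= q by lra.
have dtau : del * tau <= ea.
  apply: le_trans (_ : 5 / 2 / N * q <= _); first by rewrite ler_pM.
  by rewrite mulrAC ler_pdivrMr //; lra.
have dtau0 : 0 <= del * tau by rewrite mulr_ge0.
have has : `|a - s| <= 2 * ea.
  have -> : a - s = (a - t1) - del * tau by rewrite -st; ring.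
  by apply: le_trans (ler_normB _ _) _; rewrite (ger0_norm dtau0); lra.
have a1 : 3 / 10 <= 1 - a by move: has; rewrite ler_norml => /andP[_]; lra.
have N00 : N != 0 by rewrite gt_eqF.
have s00 : 1 - s != 0 by rewrite gt_eqF //; lra.
have a00 : 1 - a != 0 by rewrite gt_eqF //; lra.
rewrite (step_expansion _ N s t1 t2 tau del a b) // normrM gtr0_norm ?invr_gt0 //.
rewrite ler_wpM2l ?invr_ge0 ?(ltW N0) //.
have sV : (1 - s)^-1 <= 5 / 2.
  by rewrite -[5 / 2]invrK lef_pV2 ?posrE ?invr_gt0; lra.
have sV0 : 0 <= (1 - s)^-1 by rewrite invr_ge0; lra.
have aV : (1 - a)^-1 <= 10 / 3.
  by rewrite -[10 / 3]invrK lef_pV2 ?posrE ?invr_gt0; lra.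
have aV0 : 0 <= (1 - a)^-1 by rewrite invr_ge0; lra.
have b1 : `|(t2 - tau) / (1 - s)| <= 8 * q / (N * g).
  rewrite normrM (ger0_norm sV0) distrC ger0_norm ?subr_ge0 //.
  apply: le_trans (_ : (5 / 2 / N * (q / g)) * (5 / 2) <= _).
    rewrite ler_pM ?subr_ge0 //; apply: le_trans tt _.
    by rewrite ler_wpM2r // divr_ge0 // ltW.
  rewrite (_ : 5 / 2 / N * (q / g) * (5 / 2) = 25 / 4 * (q / (N * g))); last first.
    by field; rewrite N00 gt_eqF.
  rewrite -[leRHS]mulrA ler_wpM2r ?divr_ge0 ?mulr_ge0 ?(ltW N0) ?(ltW g0) //; lra.
have b2 : `|(b - t2) * (a - s) / ((1 - a) * (1 - s))| <= 20 * eb * ea.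
  rewrite normrM normrM invfM (ger0_norm (mulr_ge0 aV0 sV0)).
  apply: le_trans (_ : (eb * (2 * ea)) * (10 / 3 * (5 / 2)) <= _); last first.
    by have := mulr_ge0 eb0 ea0; lra.
  by rewrite ler_pM ?mulr_ge0 // ler_pM.
have sV2 : (1 - s)^-1 ^+ 2 <= 25 / 4.
  apply: le_trans (_ : (5 / 2) ^+ 2 <= _); first by rewrite lerXn2r ?nnegrE //; lra.
  by rewrite (_ : (5 / 2) ^+ 2 = 25 / 4 :> R) //; field.
have b3 : `|t2 * (a - s) ^+ 2 / ((1 - a) * (1 - s) ^+ 2)| <= 100 * q * ea ^+ 2.
  rewrite !normrM (ger0_norm t20) invfM -exprVn normrM (ger0_norm aV0) normrX (ger0_norm sV0).
  apply: le_trans (_ : (q * ((2 * ea) * (2 * ea))) * (10 / 3 * (25 / 4)) <= _); last first.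
    by have := mulr_ge0 q0 (sqr_ge0 ea); lra.
  have t2q : t2 <= q by exact: le_trans t2tau _.
  apply: ler_pM.
  - by apply: mulr_ge0 => //; exact: mulr_ge0.
  - by apply: mulr_ge0 => //; exact: exprn_ge0.
  - by apply: ler_pM => //; first [exact: mulr_ge0|exact: ler_pM].
  - by apply: ler_pM => //; exact: exprn_ge0.
have b4 : `|t2 * (del * tau) / (1 - s) ^+ 2| <= 20 * q ^+ 2 / N.
  rewrite !normrM (ger0_norm t20) (ger0_norm del0) (ger0_norm tau0) -exprVn normrX (ger0_norm sV0).
  apply: le_trans (_ : (q * (5 / 2 / N * q)) * (25 / 4) <= _); last first.
    rewrite (_ : _ * (25 / 4) = 125 / 8 * (q ^+ 2 / N)); last by field; rewrite N00.
    rewrite -[leRHS]mulrA ler_wpM2r ?divr_ge0 ?exprn_ge0 ?(ltW N0) //; lra.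
  have t2q : t2 <= q by exact: le_trans t2tau _.
  apply: ler_pM => //.
  - by apply: mulr_ge0 => //; exact: mulr_ge0.
  - exact: exprn_ge0.
  - by apply: ler_pM => //; first [exact: mulr_ge0|exact: ler_pM].
apply: le_trans (ler_normB _ _) _; apply: lerD => //.
apply: le_trans (ler_normD _ _) _; apply: lerD => //.
by apply: le_trans (ler_normD _ _) _; apply: lerD.
Qed.

Ltac pos := solve [ repeat first
  [ assumption | (apply: ltW; assumption) | by []
  | apply: divr_gt0 | apply: divr_ge0 | apply: mulr_gt0 | apply: mulr_ge0
  | apply: exprn_gt0 | apply: exprn_ge0 | rewrite invr_gt0 | rewrite invr_ge0 ] ].

Lemma inv_one_sub_bounds (R : realType) (s : R) : s <= 3 / 5 ->
  [/\ 0 < 1 - s, 0 <= (1 - s)^-1, (1 - s)^-1 <= 5 / 2 & (1 - s)^-1 ^+ 2 <= (5 / 2) ^+ 2].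
Proof.
move=> s35; have s1 : 0 < 1 - s by lra.
have sV : (1 - s)^-1 <= 5 / 2 by rewrite -[5 / 2]invrK lef_pV2 ?posrE ?invr_gt0; lra.
have sV0 : 0 <= (1 - s)^-1 by rewrite invr_ge0 ltW.
by split=> //; rewrite lerXn2r ?nnegrE //; lra.
Qed.

Lemma normr_le_sqr (R : realDomainType) (x y : R) : 0 <= y -> x ^+ 2 <= y ^+ 2 -> `|x| <= y.
Proof. by move=> y0; rewrite -[x ^+ 2](real_normK (num_real _)) ler_pXn2r ?nnegrE. Qed.

Lemma inv_one_sub_le2 (R : realType) (t : R) : t <= 1 / 2 -> 0 < 1 - t /\ (1 - t)^-1 <= 2.
Proof.
move=> t12; split; first by lra.
by rewrite -[2]invrK lef_pV2 ?posrE ?invr_gt0; lra.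
Qed.

Definition label {R : realType} (N i : nat) : R := i%:R / (2 * N)%:R.

Lemma label_bounds (R : realType) (N i : nat) : (0 < i <= N)%N ->
  0 < label N i :> R /\ label N i <= 1 / 2 :> R.
Proof.
case/andP=> i0 iN; have N0 : 0 < N%:R :> R by rewrite ltr0n (leq_trans i0).
rewrite /label natrM; split; first by rewrite divr_gt0 ?mulr_gt0 // ltr0n.
rewrite ler_pdivrMr ?mulr_gt0 //.
have : i%:R <= N%:R :> R by rewrite ler_nat.
by lra.
Qed.

(** * The process of adding columns, for a fixed sample *)

Section process.
Context {R : realType} {n : nat} (z : nat -> 'cV[R]_n).

Fixpoint gram (k : nat) : 'M[R]_n :=
  if k is k'.+1 then gram k' + z k' *m (z k')^T else 0.

Definition stieltjes (A : 'M[R]_n) (u : R) : R := n%:R^-1 * \tr (resolvent A u).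

(* The moving point is chosen adaptively so that the normalized trace of the
   resolvent there is a martingale up to second-order terms. *)
Fixpoint point (th : R) (k : nat) : R :=
  if k is k'.+1 then
    point th k' + n%:R^-1 / (1 - stieltjes (gram k') (point th k'))
  else th^-1.

Definition sval (th : R) (k : nat) : R := stieltjes (gram k) (point th k).
(** The old matrix at the new point. Since [point th k.+1] is determined by the columns before k, so
    are [Kmx], [K2mx] and [Bmx] at time k. *)
Definition Kmx (th : R) (k : nat) : 'M[R]_n := resolvent (gram k) (point th k.+1).
Definition K2mx (th : R) (k : nat) : 'M[R]_n :=
  res_prod (gram k) [:: point th k.+1; point th k.+1].
(** The linearization of (1/n) b/(1 - a) in the forms b and a of [K2mx] and [Kmx], with the
    derivatives taken at the mean of b and at a = sval: its centered form is the martingale part of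
    the increment of [sval]. *)
Definition Bmx (th : R) (k : nat) : 'M[R]_n :=
  n%:R^-1 *: ((1 - sval th k)^-1 *: K2mx th k +
    (n%:R^-1 * \tr (K2mx th k) / (1 - sval th k) ^+ 2) *: Kmx th k).
Definition centered (M : 'M[R]_n) (x : 'cV[R]_n) : R := qform M x - n%:R^-1 * \tr M.
Definition frob (M : 'M[R]_n) : R := \sum_i \sum_l M i l ^+ 2.

Lemma gram_sym k : (gram k)^T = gram k.
Proof.
elim: k => [|k IH] /=; first by rewrite trmx0.
by rewrite linearD /= IH trmx_mul trmxK.
Qed.

Lemma stieltjesE (A : 'M[R]_n) lam u : spectral_data A lam -> (forall i, lam i != u) ->
  stieltjes A u = mean1 n lam u.
Proof.
move=> [_ _ _ tr _] hu; have := tr [:: u]; rewrite /res_prod /= mulmx1 /stieltjes => ->.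
  by congr (_ * _); apply: eq_bigr => i _; rewrite !big_cons big_nil mulr1.
by move=> v; rewrite !inE => /eqP ->.
Qed.

Lemma trace_K2 (A : 'M[R]_n) lam u : spectral_data A lam -> (forall i, lam i != u) ->
  n%:R^-1 * \tr (res_prod A [:: u; u]) = mean2 n lam u.
Proof.
move=> [_ _ _ tr _] hu; rewrite tr.
  by congr (_ * _); apply: eq_bigr => i _; rewrite !big_cons big_nil mulr1.
by move=> v; rewrite !inE orbb => /eqP ->.
Qed.

Lemma centered_lin (c1 c2 c : R) (M N : 'M[R]_n) x :
  centered (c *: (c1 *: M + c2 *: N)) x = c * (c1 * centered M x + c2 * centered N x).
Proof.
rewrite /centered /qform -scalemxAr -scalemxAl mulmxDr mulmxDl -!scalemxAr -!scalemxAl.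
by rewrite mxtraceZ mxtraceD !mxtraceZ !mxE; ring.
Qed.

Lemma frob_lin (c1 c2 c : R) (M N : 'M[R]_n) :
  frob (c *: (c1 *: M + c2 *: N)) <= 2 * c ^+ 2 * (c1 ^+ 2 * frob M + c2 ^+ 2 * frob N).
Proof.
rewrite /frob !mulr_sumr -big_split /= mulr_sumr; refine (ler_sumR _ _ _ _ _ _ _) => i _.
rewrite !mulr_sumr -big_split /= mulr_sumr; refine (ler_sumR _ _ _ _ _ _ _) => l _.
rewrite !mxE; have h := mulr_ge0 (sqr_ge0 c) (sqr_ge0 (c1 * M i l - c2 * N i l)).
by lra.
Qed.

Variables (m N : nat) (kap eta X X1 : R).
Hypotheses (n0 : (0 < n)%N) (N0 : (0 < N)%N).
Local Notation phi := (@ratio R n m).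
Local Notation margin := (@margin R n).
Local Notation barrier := (@barrier R n m kap).
Local Notation line := (@line R n).
Local Notation gap := (@gap R n m kap).
Local Notation active := (@active R n m kap eta).
Hypotheses (eta0 : 0 < eta) (eta18 : eta <= 1 / 8) (etakap : eta <= kap) (kap1 : kap <= 1).
Hypotheses (phi20 : 20 <= phi) (X11 : 1 <= X1) (XE : X = 4 * 10 ^+ 5 * X1 ^+ 2).
Hypothesis H1 : 10 ^+ 5 * X <= n%:R * (eta * Num.sqrt eta).
Hypothesis H2 : 2 * (1 + phi) ^+ 2 <= N%:R * eta.
Hypothesis H4 : 16 * (52 * n%:R * eta ^+ 2) ^+ 2 < kap.

Local Notation label := (@label R N).
Local Notation label_bounds := (@label_bounds R N).

(** The Frobenius bounds stand as premises on purpose: the truncated forms obey the tail bounds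
    unconditionally, so these implications hold with high probability before anything is known about
    the spectrum. *)
Definition concentrated (th : R) : Prop :=
  [/\ forall k, (k < m)%N -> active th k.+1 ->
        frob (Kmx th k) <= 16 * n%:R * th ^+ 2 / margin th k ->
        centered (Kmx th k) (z k) ^+ 2 <=
          X1 ^+ 2 * (n%:R^-1 ^+ 2 * (16 * n%:R * th ^+ 2 / margin th k)),
      forall k, (k < m)%N -> active th k.+1 ->
        frob (K2mx th k) <= 64 * n%:R * th ^+ 4 / (margin th k * gap th k ^+ 2) ->
        centered (K2mx th k) (z k) ^+ 2 <=
          X1 ^+ 2 * (n%:R^-1 ^+ 2 * (64 * n%:R * th ^+ 4 / (margin th k * gap th k ^+ 2)))
    & forall k, (k <= m)%N -> active th k ->
        (forall j, (j < k)%N ->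
          frob (Bmx th j) <= 64 ^+ 2 * th ^+ 4 / (n%:R * (margin th j * gap th j ^+ 2))) ->
        (\sum_(j < k) centered (Bmx th j) (z j)) ^+ 2 <=
          X1 ^+ 2 * (n%:R^-1 ^+ 2 * (128 ^+ 2 * th ^+ 2 / (margin th k ^+ 2 * gap th k)))].

Hypothesis conc : forall i, (0 < i <= N)%N -> concentrated (label i).

Definition err (th : R) (j : nat) : R :=
  X * th / (n%:R * (margin th j * Num.sqrt (gap th j))).

(** Since gap / th is the height of the line over the barrier, the moving point deviates from its
    line by at most 1/200 of that height. *)
Definition good (th : R) (j : nat) : Prop :=
  `|sval th j - th| <= err th j /\ `|point th j - line th j| <= gap th j / (200 * th).

Let nR : 0 < n%:R :> R. Proof. by rewrite ltr0n. Qed.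
Let NR : 0 < N%:R :> R. Proof. by rewrite ltr0n. Qed.
Let X0 : 0 <= X. Proof. by rewrite XE; have := sqr_ge0 X1; lra. Qed.
Let kap0 : 0 < kap. Proof. exact: lt_le_trans etakap. Qed.

Ltac fixed H := first
  [ constr_eq H eta0 | constr_eq H eta18 | constr_eq H etakap | constr_eq H kap1
  | constr_eq H phi20 | constr_eq H X11 | constr_eq H XE | constr_eq H H1 | constr_eq H H2
  | constr_eq H H4 | constr_eq H nR | constr_eq H NR | constr_eq H X0 | constr_eq H kap0 ].
Ltac forget := repeat match goal with
  | H : is_true (@Order.le _ _ _ _) |- _ => tryif fixed H then fail else clear H
  | H : is_true (@Order.lt _ _ _ _) |- _ => tryif fixed H then fail else clear H
  | H : @eq _ _ _ |- _ => tryif fixed H then fail else clear H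
  end.

Let margin_le1 th j : 0 < th -> margin th j <= 1 - th.
Proof. by move=> t0; apply: margin_le. Qed.

Let act_mono th j k : 0 < th -> th <= 1 / 2 -> (j <= k)%N -> (k <= m)%N -> active th k ->
  [/\ active th j, gap th k <= gap th j & margin th k <= margin th j].
Proof. by move=> *; apply: active_mono. Qed.

Let sum32 th k : 0 < th -> th <= 1 / 2 -> (k <= m)%N -> active th k ->
  \sum_(j < k) (th ^+ 2 / n%:R) / (margin th j * Num.sqrt (gap th j)) <=
    16 / Num.sqrt (gap th k).
Proof. by move=> *; apply: (@gap_sum32 R n m kap eta). Qed.

Let sum1 th k : 0 < th -> th <= 1 / 2 -> (k <= m)%N -> active th k ->
  \sum_(j < k) (th ^+ 2 / n%:R) / (margin th j * gap th j) <=
    16 / (margin th k * Num.sqrt (gap th k)).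
Proof. by move=> *; apply: (@gap_sum1 R n m kap eta). Qed.

Let partn th s j : 0 < th -> th <= 1 / 2 -> (j <= m)%N -> active th j ->
  gap th j * th / (18 * margin th j) <= s -> s <= gap th j * th / (9 * margin th j) ->
  [/\ 8 / 9 * th <= th - s, active (th - s) j,
      gap th j / th / 18 <= line (th - s) j - line th j,
      line (th - s) j - line th j <= gap th j / th &
      0 < s].
Proof. by move=> *; apply: partner. Qed.

Let small th j : 0 < th -> 4 * (1 + phi) * th <= 1 -> (j <= m)%N ->
  3 / 4 <= margin th j /\ 5 / 16 <= gap th j.
Proof. by move=> *; apply: (@small_label R n m kap eta). Qed.

Let margin_low th j : 0 < th -> th <= 1 / 2 -> (j <= m)%N -> active th j ->
  kap <= 16 * margin th j ^+ 2.
Proof. by move=> *; apply: (@margin_lower R n m kap eta). Qed.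

Let gap_label th th' j : 0 < th' -> th' <= th -> th <= 1 / 2 -> 0 <= margin th j ->
  gap th j <= gap th' j /\ margin th j <= margin th' j.
Proof. by move=> *; apply: gap_mono_label. Qed.

(** Consequences of [H1], which says that n eta^(3/2) dominates the noise level. The last bound
    makes [err] negligible against gap th / margin, the spacing between a label and its partner. *)
Lemma active_facts th j : 0 < th -> th <= 1 / 2 -> (j <= m)%N -> active th j ->
  [/\ 0 < margin th j, margin th j <= 1, 0 < gap th j & gap th j <= margin th j] /\
  [/\ 0 < Num.sqrt (gap th j), Num.sqrt (gap th j) ^+ 2 = gap th j,
      10 ^+ 5 * X <= n%:R * (gap th j * Num.sqrt (gap th j)),
      10 ^+ 4 * X1 ^+ 2 <= n%:R * margin th j
    & 0 <= err th j <= gap th j * th / (10 ^+ 5 * margin th j)].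
Proof.
move=> t0 t12 jm act; have /andP[r0 ge] := act.
have g0 : 0 < gap th j by exact: lt_le_trans ge.
have gr : gap th j <= margin th j.
  by apply: gap_le_margin => //; rewrite ltW.
have r1 : margin th j <= 1.
  by apply: le_trans (margin_le1 th j t0) _; lra.
have y0 : 0 < Num.sqrt (gap th j) by rewrite sqrtr_gt0.
have ysq : Num.sqrt (gap th j) ^+ 2 = gap th j by rewrite sqr_sqrtr // ltW.
have hX : 10 ^+ 5 * X <= n%:R * (gap th j * Num.sqrt (gap th j)).
  apply: le_trans H1 _; rewrite ler_wpM2l ?(ltW nR) //.
  by rewrite ler_pM ?sqrtr_ge0 ?(ltW eta0) // ler_wsqrtr.
split=> //; split=> //.
  have : n%:R * (gap th j * Num.sqrt (gap th j)) <= n%:R * margin th j.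
    rewrite ler_wpM2l ?(ltW nR) // -[leRHS]mulr1 ler_pM ?sqrtr_ge0 ?(ltW g0) //.
    by rewrite -sqrtr1 ler_wsqrtr // (le_trans gr).
  by move: hX; rewrite XE; have := sqr_ge0 X1; lra.
apply/andP; split.
  by rewrite divr_ge0 ?mulr_ge0 ?X0 ?(ltW t0) ?(ltW nR) ?(ltW r0) ?(ltW y0).
rewrite /err ler_pdivrMr ?mulr_gt0 //.
rewrite (_ : _ / _ * _ = th / 10 ^+ 5 * (n%:R * (gap th j * Num.sqrt (gap th j)))); last first.
  by field; rewrite gt_eqF.
have := ler_wpM2l (ltW t0) hX.
by lra.
Qed.

(** * One time step and the exclusion of eigenvalues above the barrier *)

Section at_time.
Variables (j : nat) (lam : 'I_n -> R).
Hypotheses (jm : (j <= m)%N) (sd : spectral_data (gram j) lam).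

Lemma good_gap th : 0 < th -> th <= 1 / 2 -> active th j -> good th j ->
  (forall i, lam i <= barrier j) ->
  [/\ forall i, lam i <= point th j - gap th j / (2 * th),
      forall i, lam i <= point th j - gap th j / th * (199 / 200),
      0 < gap th j / (2 * th), sval th j = mean1 n lam (point th j) & sval th j <= 3 / 5].
Proof.
move=> t0 t12 act [gs gu] lb.
have [[r0 r1 g0 gr] [y0 ysq hX hr /andP[e0 e1]]] := active_facts th j t0 t12 jm act.
have G0 : 0 < gap th j / th by rewrite divr_gt0.
have Ub : line th j - barrier j = gap th j / th.
  by rewrite gap_line mulrC mulKf // gt_eqF.
have e200 : gap th j / (200 * th) = gap th j / th / 200 by field; rewrite gt_eqF.
have e2 : gap th j / (2 * th) = gap th j / th / 2 by field; rewrite gt_eqF.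
have h1 i : lam i <= point th j - gap th j / th * (199 / 200).
  have := lb i; move: gu; rewrite e200 ler_norml => /andP[h _]; lra.
have h2 i : lam i <= point th j - gap th j / (2 * th).
  by apply: le_trans (h1 i) _; rewrite e2; lra.
split=> //.
- by rewrite e2 divr_gt0.
- apply: stieltjesE => // i; rewrite lt_eqF //.
  by have := h1 i; lra.
- have : err th j <= 1 / 20.
    apply: le_trans e1 _; rewrite ler_pdivrMr ?mulr_gt0 //.
    have : gap th j * th <= margin th j * (1 / 2) by rewrite ler_pM // ltW.
    by lra.
  by move: gs; rewrite ler_norml => /andP[_]; lra.
Qed.

Hypothesis gd : forall i, (0 < i <= N)%N -> active (label i) j -> good (label i) j.

(** By [H2] the mesh is at most half the admissible range of [partner], so a grid label lies in it.
    Both labels being good, their points are separated like their lines up to 3/200 of the height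
    gap / th, and their traces like the labels up to twice [err]. *)
Lemma grid_partner i th :
  (forall i, (0 < i <= N)%N -> active (label i) j -> forall l, lam l < point (label i) j) ->
  th = label i -> (0 < i <= N)%N -> active th j ->
  1 < 4 * (1 + phi) * th ->
  exists h, [/\ gap th j / th / 25 <= h, h <= 2 * (gap th j / th) &
    mean1 n lam (point th j) - mean1 n lam (point th j + h) <= gap th j * th / (8 * margin th j)].
Proof.
move=> lt thE iN act th4; have [t0 t12] := label_bounds i iN; rewrite -thE in t0 t12.
have [[r0 r1 g0 gr] [y0 ysq hX hr /andP[e0 e1]]] := active_facts th j t0 t12 jm act.
have /andP[_ ge] := act.
have p20 := phi20; have h2N := H2.
have G0 : 0 < gap th j / th by pos.
set a := gap th j * th / (18 * margin th j); set b := gap th j * th / (9 * margin th j).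
have bE : b = 2 * a by rewrite /a /b; field; rewrite gt_eqF.
have a0 : 0 < a by rewrite /a; pos.
have a9 : a <= th / 18.
  rewrite /a ler_pdivrMr; last by pos.
  have := ler_wpM2r (ltW t0) gr; lra.
have aN : (2 * N)%:R^-1 <= a.
  rewrite natrM -[leLHS]mul1r ler_pdivrMr; last by pos.
  rewrite /a mulrAC ler_pdivlMr; last by pos.
  rewrite mul1r.
  have h1 : eta * (4 * (1 + phi) * th) <= gap th j * (4 * (1 + phi) * th).
    by rewrite ler_wpM2r // ?(le_trans ler01) // ltW.
  have h2 : 2 * (1 + phi) * 21 <= 2 * (1 + phi) * (1 + phi) by rewrite ler_wpM2l; lra.
  have h3 : 2 * (1 + phi) * 21 * 1 <= N%:R * eta * (4 * (1 + phi) * th).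
    apply: ler_pM; [by lra|by []| |by apply: ltW].
    by apply: le_trans h2 _; apply: le_trans h2N; rewrite expr2 mulrA.
  have h4 : N%:R * (eta * (4 * (1 + phi) * th)) <= N%:R * (gap th j * (4 * (1 + phi) * th)).
    by rewrite ler_wpM2l // ltW.
  have h5 : 0 < 4 * (1 + phi) by lra.
  rewrite -(@ler_pM2r _ (4 * (1 + phi))) //.
  have h6 : margin th j * (1 + phi) <= 1 * (1 + phi) by rewrite ler_wpM2r //; lra.
  by lra.
have [i' /andP[xi iy]] : exists i' : nat, th - b <= i'%:R / (2 * N)%:R <= th - a.
  apply: grid_between; first by rewrite muln_gt0 N0.
    by lra.
  by rewrite bE; lra.
have [th' t'E] : exists t, i'%:R / (2 * N)%:R = t :> R by exists (i'%:R / (2 * N)%:R).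
rewrite t'E in xi iy.
have [s1 s2] : a <= th - th' /\ th - th' <= b by split; lra.
have [p1 p2 p3 p4 p5] := partn th (th - th') j t0 t12 jm act s1 s2.
rewrite (_ : th - (th - th') = th') in p1 p2 p3 p4; last by ring.
have t'0 : 0 < th' by lra.
have i'N : (0 < i' <= N)%N.
  apply/andP; split.
    by move: t'0; rewrite -t'E; case: (i') => //; rewrite mul0r ltxx.
  have : th' <= 1 / 2 by lra.
  rewrite -t'E natrM ler_pdivrMr ?mulr_gt0 // => h.
  by rewrite -(ler_nat R); lra.
have t'12 : th' <= 1 / 2 by lra.
have gi : good th j by rewrite thE; apply: gd => //; rewrite -thE.
have gi' : good th' j by rewrite -t'E; apply: (gd i') => //; rewrite /label t'E.
have se : sval th j = mean1 n lam (point th j).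
  by apply: stieltjesE => // l; rewrite lt_eqF // thE; apply: lt => //; rewrite -thE.
have se' : sval th' j = mean1 n lam (point th' j).
  by apply: stieltjesE => // l; rewrite lt_eqF // -t'E; apply: (lt i') => //; rewrite /label t'E.
have [[r0' r1' g0' gr'] [y0' ysq' hX' hr' /andP[e0' e1']]] := active_facts th' j t'0 t'12 jm p2.
have [gap' marg'] : gap th j <= gap th' j /\ margin th j <= margin th' j.
  by apply: gap_label => //; [rewrite -subr_ge0 ltW|rewrite ltW].
have G' : gap th' j / th' = gap th j / th + (line th' j - line th j).
  by rewrite !gap_line ![_ * (line _ _ - _)]mulrC !mulfK ?gt_eqF //; ring.
have err' : err th' j <= err th j.
  have x0 := X0; rewrite /err.
  apply: ler_pM.
  - by pos.
  - by rewrite invr_ge0; pos.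
  - by apply: ler_wpM2l => //; rewrite -subr_ge0 ltW.
  rewrite lef_pV2 ?posrE; [|by pos|by pos].
  by rewrite ler_wpM2l ?(ltW nR) // ler_pM ?(ltW r0) ?(ltW y0) // ler_wsqrtr.
exists (point th' j - point th j).
case: gi => gs gu; case: gi' => gs' gu'.
have e200 : gap th j / (200 * th) = gap th j / th / 200 by field; rewrite gt_eqF.
have e200' : gap th' j / (200 * th') = gap th' j / th' / 200 by field; rewrite gt_eqF.
move: gu gu'; rewrite e200 e200' G' !ler_norml => /andP[u1 u2] /andP[u3 u4].
split.
- by move: u1 u2 u3 u4 p3 p4 G0; forget; lra.
- by move: u1 u2 u3 u4 p3 p4 G0; forget; lra.
rewrite (_ : point th j + (point th' j - point th j) = point th' j); last by ring.
rewrite -se -se'.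
have e8 : gap th j * th / (8 * margin th j) = 9 / 8 * b.
  by rewrite /b; field; rewrite gt_eqF.
have e5 : gap th j * th / (10 ^+ 5 * margin th j) = 9 / 10 ^+ 5 * b.
  by rewrite /b; field; rewrite gt_eqF.
rewrite e8; rewrite e5 in e1.
move: gs gs'; rewrite !ler_norml => /andP[v1 v2] /andP[v3 v4].
by have := le_trans err' e1; move: e1 v1 v2 v3 v4 s1 s2 a0 bE; forget; lra.
Qed.

(** Between a label and its partner the trace drops by at most gap th / (8 margin) over a distance
    at least gap / (25 th), so the divided difference is at most (25/8) th^2 / margin. The distance
    is at most four times the spectral clearance, so passing to [mean2] costs a factor 5. Small
    labels use the clearance alone. *)
Lemma mean2_bound i th : (forall l, lam l <= barrier j) ->
  th = label i -> (0 < i <= N)%N -> active th j ->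
  mean2 n lam (point th j) <= 16 * th ^+ 2 / margin th j.
Proof.
move=> lb thE iN act; have [t0 t12] := label_bounds i iN; rewrite -thE in t0 t12.
have [[r0 r1 g0 gr] [y0 ysq hX hr /andP[e0 e1]]] := active_facts th j t0 t12 jm act.
have gi : good th j by rewrite thE; apply: gd => //; rewrite -thE.
have [ga gb gc se s35] := good_gap th t0 t12 act gi lb.
have p20 := phi20.
have [le4|gt4] := leP (4 * (1 + phi) * th) 1.
  have [r34 g516] := small th j t0 le4 jm.
  apply: le_trans (mean2_le_mean1 n lam n0 _ _ gc ga) _.
  rewrite -se.
  have s2 : sval th j <= 2 * th.
    have : err th j <= th.
      apply: le_trans e1 _; rewrite ler_pdivrMr; last by pos.
      have := ler_wpM2r (ltW t0) gr; have := mulr_gt0 t0 r0; lra.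
    by case: gi => + _; rewrite ler_norml => /andP[_]; lra.
  rewrite ler_pdivrMr //.
  rewrite [leRHS](_ : _ = 8 * th * gap th j / margin th j); last first.
    by field; rewrite !gt_eqF.
  rewrite ler_pdivlMr //.
  have h1 : sval th j * margin th j <= 2 * th * 1.
    rewrite ler_pM //; last by rewrite ltW.
    rewrite se ltW //; apply: (mean1_gt0 n lam n0 _ _ gc ga).
  have h2 : 8 * th * (5 / 16) <= 8 * th * gap th j by rewrite ler_wpM2l //; lra.
  by lra.
have below i' : (0 < i' <= N)%N -> active (label i') j ->
    forall l, lam l < point (label i') j.
  move=> iN' act' l; have [t0' t12'] := label_bounds i' iN'.
  have [ga' _ gc' _ _] := good_gap _ t0' t12' act' (gd i' iN' act') lb.
  by have := ga' l; lra.
have [h [h1 h2 h3]] := grid_partner i th below thE iN act gt4.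
have G0 : 0 < gap th j / th by pos.
have h0 : 0 < h by lra.
have uv : point th j <= point th j + h by lra.
apply: le_trans (mean2_le_mean11_mul n lam n0 _ _ _ gc ga uv) _.
have := mean1_diff n lam _ _ _ gc ga uv.
rewrite addrAC subrr add0r => md.
have e2 : gap th j / (2 * th) = gap th j / th / 2 by field; rewrite gt_eqF.
have m11 : mean11 n lam (point th j) (point th j + h) <=
    gap th j * th / (8 * margin th j) / (gap th j / th / 25).
  rewrite ler_pdivlMr; last by pos.
  apply: le_trans h3; rewrite md mulrC ler_wpM2r //.
  exact: (le_trans (mean2_ge0 n lam n0 _) (mean2_le_mean11 n lam n0 _ _ _ gc ga uv)).
have m110 : 0 <= mean11 n lam (point th j) (point th j + h).
  exact: (le_trans (mean2_ge0 n lam n0 _) (mean2_le_mean11 n lam n0 _ _ _ gc ga uv)).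
have h5 : 1 + h / (gap th j / (2 * th)) <= 5.
  have : h / (gap th j / (2 * th)) <= 4 by rewrite ler_pdivrMr // e2; lra.
  by lra.
apply: le_trans (ler_wpM2r m110 h5) _.
apply: le_trans (ler_wpM2l _ m11) _ => //.
rewrite [leLHS](_ : _ = 125 / 8 * (th ^+ 2 / margin th j)); last by field; rewrite !gt_eqF.
rewrite -[leRHS]mulrA; apply: ler_wpM2r; first by pos.
by lra.
Qed.

Lemma centeredE (M : 'M[R]_n) x : qform M x - n%:R^-1 * \tr M = centered M x.
Proof. by []. Qed.

(** [mean2_bound] verifies the premises of the first two clauses of [concentrated]; the resulting
    bounds on the two forms feed [step_remainder], and they keep the form [a] below 1, which by
    [rank1_eigenvalue_lt] leaves the new spectrum below the new point. *)
Lemma column_step i th : (forall l, lam l <= barrier j) ->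
  th = label i -> (0 < i <= N)%N -> (j < m)%N -> active th j.+1 ->
  [/\ frob (Bmx th j) <= 64 ^+ 2 * th ^+ 4 / (n%:R * (margin th j * gap th j ^+ 2)),
      `|sval th j.+1 - sval th j - centered (Bmx th j) (z j)| <=
        2 * 10 ^+ 4 * X1 ^+ 2 * th ^+ 3 / (n%:R ^+ 2 * (margin th j * gap th j))
    & forall x, eigenvalue (gram j.+1) x -> x < point th j.+1].
Proof.
move=> lb thE iN jm1 act1; have [t0 t12] := label_bounds i iN; rewrite -thE in t0 t12.
have [act _ _] := act_mono th j j.+1 t0 t12 (leqnSn j) jm1 act1.
have [[r0 r1 g0 gr] [y0 ysq hX hr /andP[e0 e1]]] := active_facts th j t0 t12 jm act.
have gi : good th j by rewrite thE; apply: gd => //; rewrite -thE.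
have [ga _ gc se s35] := good_gap th t0 t12 act gi lb.
have q1 := mean2_bound i th lb thE iN act.
have x11 := X11; have x10 : 0 < X1 by lra.
have [Ha Hb _] := conc i iN; rewrite -thE in Ha Hb.
have [s sE] : exists s, sval th j = s by exists (sval th j).
have [u uE] : exists u, point th j = u by exists (point th j).
have [del delE] : exists del, n%:R^-1 / (1 - s) = del :> R by exists (n%:R^-1 / (1 - s)).
have [u' u'E] : exists u', point th j.+1 = u' by exists (point th j.+1).
have u'del : u' = u + del by rewrite -u'E /= -delE -sE /sval uE.
have [r rE] : exists r, margin th j = r by exists (margin th j).
have [g gE] : exists g, gap th j = g by exists (gap th j).
have KE : Kmx th j = resolvent (gram j) u' by rewrite /Kmx u'E.
have K2E : K2mx th j = res_prod (gram j) [:: u'; u'] by rewrite /K2mx u'E.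
have {Ha} := Ha j jm1 act1; have {Hb} := Hb j jm1 act1.
rewrite /Bmx; move: q1 ga gc se s35; rewrite KE K2E.
rewrite rE gE in r0 r1 g0 gr y0 ysq hX hr e1 *; rewrite sE uE.
have [q qE] : exists q, 16 * th ^+ 2 / r = q by exists (16 * th ^+ 2 / r).
have [gg ggE] : exists gg, g / (2 * th) = gg by exists (g / (2 * th)).
rewrite qE ggE => q1 ga gc se s35.
have nV : 0 < n%:R^-1 :> R by rewrite invr_gt0.
have s1 : 0 < 1 - s by have [] := inv_one_sub_bounds R s s35.
have del0 : 0 < del by rewrite -delE; pos.
have uu' : u <= u' by lra.
have ga' l : lam l <= u' - gg by have := ga l; lra.
have lt' l : lam l < u' by have := ga' l; lra.
have ne' l : lam l != u' by rewrite lt_eqF.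
have trK : n%:R^-1 * \tr (resolvent (gram j) u') = mean1 n lam u' by apply: stieltjesE.
have trK2 := trace_K2 (gram j) lam u' sd ne'.
have tau2 := mean11_le_mean2 n lam n0 _ _ _ gc ga uu'.
have t2tau := mean2_le_mean11 n lam n0 _ _ _ gc ga uu'.
have t20 := mean2_ge0 n lam n0 u'.
have t2s : mean2 n lam u' <= mean1 n lam u / gg.
  by apply: le_trans (le_trans t2tau tau2) _; apply: mean2_le_mean1.
have sub := mean11_sub_mean2 n lam n0 _ _ _ gc ga uu'.
have t4 := mean4_le n lam n0 _ _ _ gc ga uu'.
have mdiff := mean1_diff n lam _ _ _ gc ga uu'.
have fK : frob (resolvent (gram j) u') = n%:R * mean2 n lam u'.
  rewrite /frob (frobenius_resolvent n (gram j) lam) ?gram_sym // /mean2 mulrA divff ?mul1r //.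
  by rewrite gt_eqF.
have fK2 : frob (res_prod (gram j) [:: u'; u']) = n%:R * mean4 n lam u'.
  rewrite /frob (frobenius_resolvent2 n (gram j) lam) ?gram_sym // /mean4 mulrA divff ?mul1r //.
  by rewrite gt_eqF.
have q0 : 0 < q by rewrite -qE; pos.
have t2q : mean2 n lam u' <= q by apply: le_trans t2tau (le_trans tau2 q1).
have bK : frob (resolvent (gram j) u') <= 16 * n%:R * th ^+ 2 / r.
  rewrite fK (_ : 16 * n%:R * th ^+ 2 / r = n%:R * q); last by rewrite -qE; ring.
  by rewrite ler_wpM2l // ltW.
have qg : q / gg ^+ 2 = 64 * th ^+ 4 / (r * g ^+ 2).
  by rewrite -qE -ggE; field; rewrite !gt_eqF.
have bK2 : frob (res_prod (gram j) [:: u'; u']) <= 64 * n%:R * th ^+ 4 / (r * g ^+ 2).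
  rewrite fK2 (_ : 64 * n%:R * th ^+ 4 / _ = n%:R * (q / gg ^+ 2)); last by rewrite qg; ring.
  rewrite ler_wpM2l ?(ltW nR) //; apply: le_trans t4 _.
  by rewrite ler_wpM2r // invr_ge0; apply: exprn_ge0; apply: ltW.
move=> /(_ bK2) hb /(_ bK) ha.
have [_ sV0 sV sV2] := inv_one_sub_bounds R s s35.
have [a aE] : exists a, qform (resolvent (gram j) u') (z j) = a.
  by exists (qform (resolvent (gram j) u') (z j)).
have [b bE] : exists b, qform (res_prod (gram j) [:: u'; u']) (z j) = b.
  by exists (qform (res_prod (gram j) [:: u'; u']) (z j)).
rewrite -centeredE trK aE in ha; rewrite -centeredE trK2 bE in hb.
have nr0 : 0 < n%:R * r by pos.
have [Y YE] : exists Y, Num.sqrt (n%:R * r) = Y by exists (Num.sqrt (n%:R * r)).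
have Y0 : 0 < Y by rewrite -YE sqrtr_gt0.
have Y2 : Y ^+ 2 = n%:R * r by rewrite -YE sqr_sqrtr // ltW.
have YX : 100 * X1 <= Y.
  rewrite -(@ler_pXn2r _ 2) ?nnegrE //; [|by pos|by pos].
  by rewrite Y2 exprMn; apply: le_trans hr; rewrite le_eqVlt; apply/orP; left; apply/eqP; ring.
have rE2 : r = Y ^+ 2 / n%:R by rewrite Y2 mulrC mulKf // gt_eqF.
(* [ea] and [eb] are the square roots of the deviations granted by [concentrated], written with Y =
   sqrt(n margin). *)
have [ea eaE] : exists ea, 4 * X1 * th / Y = ea by exists (4 * X1 * th / Y).
have [eb ebE] : exists eb, 8 * X1 * th ^+ 2 / (Y * g) = eb by exists (8 * X1 * th ^+ 2 / (Y * g)).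
have ea0 : 0 < ea by rewrite -eaE; pos.
have eb0 : 0 < eb by rewrite -ebE; pos.
have {}ha : `|a - mean1 n lam u'| <= ea.
  apply: normr_le_sqr; first exact: ltW.
  apply: le_trans ha _.
  rewrite -eaE rE2 le_eqVlt; apply/orP; left; apply/eqP; field; by rewrite !gt_eqF.
have {}hb : `|b - mean2 n lam u'| <= eb.
  apply: normr_le_sqr; first exact: ltW.
  apply: le_trans hb _.
  rewrite -ebE rE2 le_eqVlt; apply/orP; left; apply/eqP; field; by rewrite !gt_eqF.
have ea20 : ea <= 1 / 20.
  rewrite -eaE ler_pdivrMr //.
  have : X1 * th <= X1 * (1 / 2) by rewrite ler_wpM2l // ltW.
  by move: YX x10; forget; lra.
have a1 : a < 1.
  have : mean1 n lam u' <= s.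
    rewrite se -subr_ge0 mdiff; apply: mulr_ge0; first by rewrite subr_ge0.
    exact: le_trans t20 t2tau.
  by move: ha s35 ea20; rewrite ler_norml => /andP[_]; forget; lra.
split.
- apply: le_trans (frob_lin _ _ _ _ _) _; rewrite trK2.
  rewrite [leRHS](_ : _ = 2 * n%:R^-1 ^+ 2 * (2 ^+ 11 * n%:R * th ^+ 4 / (r * g ^+ 2))); last first.
    by field; rewrite !gt_eqF.
  apply: ler_wpM2l; first by pos.
  have c1 : (1 - s)^-1 ^+ 2 * frob (res_prod (gram j) [:: u'; u']) <=
      (5 / 2) ^+ 2 * (64 * n%:R * th ^+ 4 / (r * g ^+ 2)).
    apply: ler_pM => //; first exact: exprn_ge0.
    by rewrite fK2; apply: mulr_ge0; [exact: ltW|]; rewrite /mean4; apply: mulr_ge0;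
      [exact: ltW|]; apply: sumr_ge0 => l _; exact: exprn_even_ge0.
  have t2s' : mean2 n lam u' <= 6 / 5 * th / g.
    apply: le_trans t2s _; rewrite -se -ggE (_ : 6 / 5 * th / g = 3 / 5 / (g / (2 * th))).
      by apply: ler_wpM2r => //; pos.
    by field; rewrite !gt_eqF.
  have c2 : (mean2 n lam u' / (1 - s) ^+ 2) ^+ 2 <= (6 / 5 * th / g * (5 / 2) ^+ 2) ^+ 2.
    rewrite lerXn2r ?nnegrE //.
    - by rewrite -exprVn; pos.
    - by pos.
    - by rewrite -exprVn ler_pM // exprn_ge0.
  have c3 : (mean2 n lam u' / (1 - s) ^+ 2) ^+ 2 * frob (resolvent (gram j) u') <=
      (6 / 5 * th / g * (5 / 2) ^+ 2) ^+ 2 * (16 * n%:R * th ^+ 2 / r).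
    apply: ler_pM => //; first exact: sqr_ge0.
    by rewrite fK; pos.
  apply: le_trans (lerD c1 c3) _.
  rewrite [leLHS](_ : _ = 13 * 10 ^+ 2 * (n%:R * th ^+ 4 / (r * g ^+ 2))); last first.
    by field; rewrite !gt_eqF.
  rewrite [leRHS](_ : _ = 2 ^+ 11 * (n%:R * th ^+ 4 / (r * g ^+ 2))); last by ring.
  by apply: ler_wpM2r; [pos|forget; lra].
- have fin : stieltjes (gram j + z j *m (z j)^T) u' - s -
      n%:R^-1 * ((b - mean2 n lam u') / (1 - s) + mean2 n lam u' * (a - mean1 n lam u') / (1 - s) ^+ 2) =
      mean1 n lam u' + n%:R^-1 * (b / (1 - a)) - s -
      n%:R^-1 * ((b - mean2 n lam u') / (1 - s) + mean2 n lam u' * (a - mean1 n lam u') / (1 - s) ^+ 2).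
    rewrite /stieltjes rank1_resolvent_trace ?aE ?bE ?mulrDr ?trK //.
      by have [_ _ un _ _] := sd; exact: un.
    by rewrite lt_eqF.
  rewrite centered_lin -!centeredE trK trK2 bE aE /sval u'E /=
    (_ : (1 - s)^-1 * (b - _) = (b - mean2 n lam u') / (1 - s)); last by ring.
  rewrite (_ : mean2 n lam u' / (1 - s) ^+ 2 * _ =
    mean2 n lam u' * (a - mean1 n lam u') / (1 - s) ^+ 2); last by ring.
  rewrite fin; apply: le_trans (step_remainder _ n%:R s _ _ (mean11 n lam u u') del a b q gg ea eb
     _ _ _ _ _ _ _ _ _ _ _ _ _ _ _) _ => //.
  + exact: ltW.
  + exact: ltW.
  + by rewrite se mdiff u'del; congr (_ * _); ring.
  + exact: le_trans tau2 q1.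
  + apply: le_trans sub _; rewrite u'del (_ : u + del - u = del); last by ring.
    by apply: ler_wpM2l; [exact: ltW|]; apply: ler_wpM2r => //; rewrite invr_ge0 ltW.
  + rewrite (_ : n%:R * ea = X1 * (4 * n%:R * th / Y)); last by rewrite -eaE; ring.
    rewrite (_ : 3 * q = 12 * th / Y * (4 * n%:R * th / Y)); last first.
      by rewrite -qE rE2; field; rewrite !gt_eqF.
    apply: ler_wpM2r; first by pos.
    rewrite ler_pdivrMr //.
    have Y100 : 100 <= Y by move: YX x11; forget; lra.
    have : 1 * 100 <= X1 * Y by apply: ler_pM.
    by move: t12; forget; lra.
  (* All four remainder terms are th^3 / (n^2 margin gap) times a polynomial in X1^2 and in rho = th
     gap / margin, which is at most 1/2. *)
  + have [rho rhoE] : exists rho, th * g / r = rho by exists (th * g / r).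
    have rho0 : 0 <= rho by rewrite -rhoE; pos.
    have rho2 : rho <= 1 / 2.
      by rewrite -rhoE ler_pdivrMr //; apply: ler_pM => //; exact: ltW.
    have x1 : 1 <= X1 ^+ 2 by rewrite expr_ge1 // ltW.
    rewrite [leLHS](_ : _ = (256 + 640 * X1 ^+ 2 + 256 * 10 ^+ 2 * X1 ^+ 2 * rho + 512 * 10 * rho) *
        (th ^+ 3 / (n%:R ^+ 2 * (r * g)))); last first.
      by rewrite -rhoE -ggE -eaE -ebE -qE rE2; field; rewrite !gt_eqF.
    rewrite -[leRHS]mulrA; apply: ler_wpM2r; first by pos.
    have h := ler_wpM2l (le_trans ler01 x1) rho2.
    by move: h x1 rho2; forget; lra.
- move=> x; rewrite u'E /=; apply: rank1_eigenvalue_lt sd lt' _ _; by rewrite aE.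
Qed.

Lemma uniform_gap u : (forall l, lam l < u) -> exists2 g, 0 < g & forall l, lam l <= u - g.
Proof.
move=> lt; pose l0 := [arg max_(l > Ordinal n0) lam l]%O.
exists (u - lam l0); first by rewrite subr_gt0.
move=> l; rewrite opprB addrC subrK /l0.
by case: arg_maxP => //= i _; apply.
Qed.

(* An eigenvalue above the barrier would make the difference of the two
   Stieltjes transforms of a grid label and its partner too large. *)
Lemma eigenvalues_le_barrier :
  (forall i, (0 < i <= N)%N -> active (label i) j -> forall l, lam l < point (label i) j) ->
  forall l, lam l <= barrier j.
Proof.
move=> lt l0; rewrite leNgt; apply/negP => lb.
have p20 := phi20; have e18 := eta18; have e0 := eta0; have h2N := H2.
have [||i [i0 iN]] := @bottom_label R n m kap eta n0 eta0 kap0 kap1 phi20 N j N0 jm _ etakap.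
- by lra.
- by have := sqr_ge0 (1 + phi); lra.
rewrite -/(label i); have [th thE] : exists th, th = label i by exists (label i).
rewrite -thE => act g2; have iN' : (0 < i <= N)%N by rewrite i0.
have [t0 t12] := label_bounds i iN'; rewrite -thE in t0 t12.
have [[r0 r1 g0 gr] _] := active_facts th j t0 t12 jm act.
have th4 : 1 < 4 * (1 + phi) * th.
  rewrite ltNge; apply/negP => le4; have [_ h] := small th j t0 le4 jm.
  by lra.
have [h [h1 h2 h3]] := grid_partner i th lt thE iN' act th4.
have lt0 l : lam l < point th j by rewrite thE; apply: lt => //; rewrite -thE.
have gi : good th j by rewrite thE; apply: gd => //; rewrite -thE.
case: gi => _; move: lt0 h3; set u := point th j => lt0 h3 gu.
have [G GE] : exists G, gap th j / th = G by exists (gap th j / th).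
have G0 : 0 < G by rewrite -GE; pos.
have Ub : line th j - barrier j = G.
  by rewrite -GE gap_line mulrC mulKf // gt_eqF.
have e200 : gap th j / (200 * th) = G / 200 by rewrite -GE; field; rewrite gt_eqF.
rewrite GE in h1 h2.
have [g' g'0 lg'] := uniform_gap u lt0.
have uv : u <= u + h by lra.
move: h3; rewrite (mean1_diff n lam _ _ _ g'0 lg' uv) (_ : u + h - u = h); last by ring.
have [d dE] : exists d, u - lam l0 = d by exists (u - lam l0).
have d0 : 0 < d by rewrite -dE subr_gt0.
have d1 : d <= 201 / 200 * G.
  by rewrite -dE; move: gu; rewrite e200 ler_norml => /andP[_ gu]; lra.
have := mean11_ge_term n lam n0 _ _ _ g'0 lg' uv l0; rewrite dE addrAC dE => ge h3.
have hp : 0 < h by move: h1 G0; forget; lra.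
have {ge}ge : n%:R^-1 * (h * (d^-1 * (d + h)^-1)) <= gap th j * th / (8 * margin th j).
  by apply: le_trans h3; rewrite mulrCA ler_wpM2l // ltW.
have low : (103 * G)^-1 <= h * (d^-1 * (d + h)^-1).
  rewrite -invfM ler_pdivlMr; last by apply: mulr_gt0 => //; exact: addr_gt0.
  rewrite mulrC ler_pdivrMr; last by pos.
  have : d * (d + h) <= 201 / 200 * G * (301 / 100 * G).
    by move: d0 d1 h2 hp G0; forget => *; apply: ler_pM; lra.
  have : G / 25 * (103 * G) <= h * (103 * G) by apply: ler_wpM2r => //; rewrite mulr_ge0 // ltW.
  by have := mulr_gt0 G0 G0; forget; lra.
have nV : 0 <= n%:R^-1 :> R by rewrite invr_ge0 ltW.
have {low}ge := le_trans (ler_wpM2l nV low) ge.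
have {}ge : 8 * margin th j <= 103 * n%:R * gap th j ^+ 2.
  move: ge; rewrite -GE ler_pdivlMr; last by pos.
  rewrite (_ : _ * (8 * _) = 8 * margin th j / (103 * n%:R * gap th j ^+ 2) * (gap th j * th)); last first.
    by field; rewrite !gt_eqF.
  rewrite -[leRHS]mul1r ler_pM2r; last by pos.
  by rewrite ler_pdivrMr ?mul1r // mulr_gt0 ?exprn_gt0 // mulr_gt0.
have gg : gap th j ^+ 2 <= (2 * eta) ^+ 2 by rewrite lerXn2r ?nnegrE ?(ltW g0) // mulr_ge0 // ltW.
(* The constant is 103 * 4 / 8 rounded up. By [H4] such a margin is smaller than the lower bound
   sqrt(kap)/4 valid for active labels. *)
have rr : margin th j <= 52 * n%:R * eta ^+ 2.
  by move: ge (ler_wpM2l (ltW nR) gg) (mulr_ge0 (ltW nR) (sqr_ge0 eta)); forget; lra.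
have : margin th j ^+ 2 <= (52 * n%:R * eta ^+ 2) ^+ 2.
  by rewrite lerXn2r ?nnegrE //; [exact: ltW|pos].
by have := margin_low th j t0 t12 jm act; have := H4; forget; lra.
Qed.

End at_time.

Lemma sval0 th : 0 < th -> sval th 0 = th.
Proof.
move=> t0; rewrite /sval /stieltjes /= /resolvent subr0 invmx_scalar mxtrace_scalar invrK.
by rewrite -[th *+ n]mulr_natl mulrA mulVf ?mul1r // gt_eqF.
Qed.

(** For [sval], the martingale part (at most 128 X1 units, by the third clause of [concentrated])
    and the remainders (32 10^4 X1^2 units, summed by [sum1]) fit together into [X]. For the point,
    each step deviates from its line by at most 5 err / n, and [sum32] adds these up. *)
Lemma good_of_steps i th k : th = label i -> (0 < i <= N)%N -> (k <= m)%N -> active th k ->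
  (forall j, (j < k)%N ->
    frob (Bmx th j) <= 64 ^+ 2 * th ^+ 4 / (n%:R * (margin th j * gap th j ^+ 2))) ->
  (forall j, (j < k)%N ->
    `|sval th j.+1 - sval th j - centered (Bmx th j) (z j)| <=
      2 * 10 ^+ 4 * X1 ^+ 2 * th ^+ 3 / (n%:R ^+ 2 * (margin th j * gap th j))) ->
  (forall j, (j < k)%N -> `|sval th j - th| <= err th j) ->
  good th k.
Proof.
move=> thE iN km act hF hS hG; have [t0 t12] := label_bounds i iN; rewrite -thE in t0 t12.
have [[r0 r1 g0 gr] [y0 ysq hX hr _]] := active_facts th k t0 t12 km act.
have x11 := X11; have x0 := X0; have x10 : 0 < X1 by lra.
have nV : 0 < n%:R^-1 :> R by rewrite invr_gt0.
have actj (j : 'I_k) : active th j.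
  by have [] := act_mono th j k t0 t12 (ltnW (ltn_ord j)) km act.
have fj (j : 'I_k) := active_facts th j t0 t12 (leq_trans (ltnW (ltn_ord j)) km) (actj j).
have s1 := sum1 th k t0 t12 km act; have s3 := sum32 th k t0 t12 km act.
split.
- have -> : sval th k - th = \sum_(j < k) centered (Bmx th j) (z j) +
      \sum_(j < k) (sval th j.+1 - sval th j - centered (Bmx th j) (z j)).
    rewrite -big_split /= -{2}(sval0 th t0).
    under [RHS]eq_bigr => j _ do rewrite addrC subrK.
    by rewrite -(telescope_sumr (sval th) (leq0n k)) big_mkord.
  have [_ _ HL] := conc i iN; rewrite -thE in HL; move: (HL k km act hF).
  have [L LE] : exists L, \sum_(j < k) centered (Bmx th j) (z j) = L by eexists.
  rewrite LE => hL.
  have {}hL : `|L| <= 128 * X1 * th / (n%:R * (margin th k * Num.sqrt (gap th k))).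
    apply: normr_le_sqr; first by pos.
    apply: le_trans hL _.
    rewrite -{1}ysq le_eqVlt; apply/orP; left; apply/eqP; field; by rewrite !gt_eqF.
  have hR : `|\sum_(j < k) (sval th j.+1 - sval th j - centered (Bmx th j) (z j))| <=
     32 * 10 ^+ 4 * X1 ^+ 2 * th / (n%:R * (margin th k * Num.sqrt (gap th k))).
    apply: le_trans (ler_norm_sum _ _ _) _.
    apply: le_trans (_ : \sum_(j < k) (2 * 10 ^+ 4 * X1 ^+ 2 * th / n%:R) *
        ((th ^+ 2 / n%:R) / (margin th j * gap th j)) <= _).
      refine (ler_sumR _ _ _ _ _ _ _) => j _; apply: le_trans (hS j (ltn_ord j)) _.
      have [[rj _ gj _] _] := fj j.
      by rewrite le_eqVlt; apply/orP; left; apply/eqP; field; rewrite !gt_eqF.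
    rewrite -mulr_sumr.
    rewrite [leRHS](_ : _ = (2 * 10 ^+ 4 * X1 ^+ 2 * th / n%:R) *
      (16 / (margin th k * Num.sqrt (gap th k)))); last by field; rewrite !gt_eqF.
    by apply: ler_wpM2l => //; pos.
  apply: le_trans (ler_normD _ _) _; apply: le_trans (lerD hL hR) _.
  rewrite -mulrDl /err; apply: ler_wpM2r; first by pos.
  rewrite -mulrDl; apply: ler_wpM2r; first exact: ltW.
  have h : X1 * 1 <= X1 * X1 by rewrite ler_wpM2l //; lra.
  by rewrite XE; clear hX hr hL hR s1 s3 XE; lra.
have pl j : (j <= k)%N -> point th j - line th j =
    \sum_(l < j) n%:R^-1 * ((1 - sval th l)^-1 - (1 - th)^-1).
  elim: j => [|j IH] jk; first by rewrite big_ord0 /line mul0r mul0r addr0 subrr.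
  rewrite big_ord_recr /= -IH ?(ltnW jk) // /line -/(sval th j) -natr1; ring.
rewrite pl //; apply: le_trans (ler_norm_sum _ _ _) _.
apply: le_trans (_ : \sum_(j < k) (5 * X / (n%:R * th)) *
    ((th ^+ 2 / n%:R) / (margin th j * Num.sqrt (gap th j))) <= _).
  refine (ler_sumR _ _ _ _ _ _ _) => j _.
  have [[rj _ gj gjr] [yj _ _ _ /andP[_ ej]]] := fj j.
  have hj := hG j (ltn_ord j).
  have e20 : err th j <= 1 / 20.
    apply: le_trans ej _; rewrite ler_pdivrMr; last by pos.
    have : gap th j * th <= margin th j * (1 / 2) by rewrite ler_pM // ltW.
    by clear hX hr s1 s3 hj; lra.
  have s35 : sval th j <= 3 / 5.
    by move: hj; rewrite ler_norml => /andP[_]; clear hX hr s1 s3 ej hS hF hG; lra.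
  have [sp sV0 sV _] := inv_one_sub_bounds R _ s35.
  have [tp tV] := inv_one_sub_le2 R th t12.
  rewrite normrM (ger0_norm (ltW nV)).
  rewrite (_ : (1 - sval th j)^-1 - (1 - th)^-1 = (sval th j - th) * ((1 - sval th j)^-1 * (1 - th)^-1)).
    rewrite normrM (ger0_norm (mulr_ge0 sV0 _)) ?invr_ge0 ?(ltW tp) //.
    apply: le_trans (_ : n%:R^-1 * (err th j * (5 / 2 * 2)) <= _).
      apply: ler_wpM2l; first exact: ltW.
      have tV0 : 0 <= (1 - th)^-1 by rewrite invr_ge0 ltW.
      by apply: ler_pM => //; [exact: mulr_ge0|exact: ler_pM].
    by rewrite /err le_eqVlt; apply/orP; left; apply/eqP; field; rewrite !gt_eqF.
  by field; rewrite !gt_eqF.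
rewrite -mulr_sumr; apply: le_trans (ler_wpM2l _ s3) _; first by pos.
rewrite [leLHS](_ : _ = 16 * 5 * X / (n%:R * th * Num.sqrt (gap th k))); last first.
  by field; rewrite !gt_eqF.
rewrite ler_pdivrMr; last by pos.
rewrite [leRHS](_ : _ = n%:R * (gap th k * Num.sqrt (gap th k)) / 200); last first.
  by field; rewrite !gt_eqF.
by clear hr s1 s3; lra.
Qed.

(** The order of deductions avoids the circle: earlier times give the steps up to k, hence goodness
    at k and a spectrum below every active point; only from these does [eigenvalues_le_barrier]
    bring the spectrum below the barrier at k. *)
Lemma spectrum_controlled k : (k <= m)%N ->
  (forall x, eigenvalue (gram k) x -> x <= barrier k) /\
  (forall i, (0 < i <= N)%N -> active (label i) k -> good (label i) k).
Proof.
elim/ltn_ind: k => k IH km.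
have steps i j : (0 < i <= N)%N -> (j < k)%N -> active (label i) j.+1 ->
  [/\ frob (Bmx (label i) j) <= 64 ^+ 2 * label i ^+ 4 /
        (n%:R * (margin (label i) j * gap (label i) j ^+ 2)),
      `|sval (label i) j.+1 - sval (label i) j - centered (Bmx (label i) j) (z j)| <=
        2 * 10 ^+ 4 * X1 ^+ 2 * label i ^+ 3 / (n%:R ^+ 2 * (margin (label i) j * gap (label i) j))
    & forall x, eigenvalue (gram j.+1) x -> x < point (label i) j.+1].
  move=> iN jk act; have jm := leq_trans jk km.
  have [hb hg] := IH j jk (ltnW jm).
  have [lam sd] := symmetric_spectral_data n (gram j) (gram_sym j).
  apply: (column_step j lam (ltnW jm) sd hg i (label i)) => // l.
  by apply: hb; case: sd => ev _ _ _ _; apply/ev; exists l.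
have gd i : (0 < i <= N)%N -> active (label i) k -> good (label i) k.
  move=> iN act; have [t0 t12] := label_bounds i iN.
  have actj j : (j <= k)%N -> active (label i) j.
    by move=> jk; have [] := act_mono (label i) j k t0 t12 jk km act.
  apply: (good_of_steps i) => // j jk.
  - by have [] := steps i j iN jk (actj _ jk).
  - by have [] := steps i j iN jk (actj _ jk).
  - by have [_ hg] := IH j jk (leq_trans (ltnW jk) km); case: (hg i iN (actj _ (ltnW jk))).
split=> // x ev.
have [lam sd] := symmetric_spectral_data n (gram k) (gram_sym k).
have [l ->] : exists l, x = lam l by case: sd => evE _ _ _ _; apply/evE.
case: k => [|k] in IH km steps gd ev sd *.
  have : eigenvalue (gram 0) (lam l) by case: sd => evE _ _ _ _; apply/evE; exists l.
  move=> /eigenvalueP[v /= /eqP]; rewrite mulmx0 eq_sym scaler_eq0 => /orP[/eqP -> _|/eqP -> ].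
    by apply: le_trans (sqr_ge0 (1 + @ratio R n 0)) _; apply: barrier_ge.
  by rewrite eqxx.
apply: (eigenvalues_le_barrier k.+1 lam) => // i iN act l'.
have [_ _] := steps i k iN (ltnSn k) act; apply.
by case: sd => evE _ _ _ _; apply/evE; exists l'.
Qed.

(** * The lower bound at the final time *)

Section lower_edge.
Variable lam : 'I_n -> R.
Hypothesis sd : spectral_data (gram m) lam.
Hypothesis kap6 : 10 ^+ 6 * kap <= 1.
Local Notation unit_ := ((1 + phi) ^+ 2 / phi * kap).

(** A grid label whose margin r is between a sqrt(kap) and (a + 1/50) sqrt(kap). Its line lies r^2
    psi^2 / ((1 - r)(phi + r)) above the edge, with psi = 1 + phi, hence at height about a^2 units;
    the trace there falls short of the edge value 1/psi by about a sqrt(kap)/psi. This is the square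
    root singularity in quantitative form. *)
Lemma edge_label (a : R) : 2 <= a -> a <= 8 ->
  exists v, [/\ forall l, lam l < v,
    (1 + phi) * mean1 n lam v <= 1 - (a - 1 / 100) * Num.sqrt kap,
    1 - (a + 3 / 100) * Num.sqrt kap <= (1 + phi) * mean1 n lam v,
    (1 + phi) ^+ 2 + unit_ * (199 / 200 * a ^+ 2) <= v
  & v <= (1 + phi) ^+ 2 + unit_ * (102 / 100 * (a + 1 / 50) ^+ 2)].
Proof.
move=> a2 a8; have p20 := phi20; have k0 := kap0; have ek := etakap; have h2N := H2.
have k6 := kap6.
have [sg sgE] : exists sg, Num.sqrt kap = sg by eexists.
have sg0 : 0 < sg by rewrite -sgE sqrtr_gt0.
have sg2 : sg ^+ 2 = kap by rewrite -sgE sqr_sqrtr // ltW.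
have sg3 : 10 ^+ 3 * sg <= 1.
  rewrite -(@ler_pXn2r _ 2) ?nnegrE //; last by pos.
  by rewrite expr1n exprMn sg2 -exprM.
have [psi psiE] : exists psi, 1 + phi = psi by eexists.
rewrite psiE sgE in h2N *.
have psi21 : 21 <= psi by rewrite -psiE; lra.
have as0 : 0 < a * sg by apply: mulr_gt0 => //; lra.
have h1 : 25 * psi <= N%:R * sg.
  have q1 : N%:R * eta <= N%:R * sg ^+ 2 by rewrite ler_wpM2l ?(ltW NR) // sg2.
  have q2 : N%:R * sg * (10 ^+ 3 * sg) <= N%:R * sg * 1.
    by rewrite ler_wpM2l // ltW // mulr_gt0 // NR.
  have q3 : 21 * psi <= psi * psi by rewrite ler_wpM2r //; lra.
  by lra.
have r9 : (a + 1 / 50) * sg <= 9 / 10 ^+ 3.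
  have : a * sg <= 8 * sg by rewrite ler_wpM2r // ltW.
  by lra.
have [i' /andP[tl tu]] : exists i' : nat,
    (1 - (a + 1 / 50) * sg) / psi <= i'%:R / (2 * N)%:R <= (1 - a * sg) / psi.
  apply: grid_between; first by rewrite muln_gt0 N0.
    by apply: divr_ge0; lra.
  rewrite -mulrBl natrM -[leLHS]mul1r ler_pdivrMr; last by apply: mulr_gt0.
  rewrite mulrAC ler_pdivlMr; last by lra.
  by lra.
have [t tE] : exists t, t = label i' by eexists.
rewrite -/(label i') -tE in tl tu.
have psi0 : 0 < psi by lra.
have t0 : 0 < t.
  by apply: lt_le_trans tl; apply: divr_gt0 => //; lra.
have iN : (0 < i' <= N)%N.
  apply/andP; split.
    by move: t0; rewrite tE /label; case: (i') => //; rewrite mul0r ltxx.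
  rewrite -(ler_nat R).
  have : i'%:R / (2 * N)%:R <= 1 / 2 :> R.
    rewrite -/(label i') -tE; apply: le_trans tu _; rewrite ler_pdivrMr //; lra.
  by rewrite natrM ler_pdivrMr ?mulr_gt0 //; lra.
have [_ t12] := label_bounds i' iN; rewrite -tE in t12.
have [r rE] : exists r, 1 - t * psi = r by eexists.
have mE : margin t m = r by rewrite /margin psiE rE.
move: tl tu; rewrite ler_pdivrMr // ler_pdivlMr // => tl tu.
have r1 : a * sg <= r by lra.
have r2 : r <= (a + 1 / 50) * sg by lra.
have r0 : 0 < r by lra.
have phi0 : 0 < phi by lra.
have r9' : r <= 9 / 10 ^+ 3 by lra.
clear tl tu h1 h2N r9 k6 sg3.
have tE' : t = (1 - r) / psi by rewrite -rE; field; rewrite gt_eqF.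
have [W WE] : exists W, line t m - psi ^+ 2 = W by eexists.
have D0 : 0 < (1 - r) * (phi + r) by apply: mulr_gt0; lra.
have WE2 : W = r ^+ 2 * psi ^+ 2 / ((1 - r) * (phi + r)).
  rewrite -WE /line -(@ratio_sqr R n m) tE' -psiE; field.
  by rewrite !gt_eqF //; lra.
have [c cE] : exists c, psi ^+ 2 / phi = c by eexists.
have c0 : 0 < c by rewrite -cE; pos.
have cphi : c * phi = psi ^+ 2 by rewrite -cE; field; rewrite gt_eqF.
have rr0 := mulr_gt0 r0 r0.
have W1 : c * r ^+ 2 <= W.
  rewrite WE2 ler_pdivlMr // -cphi.
  have : c * r ^+ 2 * ((1 - r) * (phi + r)) <= c * r ^+ 2 * phi.
    apply: ler_wpM2l; first by pos.
    have : r * 20 <= r * phi by rewrite ler_wpM2l // ltW.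
    by lra.
  by lra.
have W2 : W <= 101 / 100 * (c * r ^+ 2).
  rewrite WE2 ler_pdivrMr // -cphi.
  have : c * r ^+ 2 * (991 / 10 ^+ 3 * phi) <= c * r ^+ 2 * ((1 - r) * (phi + r)).
    apply: ler_wpM2l; first by pos.
    have : r * phi <= 9 / 10 ^+ 3 * phi by rewrite ler_wpM2r //; lra.
    have : r * r <= r * 1.
      by apply: ler_wpM2l; [exact: ltW|move: r9'; forget; lra].
    by lra.
  have := mulr_gt0 (mulr_gt0 c0 rr0) phi0.
  by lra.
have rs1 : a ^+ 2 * kap <= r ^+ 2.
  by rewrite -sg2 -exprMn lerXn2r ?nnegrE // ltW.
have rs2 : r ^+ 2 <= (a + 1 / 50) ^+ 2 * kap.
  rewrite -sg2 -exprMn lerXn2r ?nnegrE //; [exact: ltW|].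
  by apply: mulr_ge0; [move: a2; forget; lra|exact: ltW].
have bE : barrier m = psi ^+ 2 + kap * phi.
  by rewrite /barrier psiE divff ?gt_eqF // subrr expr0n addr0.
have act : active t m.
  rewrite /active mE r0 /= gap_line bE.
  have cpsi : psi <= c.
    rewrite -cE ler_pdivlMr // expr2; apply: ler_wpM2l; first exact: ltW.
    by move: psiE; forget; lra.
  have q1 : 4 * kap <= a ^+ 2 * kap.
    rewrite ler_wpM2r ?(ltW k0) //.
    have : 2 * 2 <= a * a by apply: ler_pM.
    by rewrite expr2; forget; lra.
  have q2 : psi * (4 * kap) <= c * r ^+ 2.
    by apply: ler_pM => //; [exact: ltW|pos|exact: le_trans rs1].
  have q3 : t * (3 * kap * psi) <= t * (line t m - (psi ^+ 2 + kap * phi)).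
    rewrite ler_wpM2l ?(ltW t0) //.
    have : kap * phi <= kap * psi.
      by apply: ler_wpM2l; [exact: ltW|move: psiE; forget; lra].
    by lra.
  have q4 : 1 / 2 * kap <= (t * psi) * kap.
    by apply: ler_wpM2r; [exact: ltW|move: rE r9'; forget; lra].
  by apply: le_trans q3; move: q4 k0 ek; forget; lra.
have gi : good t m by have [_ gd] := spectrum_controlled m (leqnn m); rewrite tE; apply: gd => //; rewrite -tE.
have lb l : lam l <= barrier m.
  have [ev _] := spectrum_controlled m (leqnn m).
  by apply: ev; case: sd => evE _ _ _ _; apply/evE; exists l.
have [_ gb gc se _] := good_gap m lam (leqnn m) sd t t0 t12 act gi lb.
have [[_ _ g0 _] [_ _ _ _ /andP[e0 e1]]] := active_facts t m t0 t12 (leqnn m) act.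
case: gi => gs gu.
have g2 : gap t m <= 2 * r ^+ 2.
  by rewrite -mE; apply: gap_le_margin_sqr.
have e2 : psi * err t m <= sg / 100.
  have q1 : psi * err t m <= psi * (gap t m * t / (10 ^+ 5 * r)) by rewrite ler_wpM2l ?(ltW psi0) // -mE.
  apply: le_trans q1 _.
  rewrite (_ : psi * _ = (t * psi) * (gap t m / (10 ^+ 5 * r))); last by field; rewrite gt_eqF.
  have q2 : gap t m / (10 ^+ 5 * r) <= 2 * r / 10 ^+ 5.
    rewrite ler_pdivrMr; last by pos.
    by rewrite (_ : 2 * r / 10 ^+ 5 * _ = 2 * r ^+ 2) //; field.
  apply: le_trans (_ : 1 * (2 * r / 10 ^+ 5) <= _).
    apply: ler_pM; [by pos|by pos| |exact: q2].
    by move: rE r0; forget; lra.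
  have : a * sg <= 8 * sg by rewrite ler_wpM2r // ltW.
  by move: r2 sg0; forget; lra.
exists (point t m); rewrite -se.
have gE : gap t m / (200 * t) <= W / 200.
  rewrite (_ : gap t m / (200 * t) = gap t m / t / 200); last by field; rewrite gt_eqF.
  rewrite gap_line [t * _]mulrC mulfK ?gt_eqF // bE.
  by have := mulr_gt0 k0 phi0; move: WE; forget; lra.
clear g2 e0 e1 gc D0 WE2 cphi rr0 psi21 p20 ek r9' bE tE'.
move: gs; rewrite ler_norml => /andP[gs1 gs2].
have {}gs1 := ler_wpM2l (ltW psi0) gs1; have {}gs2 := ler_wpM2l (ltW psi0) gs2.
move: gu; rewrite ler_norml => /andP[gu1 gu2].
have cr1 := ler_wpM2l (ltW c0) rs1; have cr2 := ler_wpM2l (ltW c0) rs2.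
have cr0 : 0 < c * kap by pos.
split.
- by move=> l; have := gb l; have := divr_gt0 g0 t0; forget; lra.
- by move: gs1 gs2 e2 rE r1 r2; forget; lra.
- by move: gs1 gs2 e2 rE r1 r2; forget; lra.
- by rewrite cE; move: gu1 gu2 gE W1 W2 WE cr1 cr2 cr0; forget; lra.
- by rewrite cE; move: gu1 gu2 gE W1 W2 WE cr1 cr2 cr0; forget; lra.
Qed.
Lemma eigenvalue_near_edge : exists l, (1 + phi) ^+ 2 - 200 * unit_ <= lam l.
Proof.
apply: contrapT => nex; have p20 := phi20; have k0 := kap0.
have [e eE] : exists e, unit_ = e by eexists.
have [psi psiE] : exists psi, 1 + phi = psi by eexists.
have e0 : 0 < e by rewrite -eE; apply: mulr_gt0 => //; apply: divr_gt0; [apply: exprn_gt0|]; lra.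
have psi0 : 0 < psi by rewrite -psiE; lra.
have [sg sgE] : exists sg, Num.sqrt kap = sg by eexists.
have sg0 : 0 < sg by rewrite -sgE sqrtr_gt0.
have lt l : lam l < psi ^+ 2 - 200 * e.
  rewrite ltNge; apply/negP => h; apply: nex; exists l.
  by rewrite eE psiE.
have [||u2 [_ _ a2 b2 c2]] := edge_label 2; [by rewrite ler_nat|by rewrite ler_nat|].
have [||u4 [_ a4 b4 c4 d4]] := edge_label 4; [by rewrite ler_nat|by rewrite ler_nat|].
have [||u8 [_ _ b8 c8 d8]] := edge_label 8; [by rewrite ler_nat|by rewrite ler_nat|].
rewrite eE psiE sgE in a2 b2 c2 a4 b4 c4 d4 b8 c8 d8.
have e02 : 0 < 100 * e by pos.
have ga l : lam l <= u2 - 100 * e by move: (lt l) b2 e0; forget; lra.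
have ga4 l : lam l <= u4 - 100 * e by move: (lt l) c4 e0; forget; lra.
have u24 : u2 <= u4 by move: c4 c2 e0; forget; lra.
have u48 : u4 <= u8 by move: d4 c8 e0; forget; lra.
have d24 := mean1_diff n lam _ _ _ e02 ga u24.
have d48 := mean1_diff n lam _ _ _ e02 ga4 u48.
have M24 : 0 <= mean11 n lam u2 u4.
  exact: (le_trans (mean2_ge0 n lam n0 _) (mean2_le_mean11 n lam n0 _ _ _ e02 ga u24)).
have M0 : 0 <= mean11 n lam u4 u8.
  exact: (le_trans (mean2_ge0 n lam n0 _) (mean2_le_mean11 n lam n0 _ _ _ e02 ga4 u48)).
(* With all eigenvalues 200 units below the edge, u8 - lam is at most 3/2 of u2 - lam, which bounds
   the ratio of the two slopes. [edge_label] forces a ratio near 2 instead: the shortfall grows by 2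
   over 12 units of height, and then by 4 over 48. *)
have cmp : mean11 n lam u2 u4 <= 3 / 2 * mean11 n lam u4 u8.
  rewrite /mean11 mulrCA ler_wpM2l ?invr_ge0 ?(ltW nR) // mulr_sumr.
  refine (ler_sumR _ _ _ _ _ _ _) => l _.
  have x2 : 0 < u2 - lam l by move: (ga l) e02; forget; lra.
  have x4 : 0 < u4 - lam l by move: (ga4 l) e02; forget; lra.
  have x8 : 0 < u8 - lam l by move: x4 u48; forget; lra.
  rewrite mulrC mulrCA ler_wpM2l ?invr_ge0 ?(ltW x4) //.
  by rewrite ler_pdivlMr // mulrC ler_pdivrMr //; move: (lt l) d8 b2 c2 e0; forget; lra.
have [M ME] : exists M, mean11 n lam u4 u8 = M by eexists.
rewrite ME in cmp M0 d48.
have q1 : (u4 - u2) * mean11 n lam u2 u4 <= 1251 / 100 * e * (3 / 2 * M).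
  by apply: ler_pM => //; [rewrite subr_ge0|move: d4 b2 e0; forget; lra].
have q2 : 4719 / 100 * e * M <= (u8 - u4) * M.
  by apply: ler_wpM2r => //; move: c8 d4 e0; forget; lra.
rewrite -d24 in q1; rewrite -d48 in q2.
have {}q1 := ler_wpM2l (ltW psi0) q1; have {}q2 := ler_wpM2l (ltW psi0) q2.
by move: q1 q2 a4 b4 b8 a2 sg0; forget; lra.
Qed.
End lower_edge.
(** Taking square roots divides the window around (1 + phi)^2 by roughly 1 + phi. The constant 210
    is 200 (1 + phi)/phi at phi = 20. *)
Lemma singular_value_edge : 10 ^+ 6 * kap <= 1 ->
  `|Num.sqrt (sup [set a : R | eigenvalue (gram m) a]) - (phi + 1)| <= 210 * kap.
Proof.
move=> kap6; have p20 := phi20; have k0 := kap0; have phi0 : 0 < phi by lra.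
have [lam sd] := symmetric_spectral_data n (gram m) (gram_sym m).
have [up _] := spectrum_controlled m (leqnn m).
have [l low] := eigenvalue_near_edge lam sd kap6.
have bE : barrier m = (1 + phi) ^+ 2 + kap * phi.
  by rewrite /barrier divff ?gt_eqF // subrr expr0n addr0.
have evl : eigenvalue (gram m) (lam l) by case: sd => evE _ _ _ _; apply/evE; exists l.
set S := [set a | _].
have nS : S !=set0 by exists (lam l).
have ubS : ubound S ((1 + phi) ^+ 2 + kap * phi) by move=> x /up; rewrite bE.
have Sup : sup S <= (1 + phi) ^+ 2 + kap * phi by exact: ge_sup.
have Slow : (1 + phi) ^+ 2 - 200 * ((1 + phi) ^+ 2 / phi * kap) <= sup S.
  apply: le_trans low _; apply: ub_le_sup => //; by exists ((1 + phi) ^+ 2 + kap * phi).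
have kp : kap * phi <= kap * (2 * (1 + phi)) by apply: ler_wpM2l; lra.
have hi : Num.sqrt (sup S) <= 1 + phi + kap.
  rewrite -[leRHS]ger0_norm; last by lra.
  rewrite -sqrtr_sqr ler_wsqrtr //; apply: le_trans Sup _.
  by have := sqr_ge0 kap; lra.
have lo : 1 + phi - 210 * kap <= Num.sqrt (sup S).
  have [E EE] : exists E, (1 + phi) / phi = E by eexists.
  have E1 : E <= 105 / 100 by rewrite -EE ler_pdivrMr //; lra.
  have E0 : 0 <= E by rewrite -EE; apply: divr_ge0; lra.
  have psi0 : 0 < 1 + phi by lra.
  have q0 : 200 * E * kap <= 1.
    have : E * kap <= 105 / 100 * kap by rewrite ler_wpM2r // ltW.
    by lra.
  have q1 : 1 + phi - 210 * kap <= 1 + phi - 200 * E * kap.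
    have : E * kap <= 105 / 100 * kap by rewrite ler_wpM2r // ltW.
    by lra.
  apply: le_trans q1 _.
  rewrite -[leLHS]ger0_norm; last by lra.
  rewrite -sqrtr_sqr ler_wsqrtr //; apply: le_trans Slow.
  have -> : (1 + phi) ^+ 2 / phi * kap = (1 + phi) * (E * kap).
    by rewrite -EE; field; rewrite gt_eqF.
  have Ek0 : 0 <= E * kap by rewrite mulr_ge0 // ltW.
  have : 200 * E * kap * (200 * (E * kap)) <= 1 * (200 * (E * kap)).
    by rewrite ler_wpM2r //; lra.
  have : 20 * (E * kap) <= phi * (E * kap) by rewrite ler_wpM2r.
  by lra.
by rewrite ler_norml; apply/andP; split; lra.
Qed.
End process.

(** * Measurability of the process *)

Section matrix_measurability.
Context {d : measure_display} {G : measurableType d} {R : realType}.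

Lemma measurable_funV (f : G -> R) : measurable_fun setT f ->
  measurable_fun setT (fun w => (f w)^-1).
Proof.
move=> mf; rewrite (_ : (fun w => _) = fun w => f w * powR (f w ^+ 2) (-1)).
  apply: measurable_funM => //; apply: (measurableT_comp (@measurable_powR R (-1))).
  exact: measurable_funX.
apply/funext => w; rewrite powR_inv1 ?sqr_ge0 //.
have [->|f0] := eqVneq (f w) 0; first by rewrite mul0r invr0.
by rewrite expr2 invfM mulrA divff // mul1r.
Qed.

Definition measurable_mx {p q : nat} (A : G -> 'M[R]_(p, q)) : Prop :=
  forall i j, measurable_fun setT (fun w => A w i j).

Lemma measurable_mx_cst p q (A : 'M[R]_(p, q)) : measurable_mx (fun=> A).
Proof. by move=> i j; exact: measurable_cst. Qed.

Lemma measurable_mxD p q (A B : G -> 'M[R]_(p, q)) :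
  measurable_mx A -> measurable_mx B -> measurable_mx (fun w => A w + B w).
Proof.
move=> mA mB i j; under eq_fun do rewrite mxE.
by apply: measurable_funD.
Qed.

Lemma measurable_mxB p q (A B : G -> 'M[R]_(p, q)) :
  measurable_mx A -> measurable_mx B -> measurable_mx (fun w => A w - B w).
Proof.
move=> mA mB i j; under eq_fun do rewrite !mxE.
by apply: measurable_funB.
Qed.

Lemma measurable_mxZ p q (a : G -> R) (A : G -> 'M[R]_(p, q)) :
  measurable_fun setT a -> measurable_mx A -> measurable_mx (fun w => a w *: A w).
Proof.
move=> ma mA i j; under eq_fun do rewrite mxE.
by apply: measurable_funM.
Qed.

Lemma measurable_mxM p q r (A : G -> 'M[R]_(p, q)) (B : G -> 'M[R]_(q, r)) :
  measurable_mx A -> measurable_mx B -> measurable_mx (fun w => A w *m B w).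
Proof.
move=> mA mB i j; under eq_fun do rewrite mxE.
by apply: measurable_sum_cond => l _; apply: measurable_funM.
Qed.

Lemma measurable_mx_tr p q (A : G -> 'M[R]_(p, q)) :
  measurable_mx A -> measurable_mx (fun w => (A w)^T).
Proof. by move=> mA i j; under eq_fun do rewrite mxE; exact: mA. Qed.

Lemma measurable_scalar_mx p (a : G -> R) : measurable_fun setT a ->
  measurable_mx (fun w => (a w)%:M : 'M[R]_p).
Proof.
move=> ma i j; under eq_fun do rewrite mxE.
by case: (i == j) => /=; [exact: ma|exact: measurable_cst].
Qed.

Lemma measurable_mxtrace p (A : G -> 'M[R]_p) : measurable_mx A ->
  measurable_fun setT (fun w => \tr (A w)).
Proof. by move=> mA; apply: measurable_sum_cond => i _; exact: mA. Qed.

Lemma measurable_det p (A : G -> 'M[R]_p) : measurable_mx A ->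
  measurable_fun setT (fun w => \det (A w)).
Proof.
move=> mA; apply: measurable_sum_cond => s _; apply: measurable_funM => //.
by apply: measurable_prod_cond => i _; exact: mA.
Qed.

Lemma measurable_adj p (A : G -> 'M[R]_p) : measurable_mx A ->
  measurable_mx (fun w => \adj (A w)).
Proof.
move=> mA i j; under eq_fun do rewrite mxE /cofactor.
apply: measurable_funM => //; apply: measurable_det => i' j'.
by under eq_fun do rewrite !mxE; exact: mA.
Qed.

Lemma measurable_invmx p (A : G -> 'M[R]_p) : measurable_mx A ->
  measurable_mx (fun w => invmx (A w)).
Proof.
move=> mA i j.
(* Cramer's rule off the singular matrices; on them [invmx] returns its argument. *)
rewrite (_ : (fun w => _) = fun w => if \det (A w) == 0 then A w i j
    else (\det (A w))^-1 * (\adj (A w)) i j); last first.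
  apply/funext => w; rewrite /invmx unitmxE unitfE.
  by case: eqVneq => //= _; rewrite mxE.
apply: measurable_fun_ifT.
- by apply: measurable_fun_eqr => //; exact: measurable_det.
- exact: mA.
- apply: measurable_funM; last exact: measurable_adj.
  by apply: measurable_funV; exact: measurable_det.
Qed.

Section process_measurability.
Context {n : nat} (z : G -> nat -> 'cV[R]_n) (j : nat).
Hypothesis mz : forall k, (k < j)%N -> measurable_mx (z^~ k).

Lemma measurable_gram k : (k <= j)%N -> measurable_mx (fun w => gram (z w) k).
Proof.
elim: k => [|k IH] kj /=; first exact: measurable_mx_cst.
apply: measurable_mxD; first exact: IH (ltnW kj).
by apply: measurable_mxM; [exact: mz|apply: measurable_mx_tr; exact: mz].
Qed.

Lemma measurable_resolvent k (u : G -> R) : (k <= j)%N -> measurable_fun setT u ->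
  measurable_mx (fun w => resolvent (gram (z w) k) (u w)).
Proof.
move=> kj mu; apply: measurable_invmx; apply: measurable_mxB; last exact: measurable_gram.
exact: measurable_scalar_mx.
Qed.

Lemma measurable_stieltjes k (u : G -> R) : (k <= j)%N -> measurable_fun setT u ->
  measurable_fun setT (fun w => stieltjes (gram (z w) k) (u w)).
Proof.
move=> kj mu; apply: measurable_funM => //.
by apply: measurable_mxtrace; exact: measurable_resolvent.
Qed.

(** The bound reaches [j.+1] although only columns before j are measurable: the point at time j + 1
    looks at [gram] no later than time j. This makes the matrices of step j functions of the
    past. *)
Lemma measurable_point th k : (k <= j.+1)%N -> measurable_fun setT (fun w => point (z w) th k).
Proof.
elim: k => [|k IH] kj /=; first exact: measurable_cst.
apply: measurable_funD; first exact: IH (ltnW kj).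
apply: measurable_funM => //; apply: measurable_funV; apply: measurable_funB => //.
by apply: measurable_stieltjes => //; exact: IH (ltnW kj).
Qed.

Lemma measurable_Kmx th : measurable_mx (fun w => Kmx (z w) th j).
Proof. by apply: measurable_resolvent => //; exact: measurable_point. Qed.

Lemma measurable_K2mx th : measurable_mx (fun w => K2mx (z w) th j).
Proof.
have mK := measurable_Kmx th.
by apply: measurable_mxM => //; apply: measurable_mxM => //; exact: measurable_mx_cst.
Qed.

Lemma measurable_Bmx th : measurable_mx (fun w => Bmx (z w) th j).
Proof.
have ms : measurable_fun setT (fun w => (1 - sval (z w) th j)^-1).
  apply: measurable_funV; apply: measurable_funB => //.
  by apply: measurable_stieltjes => //; exact: measurable_point.
apply: measurable_mxZ; first exact: measurable_cst.
apply: measurable_mxD; apply: measurable_mxZ => //.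
- exact: measurable_K2mx.
- apply: measurable_funM.
    by apply: measurable_funM => //; apply: measurable_mxtrace; exact: measurable_K2mx.
  under eq_fun do rewrite -exprVn; exact: measurable_funX.
- exact: measurable_Kmx.
Qed.

Lemma measurable_frob (A : G -> 'M[R]_n) : measurable_mx A ->
  measurable_fun setT (fun w => frob (A w)).
Proof.
move=> mA; apply: measurable_sum_cond => i _; apply: measurable_sum_cond => l _.
by apply: measurable_funX; exact: mA.
Qed.

End process_measurability.
End matrix_measurability.

(** * Events up to an exceptional set *)

Section exceptional_sets.
Context {d : measure_display} {T : measurableType d} {R : realType} (P : probability T R).

(** Only the exceptional set has to be measurable, so [Q] may be any property of the sample, such as
    the nested implications in [concentrated]. *)
Definition fails_with (p : R) (Q : T -> Prop) : Prop :=
  exists A, [/\ measurable A, (P A <= p%:E)%E & forall w, ~ A w -> Q w].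

Lemma fails_imply p (Q Q' : T -> Prop) : (forall w, Q w -> Q' w) ->
  fails_with p Q -> fails_with p Q'.
Proof. by move=> QQ' [A [mA PA AQ]]; exists A; split => // w /AQ /QQ'. Qed.

Lemma fails_always p (Q : T -> Prop) : 0 <= p -> (forall w, Q w) -> fails_with p Q.
Proof.
move=> p0 hQ; exists set0; split => //.
by rewrite measure0 lee_fin.
Qed.

Lemma fails_and p p' (Q Q' : T -> Prop) : fails_with p Q -> fails_with p' Q' ->
  fails_with (p + p') (fun w => Q w /\ Q' w).
Proof.
move=> [A [mA PA AQ]] [A' [mA' PA' AQ']]; exists (A `|` A'); split.
- exact: measurableU.
- by apply: le_trans (measureU2 _ _ _) _ => //; rewrite EFinD leeD.
- by move=> w /not_orP[h h']; split; [exact: AQ|exact: AQ'].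
Qed.

Lemma fails_forall p (Q : nat -> T -> Prop) k : 0 <= p ->
  (forall j, (j < k)%N -> fails_with p (Q j)) ->
  fails_with (k%:R * p) (fun w => forall j, (j < k)%N -> Q j w).
Proof.
move=> p0; elim: k => [|k IH] hQ; first by rewrite mul0r; exact: fails_always.
have := fails_and _ _ _ _ (IH (fun j jk => hQ j (ltnW jk))) (hQ k (ltnSn k)).
rewrite -natr1 mulrDl mul1r; apply: fails_imply => w [h1 h2] j.
by rewrite ltnS leq_eqVlt => /orP[/eqP ->|/h1].
Qed.

End exceptional_sets.

Definition columns {T : Type} {R : realType} {n m : nat} (Z : 'I_n -> 'I_m -> T -> R)
    (w : T) (k : nat) : 'cV[R]_n :=
  if insub k is Some j then \col_i Z i j w else 0.

Lemma gram_columns {T : Type} {R : realType} {n m : nat} (Z : 'I_n -> 'I_m -> T -> R) (w : T) :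
  gram (columns Z w) m = (\matrix_(i, j) Z i j w) *m (\matrix_(i, j) Z i j w)^T.
Proof.
have gE k : gram (columns Z w) k = \sum_(j < k) columns Z w j *m (columns Z w j)^T.
  by elim: k => [|k IH] /=; rewrite ?big_ord0 // big_ord_recr /= IH.
rewrite gE; apply/matrixP => i l; rewrite summxE mxE; apply: eq_bigr => j _.
by rewrite /columns valK !mxE big_ord1 !mxE.
Qed.

(** * Probability that the noise bounds hold for one label *)

Section concentration.
Context {d : measure_display} {T : measurableType d} {R : realType}.
Context (P : probability T R) (n m : nat) (Z : 'I_n -> 'I_m -> T -> R).
Local Notation E X := (\int[P]_w X w)%R.
Local Notation ent := (fun ij : 'I_n * 'I_m => Z ij.1 ij.2).
Hypothesis mZ : forall i j, measurable_fun setT (Z i j).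
Hypothesis indZ : mutually_independent P ent.
Hypothesis aZ : forall i j, all_moments P (Z i j).
Variables (mu : R) (q : nat).
Hypothesis n0 : (0 < n)%N.
Hypothesis EZ : forall i j, E (Z i j) = 0.
Hypothesis EZ2 : forall i j, E (fun w => Z i j w ^+ 2) = n%:R^-1.
Hypothesis mu1 : 1 <= mu.
Hypothesis momZ : forall i j, E (fun w => Z i j w ^+ (2 * q.+1)) <= (mu * n%:R^-1) ^+ q.+1.
Hypothesis momZ2 : forall i j,
  E (fun w => (Z i j w ^+ 2 - n%:R^-1) ^+ (2 * q.+1)) <= ((mu * n%:R^-1) ^+ 2) ^+ q.+1.
Local Notation z := (columns Z).
Local Notation adapted j M :=
  (@measurable_mx _ (gcyl ent (past n m j)) R n n M).

Definition tail (x : R) : R := (Kquad q * mu ^+ 2 / x ^+ 2) ^+ q.+1.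

Lemma columns_past (j : nat) k : (k < j)%N ->
  @measurable_mx _ (gcyl ent (fun x => (x.2 < j)%N)) R n 1 ((columns Z)^~ k).
Proof.
move=> kj i l; case kE : (insub k : option 'I_m) => [k'|]; last first.
  rewrite (_ : (fun w => _) = fun=> 0 : R).
    exact: (@measurable_cst _ _ (gcyl ent (fun x => (x.2 < j)%N)) R setT 0).
  by apply/funext => w; rewrite /columns kE mxE.
rewrite (_ : (fun w => _) = Z i k'); last by apply/funext => w; rewrite /columns kE mxE.
apply: (measurable_cyl ent (fun x => (x.2 < j)%N) (i, k')).
by move: kE kj; case: insubP => // k'' _ <- [->].
Qed.

Lemma quad_columns (j : 'I_m) (M : T -> 'M[R]_n) w :
  quad n m Z n%:R^-1 j (fun i l w => M w i l) w = centered (M w) (z w j).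
Proof.
rewrite /quad /centered -qform_center; apply: eq_bigr => i _; apply: eq_bigr => l _.
by rewrite /columns valK !mxE.
Qed.

Lemma frob0 : frob (0 : 'M[R]_n) = 0.
Proof. by rewrite /frob big1 // => i _; rewrite big1 // => l _; rewrite mxE expr0n. Qed.

Lemma centered0 (x : 'cV[R]_n) : centered 0 x = 0.
Proof. by rewrite /centered /qform mulmx0 mul0mx mxE mxtrace0 mulr0 subr0. Qed.

(* Truncating each matrix by its Frobenius norm makes the variance proxy deterministic. *)
Lemma sum_tail (M : nat -> T -> 'M[R]_n) (b : nat -> R) k (a x : R) :
  (k <= m)%N -> 0 < a -> 0 < x ->
  (forall j : 'I_m, (j < k)%N -> adapted j (M j)) ->
  (forall j, (j < k)%N -> 0 <= b j) -> \sum_(j < k) b j <= a ->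
  fails_with P (tail x) (fun w => (forall j, (j < k)%N -> frob (M j w) <= b j) ->
    (\sum_(j < k) centered (M j w) (z w j)) ^+ 2 <= x ^+ 2 * (n%:R^-1 ^+ 2 * a)).
Proof.
move=> km a0 x0 mM b0 ba.
pose M' (j : 'I_m) w := if frob (M j w) <= b j then M j w else 0.
have nV : 0 < n%:R^-1 :> R by rewrite invr_gt0 ltr0n.
have [|||| mA PA] := quad_sum_tail P n m Z mZ indZ aZ n%:R^-1 mu nV EZ EZ2 q mu1 momZ momZ2
   (fun j i l w => M' j w i l) (fun j => b j) k a x km a0 x0.
- move=> j jk i l.
  rewrite (_ : (fun w => _) = fun w => if frob (M j w) <= b j then M j w i l else 0); last first.
    by apply/funext => w; rewrite /M'; case: ifP => // _; rewrite mxE.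
  apply: measurable_fun_ifT.
  + by apply: measurable_fun_ler => //; apply: measurable_frob; exact: mM.
  + exact: mM.
  + exact: measurable_cst.
- by move=> j jk; exact: b0.
- move=> j jk w; rewrite -/(frob (M' j w)) /M'; case: ifP => // _.
  by rewrite frob0; exact: b0.
- by rewrite -(big_ord_widen _ (fun j => b j)).
eexists; split; [exact: mA|exact: PA|].
move=> w /negP; rewrite -leNgt => h hb.
apply: le_trans h; rewrite le_eqVlt; apply/orP; left; apply/eqP; congr (_ ^+ 2).
rewrite (big_ord_widen m (fun j => centered (M j w) (z w j))) //.
by apply: eq_bigr => j jk; rewrite quad_columns /M' hb.
Qed.

(** The case of [sum_tail] in which all matrices but the last are zero. *)
Lemma single_tail (M : T -> 'M[R]_n) j (b x : R) :
  (j < m)%N -> 0 < b -> 0 < x ->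
  @measurable_mx _ (gcyl ent (fun y => (y.2 < j)%N)) R n n M ->
  fails_with P (tail x) (fun w => frob (M w) <= b ->
    centered (M w) (z w j) ^+ 2 <= x ^+ 2 * (n%:R^-1 ^+ 2 * b)).
Proof.
move=> jm b0 x0 mM.
have := sum_tail (fun l w => if l == j then M w else 0) (fun l => if l == j then b else 0) j.+1 b x.
case=> //.
- move=> l _; case: eqVneq => [lj|_]; first by rewrite /past lj.
  exact: measurable_mx_cst.
- by move=> l _; case: ifP => // _; exact: ltW.
- by rewrite big_ord_recr /= eqxx big1 ?add0r // => l _; rewrite ltn_eqF.
move=> A [mA PA hA]; exists A; split => // w /hA h hb.
have := h _; rewrite big_ord_recr /= eqxx big1 ?add0r; last first.
  by move=> l _; rewrite ltn_eqF // centered0.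
by apply=> l _; case: ifP => // _; rewrite frob0.
Qed.

Variables (kap eta X1 : R).
Hypotheses (eta0 : 0 < eta) (kap0 : 0 < kap) (kap1 : kap <= 1).
Hypotheses (phi20 : 20 <= @ratio R n m) (X11 : 1 <= X1).

(** Three families of events, each indexed by at most m + 1 times. Activity is deterministic, so
    inactive times cost nothing. In the third family [gap_sum2] sums the Frobenius bounds, and 128^2
    is 64^2 times its constant 4. *)
Lemma concentrated_fails th : 0 < th -> th <= 1 / 2 ->
  fails_with P (3 * (m.+1%:R * tail X1)) (fun w => concentrated (z w) m kap eta X1 th).
Proof.
move=> t0 t12; have x10 : 0 < X1 by exact: lt_le_trans X11.
have nR : 0 < n%:R :> R by rewrite ltr0n.
have tail0 : 0 <= tail X1.
  apply: exprn_ge0; apply: mulr_ge0; last by rewrite invr_ge0 sqr_ge0.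
  apply: mulr_ge0; last exact: sqr_ge0.
  by rewrite /Kquad; apply: mulr_ge0 => //; apply: exprn_ge0; exact: le_trans (Kmart_ge1 q).
have facts j k : (j <= k)%N -> (k <= m)%N -> active n m kap eta th k ->
    0 < margin n th j /\ 0 < gap n m kap th j.
  move=> jk km act; have [a' _ _] : [/\ active n m kap eta th j,
    gap n m kap th k <= gap n m kap th j & margin n th k <= margin n th j].
    by apply: active_mono.
  by have /andP[r0 g0] := a'; split=> //; exact: lt_le_trans g0.
have mz j k : (k < j)%N -> @measurable_mx _ (gcyl ent (fun y => (y.2 < j)%N)) R n 1 (z^~ k).
  exact: columns_past.
have h1 : fails_with P (m.+1%:R * tail X1) (fun w => forall k, (k < m.+1)%N -> (k < m)%N ->
   active n m kap eta th k.+1 -> frob (Kmx (z w) th k) <= 16 * n%:R * th ^+ 2 / margin n th k ->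
   centered (Kmx (z w) th k) (z w k) ^+ 2 <=
     X1 ^+ 2 * (n%:R^-1 ^+ 2 * (16 * n%:R * th ^+ 2 / margin n th k))).
  apply: fails_forall => // k _; have [km|] := boolP (k < m)%N; last first.
    by move=> _; exact: fails_always.
  have [act|] := boolP (active n m kap eta th k.+1); last by move=> _; exact: fails_always.
  have [r0 g0] := facts k k.+1 (leqnSn k) km act.
  have b0 : 0 < 16 * n%:R * th ^+ 2 / margin n th k by pos.
  apply: fails_imply (single_tail (fun w => Kmx (z w) th k) k _ X1 km b0 x10 _); first by [].
  exact: (measurable_Kmx _ _ (mz k)).
have h2 : fails_with P (m.+1%:R * tail X1) (fun w => forall k, (k < m.+1)%N -> (k < m)%N ->
   active n m kap eta th k.+1 ->
   frob (K2mx (z w) th k) <= 64 * n%:R * th ^+ 4 / (margin n th k * gap n m kap th k ^+ 2) ->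
   centered (K2mx (z w) th k) (z w k) ^+ 2 <=
     X1 ^+ 2 * (n%:R^-1 ^+ 2 * (64 * n%:R * th ^+ 4 / (margin n th k * gap n m kap th k ^+ 2)))).
  apply: fails_forall => // k _; have [km|] := boolP (k < m)%N; last first.
    by move=> _; exact: fails_always.
  have [act|] := boolP (active n m kap eta th k.+1); last by move=> _; exact: fails_always.
  have [r0 g0] := facts k k.+1 (leqnSn k) km act.
  have b0 : 0 < 64 * n%:R * th ^+ 4 / (margin n th k * gap n m kap th k ^+ 2) by pos.
  apply: fails_imply (single_tail (fun w => K2mx (z w) th k) k _ X1 km b0 x10 _); first by [].
  exact: (measurable_K2mx _ _ (mz k)).
have h3 : fails_with P (m.+1%:R * tail X1) (fun w => forall k, (k < m.+1)%N ->
   active n m kap eta th k ->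
   (forall j, (j < k)%N ->
     frob (Bmx (z w) th j) <= 64 ^+ 2 * th ^+ 4 / (n%:R * (margin n th j * gap n m kap th j ^+ 2))) ->
   (\sum_(j < k) centered (Bmx (z w) th j) (z w j)) ^+ 2 <=
     X1 ^+ 2 * (n%:R^-1 ^+ 2 * (128 ^+ 2 * th ^+ 2 / (margin n th k ^+ 2 * gap n m kap th k)))).
  apply: fails_forall => // k; rewrite ltnS => km.
  have [act|] := boolP (active n m kap eta th k); last by move=> _; exact: fails_always.
  have [r0 g0] := facts k k (leqnn k) km act.
  have b0 : 0 < 128 ^+ 2 * th ^+ 2 / (margin n th k ^+ 2 * gap n m kap th k) by pos.
  have := sum_tail (fun j w => Bmx (z w) th j)
    (fun j => 64 ^+ 2 * th ^+ 4 / (n%:R * (margin n th j * gap n m kap th j ^+ 2)))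
    k _ X1 km b0 x10.
  case.
  - by move=> j jk; exact: (measurable_Bmx _ _ (mz j)).
  - move=> j jk; have [rj gj] := facts j k (ltnW jk) km act.
    by pos.
  - have s2 : \sum_(j < k) (th ^+ 2 / n%:R) / (margin n th j * gap n m kap th j ^+ 2) <=
      4 / (margin n th k ^+ 2 * gap n m kap th k) by apply: (@gap_sum2 R n m kap eta).
    have -> : 128 ^+ 2 * th ^+ 2 / (margin n th k ^+ 2 * gap n m kap th k) =
        64 ^+ 2 * th ^+ 2 * (4 / (margin n th k ^+ 2 * gap n m kap th k)).
      by field; rewrite !gt_eqF.
    apply: le_trans (ler_wpM2l _ s2); last by pos.
    rewrite mulr_sumr le_eqVlt; apply/orP; left; apply/eqP; apply: eq_bigr => j _.
    have [rj gj] := facts j k (ltnW (ltn_ord j)) km act.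
    by field; rewrite !gt_eqF.
  by move=> A [mA PA hA]; exists A; split=> // w nA _; exact: hA.
have := fails_and _ _ _ _ _ h1 (fails_and _ _ _ _ _ h2 h3).
rewrite (_ : 3 * _ = m.+1%:R * tail X1 + (m.+1%:R * tail X1 + m.+1%:R * tail X1)); last by ring.
apply: fails_imply => w [c1 [c2 c3]]; split.
- by move=> k km; apply: c1 => //; exact: ltnW.
- by move=> k km; apply: c2 => //; exact: ltnW.
- by move=> k km; apply: c3.
Qed.

End concentration.

(** * Measurability of the largest singular value *)

Section singular_value.
Context {R : realType}.

Lemma eigenvalue_gram_ge0 n m (M : 'M[R]_(n, m)) x : eigenvalue (M *m M^T) x -> 0 <= x.
Proof.
move=> /eigenvalueP[v vM v0].
have sq (k : nat) (u : 'rV[R]_k) : (u *m u^T) 0 0 = \sum_i u 0 i ^+ 2.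
  by rewrite mxE; apply: eq_bigr => i _; rewrite mxE expr2.
have ge0 (k : nat) (u : 'rV[R]_k) : 0 <= (u *m u^T) 0 0.
  by rewrite sq sumr_ge0 // => i _; exact: sqr_ge0.
have vv : 0 < (v *m v^T) 0 0.
  rewrite lt_def ge0 andbT; apply: contra_neq v0; rewrite sq => /eqP.
  rewrite psumr_eq0 => [/allP h|i _]; last exact: sqr_ge0.
  apply/rowP => i; apply/eqP; rewrite mxE -sqrf_eq0; apply: h.
  exact: mem_index_enum.
have e : x * (v *m v^T) 0 0 = ((v *m M) *m (v *m M)^T) 0 0.
  by rewrite trmx_mul mulmxA -[v *m M *m M^T]mulmxA vM -scalemxAl [RHS]mxE.
by rewrite -(pmulr_lge0 x vv) e ge0.
Qed.

Lemma bernoulli_inequality (h : R) k : 0 <= h -> 1 + k%:R * h <= (1 + h) ^+ k.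
Proof.
move=> h0; elim: k => [|k IH]; first by rewrite mul0r addr0 expr0.
rewrite exprSr; have h1 : 0 <= 1 + h by lra.
apply: le_trans (ler_wpM2r h1 IH); rewrite -natr1.
have : 0 <= k%:R * h * h by rewrite !mulr_ge0.
by lra.
Qed.

(** Traces of powers are polynomials in the entries, so this writes the sublevel sets of the largest
    eigenvalue as countable intersections of measurable sets. For the converse, an eigenvalue (1 +
    t) c with t > 0 would make (1 + t)^p at most n for all p, against Bernoulli's inequality. *)
Lemma sup_eigenvalue_le n m (M : 'M[R]_(n, m)) (c : R) : (0 < n)%N -> 0 <= c ->
  sup [set a : R | eigenvalue (M *m M^T) a] <= c <->
  forall p, \tr (iter p (mulmx (M *m M^T)) 1%:M) <= n%:R * c ^+ p.
Proof.
move=> n0 c0; set A := M *m M^T.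
have As : A^T = A by rewrite trmx_mul trmxK.
have [lam [evE tr _ _ _]] := symmetric_spectral_data n A As.
have lam0 i : 0 <= lam i by apply: (@eigenvalue_gram_ge0 _ _ M); apply/evE; exists i.
set S := [set a | _].
have nS : S !=set0 by exists (lam (Ordinal n0)); apply/evE; exists (Ordinal n0).
have ub : has_ubound S.
  exists (\sum_i lam i) => x /evE[i ->]; rewrite (bigD1 i) //= lerDl.
  by apply: sumr_ge0.
split=> [sc p|h].
  rewrite tr mulr_natl -[n in _ *+ n]card_ord -sumr_const.
  refine (ler_sumR _ _ _ _ _ _ _) => i _; rewrite lerXn2r ?nnegrE //.
  by apply: le_trans sc; apply: ub_le_sup => //; apply/evE; exists i.
apply: ge_sup => // x /evE[i ->]; rewrite leNgt; apply/negP => cl.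
have hp p : lam i ^+ p <= n%:R * c ^+ p.
  apply: le_trans (h p); rewrite tr (bigD1 i) //= lerDl.
  by apply: sumr_ge0 => j _; exact: exprn_ge0.
have [c00|cn0] := eqVneq c 0.
  by have := hp 1%N; rewrite c00 expr1 expr1 mulr0 => l0; move: cl; rewrite c00 ltNge l0.
have cp : 0 < c by rewrite lt_def cn0.
have [t tE] : exists t, lam i / c - 1 = t by eexists.
have t0 : 0 < t by rewrite -tE subr_gt0 ltr_pdivlMr // mul1r.
have hb p : p%:R * t <= n%:R.
  have lE : lam i = (1 + t) * c by rewrite -tE; field.
  have : (1 + t) ^+ p <= n%:R.
    by have := hp p; rewrite lE exprMn ler_pM2r // exprn_gt0.
  by have := bernoulli_inequality t p (ltW t0); lra.
have := hb (Num.truncn (n%:R / t)).+1; apply/negP; rewrite -ltNge -ltr_pdivrMr //.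
exact: truncnS_gt.
Qed.

Lemma measurable_largest_singular_value d (T : measurableType d) n m (M : T -> 'M[R]_(n, m)) :
  (0 < n)%N -> measurable_mx M ->
  measurable_fun setT (fun w => largest_singular_value (M w)).
Proof.
move=> n0 mM; apply: (measurability _ (RGenOInfty.measurableE R)).
move=> _ [_ [x ->] <-]; rewrite setTI.
rewrite preimage_itvoy.
rewrite (_ : [set w | _] = ~` [set w | largest_singular_value (M w) <= x]); last first.
  by apply/seteqP; split => w /=; rewrite ltNge => /negP.
apply: measurableC.
have [x0|x0] := leP 0 x; last first.
  rewrite (_ : [set w | _] = set0) //; apply/seteqP; split => // w /= h.
  by have := le_lt_trans h x0; rewrite ltNge sqrtr_ge0.
rewrite (_ : [set w | _] = \bigcap_p [set w |
    \tr (iter p (mulmx (M w *m (M w)^T)) 1%:M) <= n%:R * (x ^+ 2) ^+ p]).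
  apply: bigcapT_measurable => p.
  rewrite -[X in measurable X]setTI; apply: measurable_fun_le => //.
  apply: measurable_mxtrace.
  elim: p => [|p IH] /=; first exact: measurable_mx_cst.
  apply: measurable_mxM => //; apply: measurable_mxM => //; exact: measurable_mx_tr.
apply/seteqP; split => w /=.
  move=> h p _ /=; move: p; apply/sup_eigenvalue_le => //; first exact: sqr_ge0.
  have : largest_singular_value (M w) <= Num.sqrt (x ^+ 2) by rewrite sqrtr_sqr ger0_norm.
  by rewrite /largest_singular_value ler_sqrt // sqr_ge0.
move=> h; rewrite /largest_singular_value -[x]ger0_norm // -sqrtr_sqr ler_wsqrtr //.
by apply/sup_eigenvalue_le => //; [exact: sqr_ge0|move=> p; exact: (h p)].
Qed.

End singular_value.

(** * Choice of the scales for a fixed size *)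

Section fixed_size.
Context {d : measure_display} {T : measurableType d} {R : realType}.
Context (P : probability T R) (n m : nat) (Z : 'I_n -> 'I_m -> T -> R).
Local Notation E X := (\int[P]_w X w)%R.
Local Notation ent := (fun ij : 'I_n * 'I_m => Z ij.1 ij.2).
Hypothesis mZ : forall i j, measurable_fun setT (Z i j).
Hypothesis indZ : mutually_independent P ent.
Hypothesis aZ : forall i j, all_moments P (Z i j).
Variables (mu : R) (q : nat).
Hypothesis n0 : (0 < n)%N.
Hypothesis EZ : forall i j, E (Z i j) = 0.
Hypothesis EZ2 : forall i j, E (fun w => Z i j w ^+ 2) = n%:R^-1.
Hypothesis mu1 : 1 <= mu.
Hypothesis momZ : forall i j, E (fun w => Z i j w ^+ (2 * q.+1)) <= (mu * n%:R^-1) ^+ q.+1.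
Hypothesis momZ2 : forall i j,
  E (fun w => (Z i j w ^+ 2 - n%:R^-1) ^+ (2 * q.+1)) <= ((mu * n%:R^-1) ^+ 2) ^+ q.+1.

(** Here b stands for n^(-2/3) and a for n^eps. With eta = a^4 b one has n eta^(3/2) = a^6, which
    beats the X of order a^2 in [H1]. Then n^2 eta^4 = a^16 b, so kap = a^17 b is the next power
    that satisfies [H4]. The last factor of a in the final a^18 b absorbs 210, as it absorbs the
    other numerical constants. *)
Lemma singular_value_fails (a b : R) (N : nat) :
  10 ^+ 6 <= a -> 0 < b -> n%:R ^+ 2 * b ^+ 3 = 1 -> a ^+ 24 * b <= 1 ->
  20 <= @ratio R n m -> 2 * (1 + @ratio R n m) ^+ 2 <= N%:R * b ->
  fails_with P (N.+1%:R * (3 * (m.+1%:R * tail mu q a)))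
    (fun w => `|largest_singular_value (\matrix_(i, j) Z i j w) - (@ratio R n m + 1)| <=
      a ^+ 18 * b).
Proof.
move=> a6 b0 nb ab phi20 hN.
have a1 : 1 <= a by lra.
have a0 : 0 < a by lra.
have nR : 0 < n%:R :> R by rewrite ltr0n.
have mono k l : (k <= l)%N -> a ^+ k * b <= a ^+ l * b.
  by move=> kl; rewrite ler_wpM2r ?(ltW b0) // ler_weXn2l.
have ak0 k : 0 < a ^+ k * b by pos.
have [eta etaE] : exists eta, a ^+ 4 * b = eta by eexists.
have [kap kapE] : exists kap, a ^+ 17 * b = kap by eexists.
have eta0 : 0 < eta by rewrite -etaE.
have kap0 : 0 < kap by rewrite -kapE.
have etakap : eta <= kap by rewrite -etaE -kapE mono.
have kap18 : a * kap = a ^+ 18 * b by rewrite -kapE mulrA -exprS.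
have akap : a * kap <= 1 by rewrite kap18; apply: le_trans ab; exact: mono.
have kap6 : 10 ^+ 6 * kap <= 1.
  by apply: le_trans akap; apply: ler_wpM2r => //; exact: ltW.
have kap1 : kap <= 1 by lra.
have eta18 : eta <= 1 / 8 by lra.
have N0 : (0 < N)%N.
  rewrite lt0n; apply/eqP => N00; move: hN; rewrite N00 mul0r.
  have : 1 ^+ 2 <= (1 + @ratio R n m) ^+ 2 by rewrite lerXn2r ?nnegrE; lra.
  by lra.
have X11 := a1.
have [X XE] : exists X, X = 4 * 10 ^+ 5 * a ^+ 2 by eexists.
have H1 : 10 ^+ 5 * X <= n%:R * (eta * Num.sqrt eta).
  have e0 : 0 <= n%:R * (eta * Num.sqrt eta).
    by apply: mulr_ge0; [exact: ltW|apply: mulr_ge0; [exact: ltW|exact: sqrtr_ge0]].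
  have -> : n%:R * (eta * Num.sqrt eta) = a ^+ 6.
    apply/eqP; rewrite -(@eqrXn2 _ 2) //; last by rewrite exprn_ge0 // ltW.
    rewrite !exprMn sqr_sqrtr ?(ltW eta0) // -etaE.
    rewrite [eqbLHS](_ : _ = n%:R ^+ 2 * b ^+ 3 * (a ^+ 6) ^+ 2); last by ring.
    by rewrite nb mul1r; apply/eqP; ring.
  have a2 : (10 ^+ 6) ^+ 2 <= a ^+ 2 by rewrite lerXn2r ?nnegrE // ltW.
  have a46 : (10 ^+ 6) ^+ 2 * a ^+ 2 * 1 <= a ^+ 2 * a ^+ 2 * a ^+ 2.
    apply: ler_pM => //.
    - by pos.
    - by apply: ler_wpM2r => //; pos.
    - by lra.
  rewrite XE; have a20 : 0 < a ^+ 2 by pos.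
  rewrite (_ : a ^+ 6 = a ^+ 2 * a ^+ 2 * a ^+ 2); last by ring.
  by lra.
have H2 : 2 * (1 + @ratio R n m) ^+ 2 <= N%:R * eta.
  apply: le_trans hN _; rewrite ler_wpM2l // -etaE -[leLHS]mul1r.
  by have := mono 0%N 4%N isT; rewrite expr0.
have H4 : 16 * (52 * n%:R * eta ^+ 2) ^+ 2 < kap.
  rewrite (_ : 16 * _ = 16 * 52 ^+ 2 * (a ^+ 16 * b)); last first.
    rewrite -etaE (_ : (52 * _ * _) ^+ 2 = n%:R ^+ 2 * b ^+ 3 * (52 ^+ 2 * (a ^+ 16 * b))); last by ring.
    by rewrite nb mul1r mulrA.
  rewrite -kapE (_ : a ^+ 17 * b = a * (a ^+ 16 * b)); last by ring.
  rewrite ltr_pM2r //.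
  by apply: lt_le_trans a6; lra.
have tail0 : 0 <= tail mu q a.
  apply: exprn_ge0; apply: mulr_ge0; last by rewrite invr_ge0 sqr_ge0.
  apply: mulr_ge0; last exact: sqr_ge0.
  by rewrite /Kquad; apply: mulr_ge0 => //; apply: exprn_ge0; exact: le_trans (Kmart_ge1 q).
have p0 : 0 <= 3 * (m.+1%:R * tail mu q a) by rewrite !mulr_ge0.
have F i : (i < N.+1)%N -> fails_with P (3 * (m.+1%:R * tail mu q a))
    (fun w => (0 < i)%N -> concentrated (columns Z w) m kap eta a (label N i)).
  rewrite ltnS => iN; have [i0|] := boolP (0 < i)%N; last by move=> _; exact: fails_always.
  have [t0 t12] : 0 < label N i :> R /\ label N i <= 1 / 2 :> R.
    by apply: label_bounds; rewrite i0.
  have := concentrated_fails P n m Z mZ indZ aZ mu q n0 EZ EZ2 mu1 momZ momZ2 kap eta a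
    eta0 kap0 kap1 phi20 X11 _ t0 t12.
  exact: fails_imply.
apply: fails_imply (fails_forall P _ _ _ p0 F) => w conc.
have conc' i : (0 < i <= N)%N -> concentrated (columns Z w) m kap eta a (label N i).
  by case/andP => i0 iN; apply: conc.
rewrite /largest_singular_value -gram_columns.
apply: le_trans (singular_value_edge (columns Z w) m N kap eta X a n0 N0 eta0 eta18 etakap
  kap1 phi20 X11 XE H1 H2 H4 conc' kap6) _.
by rewrite -kap18; apply: ler_wpM2r; [exact: ltW|lra].
Qed.

End fixed_size.

(** * Moments of the entries and asymptotics in n *)

Section moment_bounds.
Context {d : measure_display} {T : measurableType d} {R : realType} (P : probability T R).
Local Notation E X := (\int[P]_w X w)%R.

Lemma expectation_Rintegral (X : T -> R) : all_moments P X -> 'E_P[X]%E = (E X)%:E.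
Proof.
by move=> aX; rewrite unlock /Rintegral fineK //; apply: integrable_fin_num => //; exact: am_integrable.
Qed.

Lemma all_moments_even (X : T -> R) (c : nat -> R) : measurable_fun setT X ->
  (forall p, (0 < p)%N -> ('E_P[fun w => (X w ^+ (2 * p))%R] <= (c p)%:E)%E) ->
  all_moments P X.
Proof.
move=> mX cX.
have even k : P.-integrable setT (EFin \o (fun w => X w ^+ (2 * k.+1))).
  apply/integrableP; split; first by apply/measurable_EFinP; exact: measurable_funX.
  apply: le_lt_trans (ltry (c k.+1)); apply: le_trans (cX k.+1 isT); rewrite unlock.
  rewrite le_eqVlt; apply/orP; left; apply/eqP; apply: eq_integral => w _ /=.
  by rewrite ger0_norm // exprM exprn_ge0 // sqr_ge0.
split=> // -[|k]; first exact: (finite_measure_integrable_cst P 1 measurableT).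
have iD : P.-integrable setT (EFin \o (fun w => 1 + X w ^+ (2 * k.+1))).
  have := integrableD measurableT (finite_measure_integrable_cst P 1 measurableT) (even k).
  by apply: eq_integrable.
apply: (integrable_dominated P _ _ _ iD); first exact: measurable_funX.
move=> w; rewrite mulnC exprM -[X w ^+ k.+1 ^+ 2](real_normK (num_real _)).
move: `|_| (normr_ge0 (X w ^+ k.+1)) => y y0; have := sqr_ge0 (y - 1).
by have := sqr_ge0 y; lra.
Qed.

Lemma centered_square_moment (X : T -> R) (v : R) p : all_moments P X -> 0 <= v ->
  E (fun w => (X w ^+ 2 - v) ^+ (2 * p)) <= 4 ^+ p * (E (fun w => X w ^+ (2 * (2 * p))) + v ^+ (2 * p)).
Proof.
move=> aX v0; have aY := am_X P X (2 * (2 * p)) aX.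
apply: le_trans (_ : E (fun w => 4 ^+ p * (X w ^+ (2 * (2 * p)) + v ^+ (2 * p))) <= _).
  apply: E_le.
  - by apply: am_X; apply: am_D; [exact: am_X|exact: am_cst].
  - by apply: am_Z; apply: am_D => //; exact: am_cst.
  - move=> w; apply: le_trans (normrD_even_le _ _ _ _) _.
    rewrite -exprM (_ : (- v) ^+ (2 * p) = v ^+ (2 * p)) //.
    by rewrite exprM sqrrN -exprM.
rewrite E_Z; last by apply: am_D => //; exact: am_cst.
by rewrite E_D ?E_cst //; exact: am_cst.
Qed.

End moment_bounds.

Lemma powR_eventually_ge (R : realType) (c K : R) : 0 < c ->
  exists N : nat, forall n : nat, (N <= n)%N -> (0 < n)%N /\ K <= n%:R `^ c.
Proof.
move=> c0; pose M := Num.max K 1.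
have M1 : 1 <= M by rewrite /M le_max lexx orbT.
exists (Num.truncn (M `^ c^-1)).+1 => n Nn; split; first exact: leq_trans Nn.
have h : M `^ c^-1 <= n%:R.
  by apply: ltW; apply: lt_le_trans (truncnS_gt _) _; rewrite ler_nat.
apply: le_trans (_ : M <= _); first by rewrite /M le_max lexx.
have -> : M = (M `^ c^-1) `^ c by rewrite -powRrM mulVf ?gt_eqF // powRr1 //; lra.
by apply: ge0_ler_powR; rewrite ?nnegrE ?powR_ge0 // ltW.
Qed.

Lemma fails_with_probability d (T : measurableType d) (R : realType) (P : probability T R)
  (p : R) (S : set T) : measurable S -> fails_with P p S -> ((1 - p)%:E <= P S)%E.
Proof.
move=> mS [A [mA PA AS]].
apply: le_trans (_ : (P (~` A) <= _)%E); last first.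
  by apply: le_measure; rewrite ?inE //; exact: measurableC.
by rewrite probability_setC // EFinB leeB.
Qed.

(** The union bound costs n^2 n^(4C), one further power of n pays for [60 * K ^+ q.+1], and D is the
    requested rate: this is the exponent 4C + D + 3. *)
Lemma mul_powR_tail (R : realType) (n q : nat) (C D eps K : R) : (0 < n)%N ->
  4 * C + D + 3 <= 2 * eps * q.+1%:R -> 0 <= K -> 60 * K ^+ q.+1 <= n%:R ->
  60 * (n%:R ^+ 2 * (n%:R `^ C) ^+ 4) * (K / (n%:R `^ eps) ^+ 2) ^+ q.+1 <= n%:R `^ (- D).
Proof.
move=> n0 hq K0 hK; have nR : 0 < n%:R :> R by rewrite ltr0n.
have n1 : 1 <= n%:R :> R by rewrite ler1n.
have nn0 : (n%:R != 0 :> R) by rewrite gt_eqF.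
have pw r : 0 < n%:R `^ r :> R by apply: powR_gt0.
have e1 : (n%:R `^ eps) ^+ 2 ^+ q.+1 = n%:R `^ (2 * eps * q.+1%:R).
  by rewrite -exprM -powR_mulrn ?powR_ge0 // -powRrM; congr (_ `^ _); rewrite natrM; ring.
have e2 : n%:R `^ (4 * C + D + 3) = (n%:R `^ C) ^+ 4 * n%:R `^ D * n%:R ^+ 3.
  rewrite (@powRD R _ (4 * C + D) 3) ?nn0 ?implybT // (@powRD R _ (4 * C) D) ?nn0 ?implybT // powR_mulrn ?ler0n //; congr (_ * _ * _).
  by rewrite -[RHS]powR_mulrn ?powR_ge0 // -powRrM mulrC.
have h : n%:R `^ (4 * C + D + 3) <= n%:R `^ (2 * eps * q.+1%:R) by apply: ler_powR.
rewrite expr_div_n e1 powRN.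
apply: le_trans (_ : 60 * (n%:R ^+ 2 * (n%:R `^ C) ^+ 4) *
  (K ^+ q.+1 / n%:R `^ (4 * C + D + 3)) <= _).
  apply: ler_wpM2l; first by rewrite !mulr_ge0 ?exprn_ge0 // ltW.
  by rewrite ler_wpM2l ?exprn_ge0 // lef_pV2 ?posrE.
rewrite e2 [leLHS](_ : _ = 60 * K ^+ q.+1 / n%:R * (n%:R `^ D)^-1); last first.
  by field; rewrite nn0 !gt_eqF.
rewrite -[leRHS]mul1r; apply: ler_wpM2r; first by rewrite invr_ge0 ltW.
by rewrite ler_pdivrMr // mul1r.
Qed.

(** As m = phi^2 n and 2 (1 + phi)^2 <= 8 y^2, a grid of about 8 y^2 n labels is fine enough once n
    b >= 1. *)
Lemma grid_size (R : realType) (n m : nat) (y b : R) : (0 < n)%N ->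
  20 <= @ratio R n m -> @ratio R n m <= y -> 1 <= n%:R * b ->
  exists N : nat, [/\ 2 * (1 + @ratio R n m) ^+ 2 <= N%:R * b,
    N.+1%:R <= 10 * (y ^+ 2 * n%:R) & m.+1%:R <= 2 * (y ^+ 2 * n%:R)].
Proof.
move=> n0 phi20 phiy nb1; have nR : 0 < n%:R :> R by rewrite ltr0n.
have mE : m%:R = @ratio R n m ^+ 2 * n%:R by rewrite ratio_sqr divfK // gt_eqF.
have [phi phiE] : exists phi, @ratio R n m = phi by eexists.
rewrite phiE in phi20 phiy mE *.
have phi0 : 0 <= phi by lra.
have y20 : 20 <= y by exact: le_trans phiy.
have y0 : 0 <= y by lra.
have b0 : 0 < b by rewrite -(pmulr_rgt0 b nR); lra.
have [x xE] : exists x, y ^+ 2 * n%:R = x by eexists.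
have x1 : 1 <= x.
  rewrite -xE -[leLHS]mulr1; apply: ler_pM => //; last by rewrite ler1n.
  by apply: exprn_ege1; lra.
have x0 : 0 <= 8 * x by lra.
have /andP[h1 h2] := truncn_itv x0.
rewrite xE; exists (Num.truncn (8 * x)).+1; split.
- apply: le_trans (ler_wpM2r (ltW b0) (ltW h2)).
  rewrite -xE (_ : 8 * (y ^+ 2 * _) * b = 2 * ((2 * y) ^+ 2 * (n%:R * b))); last by ring.
  rewrite ler_wpM2l // -[leLHS]mulr1 ler_pM ?sqr_ge0 // lerXn2r ?nnegrE //; lra.
- by rewrite -natr1 -natr1; lra.
- have : m%:R <= x by rewrite mE -xE ler_wpM2r ?(ltW nR) // lerXn2r ?nnegrE.
  by rewrite -natr1; lra.
Qed.

Theorem theorem2p1 (R : realType) (C : R) (hC : 0 < C)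
  (m : nat -> nat) (hm : forall n, (0 < m n)%N)
  (hphi : forall n : nat, (0 < n)%N ->
     (n%:R : R) `^ C^-1 <= phi_ratio R n (m n) /\
     phi_ratio R n (m n) <= (n%:R : R) `^ C)
  (Cp : nat -> R)
  (d : nat -> measure_display) (T : forall n, measurableType (d n))
  (P : forall n, probability (T n) R)
  (Z : forall n, 'I_n -> 'I_(m n) -> T n -> R)
  (hmeas : forall n i j, measurable_fun setT (Z n i j))
  (hindep : forall n, mutually_independent (P n)
     (fun ij : 'I_n * 'I_(m n) => Z n ij.1 ij.2))
  (hiid : forall n, identically_distributed (P n)
     (fun ij : 'I_n * 'I_(m n) => Z n ij.1 ij.2))
  (hmean : forall n i j, ('E_(P n)[Z n i j] = 0)%E)
  (hvar : forall n i j,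
     ('E_(P n)[fun w => (Z n i j w ^+ 2)%R] = ((n%:R : R)^-1)%:E)%E)
  (hmom : forall n i j (p : nat), (0 < p)%N ->
     ('E_(P n)[fun w => (Z n i j w ^+ (2 * p))%R] <= ((Cp p / (n%:R : R) ^+ p)%R)%:E)%E) :
  forall delta : R, 0 < delta ->
  forall D : R, 0 < D ->
  exists N : nat, forall n : nat, (N <= n)%N ->
    measurable [set w : T n |
       (`|largest_singular_value (\matrix_(i, j) Z n i j w)
          - (phi_ratio R n (m n) + 1)|
       <= (n%:R : R) `^ delta / (n%:R : R) `^ (2 / 3))%R] /\
    (((1 - (n%:R : R) `^ (- D))%R)%:E <=
     P n [set w : T n |
       (`|largest_singular_value (\matrix_(i, j) Z n i j w)
          - (phi_ratio R n (m n) + 1)|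
       <= (n%:R : R) `^ delta / (n%:R : R) `^ (2 / 3))%R])%E.
Proof.
move=> delta delta0 D D0.
(* The final error is n^(18 eps - 2/3), and 36 eps <= 1 is the requirement n^(24 eps) n^(-2/3) <= 1
   of [singular_value_fails]. *)
have [eps [eps0 eps18 eps36]] : exists eps : R, [/\ 0 < eps, 18 * eps <= delta & 36 * eps <= 1].
  exists (Num.min delta (1 / 2) / 18); split.
  - by rewrite divr_gt0 // lt_min delta0 /=; lra.
  - have : Num.min delta (1 / 2) <= delta by rewrite ge_min lexx.
    by lra.
  - have : Num.min delta (1 / 2) <= 1 / 2 by rewrite ge_min lexx orbT.
    by lra.
(* The order of the moments is fixed here, before n, so the constants [Cp q.+1] and [Cp (2 * q.+1)]
   are the only moment constants needed for the tail bounds. *)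
have [q hq] : exists q : nat, 4 * C + D + 3 <= 2 * eps * q.+1%:R.
  exists (Num.truncn ((4 * C + D + 3) / (2 * eps))).
  rewrite [leRHS]mulrC -ler_pdivrMr; last by lra.
  by apply: ltW; exact: truncnS_gt.
pose c1 := Cp q.+1; pose c2 := Cp (2 * q.+1)%N.
(* One constant for both moment bounds: [c1] serves the entries, and [c2], of doubled order, their
   centered squares, where the factor 4 comes from splitting the power of a difference. *)
have [mu muE] : exists mu, mu = 4 * (1 + `|c1| + `|c2|) by eexists.
have c10 := normr_ge0 c1; have c20 := normr_ge0 c2.
have mu1 : 1 <= mu by lra.
have [K KE] : exists K, K = Kquad q * mu ^+ 2 by eexists.
have K0 : 0 <= K.
  rewrite KE; apply: mulr_ge0; last exact: sqr_ge0.
  by rewrite /Kquad; apply: mulr_ge0 => //; apply: exprn_ge0; exact: le_trans (Kmart_ge1 q).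
have [N1 HN1] := powR_eventually_ge R eps (10 ^+ 6) eps0.
have CV0 : 0 < C^-1 by rewrite invr_gt0.
have [N2 HN2] := powR_eventually_ge R C^-1 20 CV0.
have [N3 HN3] := powR_eventually_ge R 1 (60 * K ^+ q.+1) ltr01.
exists (maxn N1 (maxn N2 N3)) => n; rewrite !geq_max => /and3P[n1 n2 n3].
have [n0 {}HN1] := HN1 n n1; have [_ {}HN2] := HN2 n n2; have [_ {}HN3] := HN3 n n3.
rewrite powRr1 ?ler0n // in HN3.
have nR : 0 < n%:R :> R by rewrite ltr0n.
have nR1 : 1 <= n%:R :> R by rewrite ler1n.
have pw r : 0 < n%:R `^ r :> R by apply: powR_gt0.
have [phi_low phi_up] := hphi n n0.
have phi20 : 20 <= @ratio R n (m n) by exact: le_trans HN2 phi_low.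
have aZ i j : all_moments (P n) (Z n i j).
  by apply: (all_moments_even _ _ (fun p => Cp p / n%:R ^+ p)) => // p; exact: hmom.
have EZ i j : (\int[P n]_w Z n i j w)%R = 0.
  by have := hmean n i j; rewrite expectation_Rintegral // => -[].
have EZ2 i j : (\int[P n]_w (Z n i j w ^+ 2))%R = n%:R^-1.
  by have := hvar n i j; rewrite expectation_Rintegral; [case|exact: am_X].
have mom i j p : (0 < p)%N -> (\int[P n]_w (Z n i j w ^+ (2 * p)))%R <= Cp p / n%:R ^+ p.
  move=> p0; have := hmom n i j p p0.
  by rewrite expectation_Rintegral ?lee_fin //; exact: am_X.
have momZ i j : (\int[P n]_w (Z n i j w ^+ (2 * q.+1)))%R <= (mu * n%:R^-1) ^+ q.+1.
  apply: le_trans (mom i j q.+1 isT) _.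
  rewrite exprMn exprVn ler_wpM2r ?invr_ge0 ?exprn_ge0 ?ler0n // -/c1.
  apply: le_trans (_ : mu <= _); first by have := ler_norm c1; lra.
  exact: ler_eXnr.
have momZ2 i j : (\int[P n]_w ((Z n i j w ^+ 2 - n%:R^-1) ^+ (2 * q.+1)))%R <=
    ((mu * n%:R^-1) ^+ 2) ^+ q.+1.
  have nV0 : 0 <= n%:R^-1 :> R by rewrite invr_ge0 ler0n.
  apply: le_trans (centered_square_moment _ _ _ _ (aZ i j) nV0) _.
  have h := mom i j (2 * q.+1)%N isT.
  rewrite -exprM exprMn exprVn.
  have W0 : 0 <= (n%:R ^+ (2 * q.+1))^-1 :> R by rewrite invr_ge0 exprn_ge0 ?ler0n.
  apply: le_trans (_ : 4 ^+ q.+1 * ((1 + `|c2|) / n%:R ^+ (2 * q.+1)) <= _).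
    apply: ler_wpM2l; first exact: exprn_ge0.
    have := ler_wpM2r W0 (ler_norm c2); rewrite /c2 mulrDl mul1r; move: h; lra.
  rewrite mulrA ler_wpM2r // exprM.
  apply: le_trans (_ : (4 * (1 + `|c2|)) ^+ q.+1 <= _).
    rewrite exprMn; apply: ler_wpM2l; first exact: exprn_ge0.
    by apply: ler_eXnr => //; rewrite lerDl.
  have cc : 0 <= 4 * (1 + `|c2|) by lra.
  apply: lerXn2r; rewrite ?nnegrE //; first exact: sqr_ge0.
  have : mu * 1 <= mu * mu by rewrite ler_wpM2l //; lra.
  by rewrite expr2; lra.
have [y yE] : exists y, y = n%:R `^ C :> R by eexists.
have y20 : 20 <= y by rewrite yE; exact: le_trans phi20 phi_up.
have y0 : 0 < y by lra.
have phiy : @ratio R n (m n) <= y by rewrite yE.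
have [b bE] : exists b, b = (n%:R `^ (2 / 3))^-1 :> R by eexists.
have b0 : 0 < b by rewrite bE invr_gt0.
have nb1 : 1 <= n%:R * b.
  rewrite bE ler_pdivlMr // mul1r -[leRHS]powRr1 ?ler0n //.
  by apply: ler_powR => //; lra.
have nb : n%:R ^+ 2 * b ^+ 3 = 1.
  rewrite bE exprVn -[(_ `^ _) ^+ 3]powR_mulrn ?powR_ge0 // -powRrM (_ : 2 / 3 * 3 = 2); last by field.
  by rewrite powR_mulrn ?ler0n // divff // expf_neq0 // gt_eqF.
have apow k : (n%:R `^ eps) ^+ k = n%:R `^ (k%:R * eps) :> R.
  by rewrite -powR_mulrn ?powR_ge0 // -powRrM mulrC.
have ab : (n%:R `^ eps) ^+ 24 * b <= 1.
  rewrite bE ler_pdivrMr // mul1r apow; apply: ler_powR => //; lra.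
have [N [hN Nup mup]] := grid_size R n (m n) y b n0 phi20 phiy nb1.
have fails := singular_value_fails (P n) n (m n) (Z n) (hmeas n) (hindep n) aZ mu q n0 EZ EZ2
  mu1 momZ momZ2 _ b N HN1 b0 nb ab phi20 hN.
set S := [set w | _].
have mS : measurable S.
  rewrite -[X in measurable X]setTI; apply: measurable_fun_le => //.
  apply: measurableT_comp => //; apply: measurable_funB => //.
  apply: measurable_largest_singular_value => // i j.
  by under eq_fun do rewrite mxE; exact: hmeas.
split=> //.
have {}fails : fails_with (P n) (n%:R `^ (- D)) S.
  have [A [mA PA hA]] := fails; exists A; split => //.
    apply: le_trans PA _; rewrite lee_fin.
    apply: le_trans (mul_powR_tail R n q C D eps K n0 hq K0 HN3).
    rewrite -yE /tail -KE.
    rewrite (_ : 60 * _ = 10 * (y ^+ 2 * n%:R) * (3 * (2 * (y ^+ 2 * n%:R)))); last by ring.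
    have t0 : 0 <= (K / (n%:R `^ eps) ^+ 2) ^+ q.+1.
      by rewrite exprn_ge0 // divr_ge0 // exprn_ge0 // powR_ge0.
    rewrite [leLHS](_ : _ = N.+1%:R * (3 * (m n).+1%:R) *
      (K / (n%:R `^ eps) ^+ 2) ^+ q.+1); last by ring.
    apply: ler_wpM2r => //; by apply: ler_pM => //; apply: ler_wpM2l.
  move=> w /hA h; apply: le_trans h _.
  rewrite bE apow; apply: ler_wpM2r; first by rewrite invr_ge0 ltW.
  exact: ler_powR.
exact: fails_with_probability.
Qed.
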